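(* Let $n\ge2$, $k\ge0$ and let $\Gamma(\vec{x})\cup\Delta(\vec{x})\subseteq\hat{\Pi}_k^b(\#_n)$. Then $T^k_n\vdash\Gamma(\vec{x})\Rightarrow\Delta(\vec{x})$ if and only if $\Gamma\rhd_d^{(\hat{\Pi}_k^b(\#_n),\,\mathrm{PV}(\#_n))}\Delta$. Specifically, for $n=2$: $T^k_2\vdash\Gamma(\vec{x})\Rightarrow\Delta(\vec{x})$ if and only if $\Gamma\rhd_d^{(\hat{\Pi}_k^b,\,\mathrm{PV})}\Delta$.
   Context: **Theories.** $x\#_2y=2^{|x|\cdot|y|}$ and $x\#_{m+1}y=2^{|x|\#_m|y|}$. $\mathrm{PV}$ is Cook's theory of polynomial time functions, formulated as a universal first-order theory with a function symbol for each Cobham-style definition of a polytime function; $\mathrm{PV}(\#_n)$ is the analogous universal theory in which the smash functions up to $\#_n$ are available as initial functions (so $\mathrm{PV}(\#_2)=\mathrm{PV}$). Its language includes $0,1,+,-,\cdot,\lfloor\frac{\cdot}{\cdot}\rfloor,\le$, where $x-y$ is truncated subtraction and $\lfloor\frac{x}{y}\rfloor$ denotes $\lfloor x/(y+1)\rfloor$. $\hat\Pi^b_k(\#_n)$ is $\Pi_k(\Phi)$ (defined below) with $\Phi$ the class of sharply bounded formulas of the language with $\#_n$ (quantifiers of the form $Qy\le|t|$ only); $\hat\Pi^b_k=\hat\Pi^b_k(\#_2)$. $T^k_n$ is Buss's theory of bounded arithmetic over the language with $\#_n$, axiomatized by the basic axioms and the usual induction $A(0)\wedge\forall x(A(x)\to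 A(x+1))\to\forall x\,A(x)$ for $A\in\hat\Pi^b_k(\#_n)$; as usual it is identified with its extension by the function symbols and axioms of $\mathrm{PV}(\#_n)$, which may then occur in induction formulas. A theory proves $\Gamma\Rightarrow\Delta$ iff it proves $\bigwedge\Gamma\to\bigvee\Delta$. **Hierarchy.** $\Pi_0(\Phi)=\Sigma_0(\Phi)=\Phi$; $\Sigma_{k+1}(\Phi)$ consists of formulas with a block of bounded existential quantifiers in front of a $\Pi_k(\Phi)$ formula, and $\Pi_{k+1}(\Phi)$ of formulas with a block of bounded universal quantifiers in front of a $\Sigma_k(\Phi)$ formula. Boolean combinations such as $\bigwedge\Gamma$, $\bigvee\Delta$ are replaced by equivalent prenex formulas in the relevant class. **Deterministic reductions** (over a base theory $\mathcal{B}$). For $A,B$ both in $\Pi_k(\Phi)$ or both in $\Sigma_k(\Phi)$ and a sequence of terms $F=(F_i)_{i=1}^k$ of the language of $\mathcal B$, define $A\le_d^{F,k}B$ by recursion on $k$. For $k=0$: $F$ is empty and $\mathcal{B}\vdash A\to B$. If $A=\forall\vec u\le\vec p(\vec x)\,C(\vec x,\vec u)$, $B=\forall\vec v\le\vec q(\vec x)\,D(\vec x,\vec v)$: $A\le_d^{F,k+1}B$ iff $\mathcal{B}\vdash\vec v\le\vec q(\vec x)\to F_{k+1}(\vec x,\vec v)\le\vec p(\vec x)$ and $\big(F_{k+1}(\vec x,\vec v)\le\vec p(\vec x)\to C(\vec x,F_{k+1}(\vec x,\vec v))\big)\le_d^{\hat F,k}\big(\vec v\le\vec q(\vec x)\to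 D(\vec x,\vec v)\big)$ with $\hat F=(F_i)_{i=1}^{k}$. If $A=\exists\vec u\le\vec p(\vec x)\,C$, $B=\exists\vec v\le\vec q(\vec x)\,D$: iff $\mathcal{B}\vdash\vec u\le\vec p(\vec x)\to F_{k+1}(\vec x,\vec u)\le\vec q(\vec x)$ and $\big(\vec u\le\vec p(\vec x)\wedge C(\vec x,\vec u)\big)\le_d^{\hat F,k}\big(F_{k+1}(\vec x,\vec u)\le\vec q(\vec x)\wedge D(\vec x,F_{k+1}(\vec x,\vec u))\big)$. $A\equiv_d^{(E_0,E_1)}B$ means $A\le_d^{E_0}B$ and $B\le_d^{E_1}A$. **Deterministic flow.** $A\rhd_d^{(\Pi_k(\Phi),\mathcal{B})}B$ (for $A,B\in\Pi_k(\Phi)$) means there are a term $t(\vec x)$, a formula $H(u,\vec x)\in\Pi_k(\Phi)$ and sequences of terms $E_0,E_1,G_0,G_1,F(u)$ such that, provably in $\mathcal{B}$: $H(0,\vec x)\equiv_d^{(E_0,E_1)}A(\vec x)$; $H(t(\vec x),\vec x)\equiv_d^{(G_0,G_1)}B(\vec x)$; and for all $u<t(\vec x)$, $H(u,\vec x)\le_d^{F(u)}H(u+1,\vec x)$. $\Gamma\rhd_d\Delta$ means $\bigwedge\Gamma\rhd_d\bigvee\Delta$. *)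

(* Defs.v *)
From mathcomp Require Import all_boot.
From Stdlib Require List.

Set Implicit Arguments.
Unset Strict Implicit.
Unset Printing Implicit Defensive.

(* Function symbols of PV(#_n), indexed by their arity: one for each
   Cobham-style definition.  [fDiv] is |_ x / (y + 1) _| and [fSub] is truncated
   subtraction.  [fRec g h0 h1 b] is bounded recursion on notation on the first
   argument; its values are cut off at [b] (see [pv_rec0], [pv_recE], [pv_recO]),
   so that no proof of the bound has to be part of the symbol. *)
Inductive fsym (n : nat) : nat -> Type :=
| fZero : fsym n 0
| fOne : fsym n 0
| fLen : fsym n 1
| fAdd : fsym n 2
| fSub : fsym n 2
| fMul : fsym n 2
| fDiv : fsym n 2
| fSmash (i : nat) of 1 < i <= n : fsym n 2
| fProj (m : nat) of 'I_m : fsym n m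
| fComp (m l : nat) of fsym n m & ('I_m -> fsym n l) : fsym n l
| fRec (m : nat) of fsym n m & fsym n m.+2 & fsym n m.+2 & fsym n m.+1 :
    fsym n m.+1.

Arguments fZero {n}.
Arguments fOne {n}.
Arguments fLen {n}.
Arguments fAdd {n}.
Arguments fSub {n}.
Arguments fMul {n}.
Arguments fDiv {n}.
Arguments fSmash {n} i _.
Arguments fProj {n m} _.
Arguments fComp {n m l} _ _.
Arguments fRec {n m} _ _ _ _.

(* Variables are de Bruijn indices. *)
Inductive term (n : nat) : Type :=
| Var of nat
| App (m : nat) of fsym n m & ('I_m -> term n).

Arguments Var {n} _.
Arguments App {n m} _ _.

Inductive form (n : nat) : Type :=
| Bot
| Eq of term n & term n
| Le of term n & term n
| Imp of form n & form n
| And of form n & form n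
| Or of form n & form n
| All of form n
| Ex of form n.

Arguments Bot {n}.

(* Only used with size ts = m. *)
Definition ap n m (f : fsym n m) (ts : seq (term n)) : term n :=
  App f (fun i : 'I_m => nth (Var 0) ts i).

Declare Scope pv_scope.
Delimit Scope pv_scope with pv.
Bind Scope pv_scope with term.
Bind Scope pv_scope with form.

(* x < y is read as x + 1 <= y. *)
Notation "0" := (ap fZero [::]) : pv_scope.
Notation "1" := (ap fOne [::]) : pv_scope.
Notation "2" := (ap fAdd [:: ap fOne [::]; ap fOne [::]]) : pv_scope.
Notation "x + y" := (ap fAdd [:: x; y]) : pv_scope.
Notation "x - y" := (ap fSub [:: x; y]) : pv_scope.
Notation "x * y" := (ap fMul [:: x; y]) : pv_scope.
Notation "x == y" := (Eq x y) : pv_scope.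
Notation "x <= y" := (Le x y) : pv_scope.
Notation "x < y" := (Le (ap fAdd [:: x; ap fOne [::]]) y) : pv_scope.
Notation "A -> B" := (Imp A B) : pv_scope.
Notation "A /\ B" := (And A B) : pv_scope.
Notation "A \/ B" := (Or A B) : pv_scope.
Notation "~ A" := (Imp A Bot) : pv_scope.
Notation "A <-> B" := (And (Imp A B) (Imp B A)) : pv_scope.

Definition len n (x : term n) : term n := ap fLen [:: x].
Definition div1 n (x y : term n) : term n := ap fDiv [:: x; y].
Definition half n (x : term n) : term n := div1 x 1.
Definition smash n i (h : 1 < i <= n) (x y : term n) : term n :=
  ap (fSmash i h) [:: x; y].
Definition tmin n (x y : term n) : term n := (x - (x - y))%pv.

Definition Top n : form n := Imp Bot Bot.

Fixpoint tsub n (s : nat -> term n) (t : term n) : term n :=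
  match t with
  | Var i => s i
  | App _ f a => App f (fun i => tsub s (a i))
  end.

Definition tshift n (l : nat) : term n -> term n :=
  tsub (fun i => Var (l + i)).

Definition scons n (t : term n) (s : nat -> term n) (i : nat) : term n :=
  if i is j.+1 then s j else t.

Definition up n (s : nat -> term n) : nat -> term n :=
  scons (Var 0) (fun i => tshift 1 (s i)).

Fixpoint fsub n (s : nat -> term n) (A : form n) : form n :=
  match A with
  | Bot => Bot
  | Eq t u => Eq (tsub s t) (tsub s u)
  | Le t u => Le (tsub s t) (tsub s u)
  | Imp B C => Imp (fsub s B) (fsub s C)
  | And B C => And (fsub s B) (fsub s C)
  | Or B C => Or (fsub s B) (fsub s C)
  | All B => All (fsub (up s) B)
  | Ex B => Ex (fsub (up s) B)
  end.

Definition fshift n (l : nat) : form n -> form n :=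
  fsub (fun i => Var (l + i)).

Definition inst n (t : term n) : form n -> form n := fsub (scons t Var).

(* Classical natural deduction with equality.  An axiom may be used under any
   hypotheses, hence free variables of axioms are universally quantified. *)
Inductive prv n (T : form n -> Prop) : seq (form n) -> form n -> Prop :=
| prv_ax G A : T A -> prv T G A
| prv_hyp G A : List.In A G -> prv T G A
| prv_raa G A : prv T ((~ A)%pv :: G) Bot -> prv T G A
| prv_impI G A B : prv T (A :: G) B -> prv T G (Imp A B)
| prv_impE G A B : prv T G (Imp A B) -> prv T G A -> prv T G B
| prv_andI G A B : prv T G A -> prv T G B -> prv T G (And A B)
| prv_andE1 G A B : prv T G (And A B) -> prv T G A
| prv_andE2 G A B : prv T G (And A B) -> prv T G B
| prv_orI1 G A B : prv T G A -> prv T G (Or A B)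
| prv_orI2 G A B : prv T G B -> prv T G (Or A B)
| prv_orE G A B C : prv T G (Or A B) -> prv T (A :: G) C ->
    prv T (B :: G) C -> prv T G C
| prv_allI G A : prv T (map (fshift 1) G) A -> prv T G (All A)
| prv_allE G A t : prv T G (All A) -> prv T G (inst t A)
| prv_exI G A t : prv T G (inst t A) -> prv T G (Ex A)
| prv_exE G A C : prv T G (Ex A) ->
    prv T (A :: map (fshift 1) G) (fshift 1 C) -> prv T G C
| prv_refl G t : prv T G (Eq t t)
| prv_eqE G A t u : prv T G (Eq t u) -> prv T G (inst t A) ->
    prv T G (inst u A).

Definition proves n (T : form n -> Prop) (A : form n) : Prop := prv T [::] A.

Definition proves_seq n (T : form n -> Prop) (Gamma Delta : seq (form n)) :
    Prop :=
  proves T (foldr (@And n) (Top n) Gamma -> foldr (@Or n) Bot Delta)%pv.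

(* Buss's BASIC, with S x written x + 1. *)
Inductive basic_ax (n : nat) : form n -> Prop :=
| basic1 x y : basic_ax (y <= x -> y <= x + 1)%pv
| basic2 x : basic_ax (~ (x == x + 1))%pv
| basic3 x : basic_ax (0 <= x)%pv
| basic4 x y : basic_ax ((x <= y /\ ~ (x == y)) <-> (x + 1 <= y))%pv
| basic5 x : basic_ax (~ (x == 0) -> ~ (2 * x == 0))%pv
| basic6 x y : basic_ax (y <= x \/ x <= y)%pv
| basic7 x y : basic_ax (x <= y /\ y <= x -> x == y)%pv
| basic8 x y z : basic_ax (x <= y /\ y <= z -> x <= z)%pv
| basic9 : basic_ax (len 0 == 0)%pv
| basic10 x : basic_ax (~ (x == 0) ->
    len (2 * x) == len x + 1 /\ len (2 * x + 1) == len x + 1)%pv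
| basic11 : basic_ax (len 1 == 1)%pv
| basic12 x y : basic_ax (x <= y -> len x <= len y)%pv
| basic13 x y (h : 1 < 2 <= n) :
    basic_ax (len (smash h x y) == len x * len y + 1)%pv
| basic14 y (h : 1 < 2 <= n) : basic_ax (smash h 0 y == 1)%pv
| basic15 x (h : 1 < 2 <= n) : basic_ax (~ (x == 0) ->
    smash h 1 (2 * x) == 2 * smash h 1 x /\
    smash h 1 (2 * x + 1) == 2 * smash h 1 x)%pv
| basic16 x y (h : 1 < 2 <= n) : basic_ax (smash h x y == smash h y x)%pv
| basic17 x y z (h : 1 < 2 <= n) :
    basic_ax (len x == len y -> smash h x z == smash h y z)%pv
| basic18 x y u v (h : 1 < 2 <= n) :
    basic_ax (len x == len u + len v ->
              smash h x y == smash h u y * smash h v y)%pv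
| basic19 x y : basic_ax (x <= x + y)%pv
| basic20 x y : basic_ax (x <= y /\ ~ (x == y) ->
    2 * x + 1 <= 2 * y /\ ~ (2 * x + 1 == 2 * y))%pv
| basic21 x y : basic_ax (x + y == y + x)%pv
| basic22 x : basic_ax (x + 0 == x)%pv
| basic23 x y : basic_ax (x + (y + 1) == (x + y) + 1)%pv
| basic24 x y z : basic_ax ((x + y) + z == x + (y + z))%pv
| basic25 x y z : basic_ax ((x + y <= x + z) <-> (y <= z))%pv
| basic26 x : basic_ax (x * 0 == 0)%pv
| basic27 x y : basic_ax (x * (y + 1) == x * y + x)%pv
| basic28 x y : basic_ax (x * y == y * x)%pv
| basic29 x y z : basic_ax (x * (y + z) == x * y + x * z)%pv
| basic30 x y z : basic_ax (1 <= x -> (x * y <= x * z) <-> (y <= z))%pv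
| basic31 x : basic_ax (~ (x == 0) -> len x == len (half x) + 1)%pv
| basic32 x y : basic_ax ((x == half y) <-> (2 * x == y \/ 2 * x + 1 == y))%pv.

Fixpoint qfree n (A : form n) : bool :=
  match A with
  | Bot | Eq _ _ | Le _ _ => true
  | Imp B C | And B C | Or B C => (qfree B && qfree C)%B
  | All _ | Ex _ => false
  end.

(* PV(#_n); every axiom is quantifier-free.  [pv_smash_lenS] and [pv_smash_min]
   say that x #_(i+1) y is the least number of length |x| #_i |y| + 1, that is
   2 ^ (|x| #_i |y|).  [pv_recE] excludes 2 * y = 0, where [pv_rec0] applies.
   Cook's rule of induction on notation appears as [pv_ind]: a quantifier-free
   formula (with induction variable 0) obtained by it is again an axiom. *)
Inductive PV_ax (n : nat) : form n -> Prop :=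
| pv_basic A : basic_ax A -> PV_ax A
| pv_sub0 x y : PV_ax (x <= y -> x - y == 0)%pv
| pv_subK x y : PV_ax (y <= x -> (x - y) + y == x)%pv
| pv_div_le x y : PV_ax (div1 x y * (y + 1) <= x)%pv
| pv_div_lt x y : PV_ax (x < (div1 x y + 1) * (y + 1))%pv
| pv_smash_lenS x y i (h : 1 < i <= n) (h' : 1 < i.+1 <= n) :
    PV_ax (len (smash h' x y) == smash h (len x) (len y) + 1)%pv
| pv_smash_min x y z i (h : 1 < i <= n) :
    PV_ax (len (smash h x y) <= len z -> smash h x y <= z)%pv
| pv_proj m (i : 'I_m) (xs : m.-tuple (term n)) :
    PV_ax (ap (fProj i) xs == tnth xs i)%pv
| pv_comp m l (g : fsym n m) (h : 'I_m -> fsym n l) (xs : l.-tuple (term n)) :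
    PV_ax (ap (fComp g h) xs == App g (fun j => ap (h j) xs))%pv
| pv_rec0 m (g : fsym n m) h0 h1 b (xs : m.-tuple (term n)) :
    let f := fRec g h0 h1 b in
    PV_ax (ap f (0%pv :: xs) == tmin (ap g xs) (ap b (0%pv :: xs)))%pv
| pv_recE m (g : fsym n m) h0 h1 b y (xs : m.-tuple (term n)) :
    let f := fRec g h0 h1 b in
    let y' := (2 * y)%pv in
    PV_ax (~ (y == 0) ->
      ap f (y' :: xs) ==
      tmin (ap h0 [:: y, ap f (y :: xs) & xs]) (ap b (y' :: xs)))%pv
| pv_recO m (g : fsym n m) h0 h1 b y (xs : m.-tuple (term n)) :
    let f := fRec g h0 h1 b in
    let y' := (2 * y + 1)%pv in
    PV_ax (ap f (y' :: xs) ==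
      tmin (ap h1 [:: y, ap f (y :: xs) & xs]) (ap b (y' :: xs)))%pv
| pv_ind A : qfree A -> proves (@PV_ax n) (inst 0 A) ->
    proves (@PV_ax n)
      (fsub (scons (half (Var 0)) (fun i => Var i.+1)) A -> A) ->
    PV_ax A.

Definition ball n (t : term n) (A : form n) : form n :=
  All (Var 0 <= tshift 1 t -> A).

Definition bex n (t : term n) (A : form n) : form n :=
  Ex (Var 0 <= tshift 1 t /\ A).

Inductive sharply_bounded n : form n -> Prop :=
| sb_bot : sharply_bounded Bot
| sb_eq t u : sharply_bounded (Eq t u)
| sb_le t u : sharply_bounded (Le t u)
| sb_imp A B : sharply_bounded A -> sharply_bounded B ->
    sharply_bounded (Imp A B)
| sb_and A B : sharply_bounded A -> sharply_bounded B ->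
    sharply_bounded (And A B)
| sb_or A B : sharply_bounded A -> sharply_bounded B ->
    sharply_bounded (Or A B)
| sb_ball t A : sharply_bounded A -> sharply_bounded (ball (len t) A)
| sb_bex t A : sharply_bounded A -> sharply_bounded (bex (len t) A).

(* A prenex formula with k alternating blocks of bounded quantifiers, outermost
   block first: the bounds of each block, then the matrix.  Whether it is read in
   Pi_k or in Sigma_k is the boolean argument of [pform] (true for Pi_k).  A block
   with bounds ps binds the variables i < size ps, the variable i being bounded
   by the i-th entry of ps, a term in which no variable of the block occurs. *)
Fixpoint prenex (n k : nat) : Type :=
  if k is j.+1 then (seq (term n) * prenex n j)%type else form n.

Fixpoint block n (q : term n -> form n -> form n) (ps : seq (term n))
    (A : form n) : form n :=
  if ps is p :: ps' then block q ps' (q (tshift (size ps') p) A) else A.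

Fixpoint pform n k (pi : bool) : prenex n k -> form n :=
  if k is j.+1 return prenex n k -> form n then
    fun A => block (if pi then @ball n else @bex n) A.1 (pform (~~ pi)%B A.2)
  else id.

Fixpoint matrix n k : prenex n k -> form n :=
  if k is j.+1 return prenex n k -> form n then fun A => matrix A.2 else id.

Definition in_class n k (Phi : form n -> Prop) (A : prenex n k) : Prop :=
  Phi (matrix A).

Fixpoint psub n k (s : nat -> term n) : prenex n k -> prenex n k :=
  if k is j.+1 return prenex n k -> prenex n k then
    fun A => (map (tsub s) A.1, psub (iter (size A.1) (@up n) s) A.2)
  else fsub s.

(* Prenex form of [op g A], where [op] is [And] or [Imp]. *)
Fixpoint guard n k (op : form n -> form n -> form n) (g : form n) :
    prenex n k -> prenex n k :=
  if k is j.+1 return prenex n k -> prenex n k then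
    fun A => (A.1, guard op (fshift (size A.1) g) A.2)
  else op g.

(* Prenex form of [op A B], where [op] is [And] or [Or]: blocks of the same level
   are concatenated. *)
Fixpoint pop2 n k (op : form n -> form n -> form n) :
    prenex n k -> prenex n k -> prenex n k :=
  if k is j.+1 return prenex n k -> prenex n k -> prenex n k then
    fun A B =>
      let l := size A.1 in
      let r := size B.1 in
      (A.1 ++ B.1,
       pop2 op (psub (fun i => Var (if i < l then i else r + i)) A.2)
               (psub (fun i => Var (l + i)) B.2))
  else op.

Fixpoint pmat n k (A : form n) : prenex n k :=
  if k is j.+1 return prenex n k then ([::], pmat j A) else A.

Definition pAnd n k (Gamma : seq (prenex n k)) : prenex n k :=
  foldr (pop2 (@And n)) (pmat k (Top n)) Gamma.

Definition pOr n k (Delta : seq (prenex n k)) : prenex n k :=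
  foldr (pop2 (@Or n)) (pmat k Bot) Delta.

(* T^k_n, in the language of PV(#_n). *)
Inductive T_ax (n k : nat) : form n -> Prop :=
| T_pv A : PV_ax A -> T_ax k A
| T_ind (P : prenex n k) : in_class (@sharply_bounded n) P ->
    let A := pform true P in
    T_ax k (inst 0 A /\
            All (A -> fsub (scons (Var 0 + 1) (fun i => Var i.+1)) A)
            -> All A)%pv.

Definition block_vars n (l : nat) : seq (term n) := mkseq (fun i => Var i) l.

Definition les n (ts ps : seq (term n)) : form n :=
  foldr (fun tp => And (Le tp.1 tp.2)) (Top n) (zip ts ps).

(* From the context of a block of [size ts] variables to that of a block of [l]
   variables, substituting the terms ts for the former. *)
Definition block_sub n (ts : seq (term n)) (l i : nat) : term n :=
  if i < size ts then nth (Var 0) ts i else Var (l + (i - size ts)).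

(* A <=_d^{F,k} B over the base theory T, for A and B in Pi_k ([pi] true) or
   Sigma_k ([pi] false), under the additional hypothesis [g], which serves for
   "for all u < t" in a flow.  F i is the tuple of terms F_i, 1 <= i <= k. *)
Fixpoint dred n (T : form n -> Prop) (F : nat -> seq (term n)) (k : nat)
    (pi : bool) (g : form n) : prenex n k -> prenex n k -> Prop :=
  if k is j.+1 return prenex n k -> prenex n k -> Prop then
    fun A B =>
      let (p, C) := A in
      let (q, D) := B in
      let f := F j.+1 in
      if pi then
        let l := size q in
        let g' := fshift l g in
        let in_q := les (block_vars n l) (map (tshift l) q) in
        let in_p := les f (map (tshift l) p) in
        [/\ size f = size p,
            proves T (g' -> in_q -> in_p) &
            dred T F (~~ pi)%B g' (guard (@Imp n) in_p (psub (block_sub f l) C))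
                 (guard (@Imp n) in_q D)]
      else
        let l := size p in
        let g' := fshift l g in
        let in_p := les (block_vars n l) (map (tshift l) p) in
        let in_q := les f (map (tshift l) q) in
        [/\ size f = size q,
            proves T (g' -> in_p -> in_q) &
            dred T F (~~ pi)%B g' (guard (@And n) in_p C)
                 (guard (@And n) in_q (psub (block_sub f l) D))]
  else fun A B => proves T (g -> A -> B).

Definition dequiv n (T : form n -> Prop) (E0 E1 : nat -> seq (term n)) k
    (A B : prenex n k) : Prop :=
  dred T E0 true (Top n) A B /\ dred T E1 true (Top n) B A.

(* A |>_d B for the class Pi_k(Phi) and the base theory T.  In H the variable 0
   is u, and the variables x of A, B and t are shifted by one. *)
Definition dflow n (Phi : form n -> Prop) (T : form n -> Prop) k
    (A B : prenex n k) : Prop :=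
  exists (t : term n) (H : prenex n k) (E0 E1 G0 G1 F : nat -> seq (term n)),
    [/\ in_class Phi H,
        dequiv T E0 E1 (psub (scons 0 Var) H) A,
        dequiv T G0 G1 (psub (scons t Var) H) B &
        dred T F true (Var 0 < tshift 1 t)%pv
          H (psub (scons (Var 0 + 1)%pv (fun i => Var i.+1)) H)].

Definition dflow_seq n (Phi : form n -> Prop) (T : form n -> Prop) k
    (Gamma Delta : seq (prenex n k)) : Prop :=
  dflow Phi T (pAnd Gamma) (pOr Delta).

Definition hatPi n k (A : prenex n k) : Prop := in_class (@sharply_bounded n) A.

Definition PV : form 2 -> Prop := @PV_ax 2.

(* Main.v *)
(* Completeness of flows is proved with models.  A prenex formula is read as a game;
   a deterministic reduction is then a strategy given by PV terms, and a flow is a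
   definable sequence of reductions.  Flows compose, can be iterated (which gives
   induction) and are compatible with the connectives and the bounded quantifiers.
   The crucial point is contraction, i.e. flows from A \/ A to A and from A to
   A /\ A, for which there is no reduction: the flow decides A by walking through
   the values of one bounded quantifier at a time.

   If there is no flow from A to B, then a generic increasing sequence of such
   pairs, starting with (A, B), puts every Pi_k formula on one of the two sides and
   provides terms witnessing quantifiers and failures of induction.  The terms,
   modulo provable equality on the left, form a model of T^k_n in which A holds and
   B fails.  Conversely, in a model of T^k_n truth is transported along a flow by
   induction. *)

From mathcomp Require Import all_boot.
From Stdlib Require List.
From Stdlib Require Import Classical ClassicalEpsilon FunctionalExtensionality
  PropExtensionality Eqdep_dec.
Require Import Defs.

Set Implicit Arguments.
Unset Strict Implicit.
Unset Printing Implicit Defensive.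

(** * Models *)

(** What blocks contraction is a choice. A reduction from [A] to [A /\ A] receives one move against
    each copy and must return a single move against [A]; it would have to know which of the two
    refutes, in general a question that no term settles. The remedy couples the levels: contraction
    for Pi_k games lets a flow of Pi_(k+1) games decide between two Pi_k games, and that decision
    gives contraction for Pi_(k+1). Weakening, linear distributivity and cases on a decidable
    condition have strategies outright. Lengths are the second difficulty. Nested flows have lengths
    depending on parameters, and a maximum over a bounded range need not be a term; so lengths are
    stretched to values of monotone upper bounds of terms. The induction rule of PV refers to
    provability, so a completeness theorem for the calculus turns it into a statement on all models.
    Search by recursion on notation then makes sharply bounded matrices decidable by terms, and only
    the blocks remain as moves. The model construction uses nothing about proofs in T^k_n: closure
    of flows under cut, the two quantifier rules and induction suffices. *)

Record model (n : nat) := Model {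
  dom :> Type;
  fn : forall m, fsym n m -> ('I_m -> dom) -> dom;
  lem : dom -> dom -> Prop }.

Definition econs D (x : D) (e : nat -> D) (i : nat) : D :=
  if i is j.+1 then e j else x.

(** Environments follow the convention of [block]: the values of a block occupy the first positions,
    and the former context is shifted behind them. *)
Definition ecat D (us : seq D) (e : nat -> D) : nat -> D :=
  foldr (@econs D) e us.

Definition edrop D (l : nat) (e : nat -> D) : nat -> D := fun i => e (l + i).

Definition etake D (l : nat) (e : nat -> D) : seq D := mkseq e l.

Fixpoint eval n (M : model n) (e : nat -> M) (t : term n) : M :=
  match t with
  | Var i => e i
  | App _ f a => fn f (fun i => eval e (a i))
  end.

Fixpoint sat n (M : model n) (e : nat -> M) (A : form n) : Prop :=
  match A with
  | Bot => False
  | Eq t u => eval e t = eval e u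
  | Le t u => lem (eval e t) (eval e u)
  | Imp B C => sat e B -> sat e C
  | And B C => sat e B /\ sat e C
  | Or B C => sat e B \/ sat e C
  | All B => forall d, sat (econs d e) B
  | Ex B => exists d, sat (econs d e) B
  end.

Lemma tsub_comp n (s r : nat -> term n) t :
  tsub s (tsub r t) = tsub (fun i => tsub s (r i)) t.
Proof.
elim: t => [//|m f a IH] /=; congr App; apply: functional_extensionality => i.
exact: IH.
Qed.

Lemma tsub_Var n (t : term n) : tsub Var t = t.
Proof.
elim: t => [//|m f a IH] /=; congr App; apply: functional_extensionality => i.
exact: IH.
Qed.

Lemma tsub_ap n m (s : nat -> term n) (f : fsym n m) ts :
  size ts = m -> tsub s (ap f ts) = ap f (map (tsub s) ts).
Proof.
move=> hs /=; congr App; apply: functional_extensionality => i.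
by rewrite (nth_map (Var 0)) // hs.
Qed.

Lemma up_comp n (s r : nat -> term n) :
  (fun i => tsub (up s) (up r i)) = up (fun i => tsub s (r i)).
Proof.
by apply: functional_extensionality => -[//|i] /=; rewrite /tshift !tsub_comp.
Qed.

Lemma up_Var n : up (@Var n) = Var.
Proof. by apply: functional_extensionality => -[]. Qed.

Lemma fsub_comp n (s r : nat -> term n) A :
  fsub s (fsub r A) = fsub (fun i => tsub s (r i)) A.
Proof.
elim: A s r => [|t u|t u|B IB C IC|B IB C IC|B IB C IC|B IB|B IB] s r //=;
  by rewrite ?tsub_comp ?IB ?IC ?up_comp.
Qed.

Lemma fsub_Var n (A : form n) : fsub Var A = A.
Proof.
elim: A => [|t u|t u|B IB C IC|B IB C IC|B IB C IC|B IB|B IB] //=;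
  by rewrite ?tsub_Var ?up_Var ?IB ?IC.
Qed.

Lemma fsub_ext n (s s' : nat -> term n) A :
  (forall i, s i = s' i) -> fsub s A = fsub s' A.
Proof. by move=> /functional_extensionality ->. Qed.

Lemma inst_up n (t : term n) s A :
  inst t (fsub (up s) A) = fsub (scons t s) A.
Proof.
rewrite /inst fsub_comp; apply: fsub_ext => -[//|i] /=.
by rewrite /tshift tsub_comp tsub_Var.
Qed.

Lemma fsub_inst n (t : term n) s A :
  fsub s (inst t A) = inst (tsub s t) (fsub (up s) A).
Proof. by rewrite inst_up /inst fsub_comp; apply: fsub_ext => -[]. Qed.

Lemma fsub_fshift n (s : nat -> term n) A :
  fsub (up s) (fshift 1 A) = fshift 1 (fsub s A).
Proof. by rewrite /fshift !fsub_comp; apply: fsub_ext. Qed.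

Lemma tinst_tshift n (t u : term n) : tsub (scons t Var) (tshift 1 u) = u.
Proof. by rewrite /tshift tsub_comp -[RHS]tsub_Var. Qed.

Section Semantics.
Variables (n : nat) (M : model n).
Implicit Types e : nat -> M.

Lemma eval_tsub e s t :
  eval e (tsub s t) = eval (fun i => eval e (s i)) t.
Proof.
elim: t => [//|m f a IH] /=; congr fn; apply: functional_extensionality => i.
exact: IH.
Qed.

Lemma eval_tshift l e t : eval e (tshift l t) = eval (edrop l e) t.
Proof. exact: eval_tsub. Qed.

Lemma econs_up e s d :
  (fun i => eval (econs d e) (up s i)) = econs d (fun i => eval e (s i)).
Proof.
by apply: functional_extensionality => -[//|i] /=; rewrite eval_tshift.
Qed.

Lemma sat_fsub e s A : sat e (fsub s A) = sat (fun i => eval e (s i)) A.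
Proof.
elim: A e s => [|t u|t u|B IB C IC|B IB C IC|B IB C IC|B IB|B IB] e s //=;
  rewrite ?eval_tsub ?IB ?IC //; apply: propositional_extensionality.
- by split=> h d; move: (h d); rewrite IB econs_up.
- by split=> -[d h]; exists d; move: h; rewrite IB econs_up.
Qed.

Lemma sat_fshift l e A : sat e (fshift l A) = sat (edrop l e) A.
Proof. exact: sat_fsub. Qed.

Lemma sat_inst e t A : sat e (inst t A) = sat (econs (eval e t) e) A.
Proof.
rewrite sat_fsub; congr sat; apply: functional_extensionality => -[//|i] //=.
Qed.

Lemma edrop_econs d e : edrop 1 (econs d e) = e.
Proof. by apply: functional_extensionality. Qed.

Lemma soundness T G A : (forall B, T B -> forall e, sat e B) -> prv T G A ->
  forall e, (forall B, List.In B G -> sat e B) -> sat e A.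
Proof.
move=> hT; elim=> {G A}.
- by move=> G A hA e _; exact: hT.
- by move=> G A hA e; apply.
- move=> G A _ IH e hG; apply: NNPP => hA; apply: (IH e) => B /= [<- //|].
  exact: hG.
- by move=> G A B _ IH e hG hA; apply: (IH e) => C /= [<- //|]; exact: hG.
- by move=> G A B _ IH1 _ IH2 e hG; apply: (IH1 e hG); exact: IH2.
- by move=> G A B _ IH1 _ IH2 e hG; split; [exact: IH1|exact: IH2].
- by move=> G A B _ IH e /IH[].
- by move=> G A B _ IH e /IH[].
- by move=> G A B _ IH e /IH; left.
- by move=> G A B _ IH e /IH; right.
- move=> G A B C _ IH _ IH1 _ IH2 e hG; case: (IH e hG) => h.
  + by apply: (IH1 e) => D /= [<- //|]; exact: hG.
  + by apply: (IH2 e) => D /= [<- //|]; exact: hG.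
- move=> G A _ IH e hG d; apply: (IH (econs d e)) => B /List.in_map_iff[C [<- hC]].
  by rewrite sat_fshift edrop_econs; exact: hG.
- by move=> G A t _ IH e hG; rewrite sat_inst; exact: IH.
- by move=> G A t _ IH e hG; exists (eval e t); rewrite -sat_inst; exact: IH.
- move=> G A C _ IH1 _ IH2 e hG; have [d hd] := IH1 e hG.
  have : sat (econs d e) (fshift 1 C).
    apply: IH2 => B /= [<- //|/List.in_map_iff[D [<- hD]]].
    by rewrite sat_fshift edrop_econs; exact: hG.
  by rewrite sat_fshift edrop_econs.
- by [].
- move=> G A t u _ IH1 _ IH2 e hG; rewrite sat_inst -(IH1 e hG) -sat_inst.
  exact: IH2.
Qed.

Lemma ecat_cat us vs e : ecat (us ++ vs) e = ecat us (ecat vs e).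
Proof. by rewrite /ecat foldr_cat. Qed.

Lemma edrop_ecat us e : edrop (size us) (ecat us e) = e.
Proof. by apply: functional_extensionality => i; elim: us => //= u us. Qed.

Lemma etake_econs l x e : etake l.+1 (econs x e) = x :: etake l e.
Proof. by rewrite /etake /mkseq /= -[1]addn0 iotaDl -map_comp. Qed.

Lemma etakeS l e : etake l.+1 e = e 0 :: etake l (edrop 1 e).
Proof. by rewrite /etake /mkseq /= -[1]addn0 iotaDl -map_comp. Qed.

Lemma etake_ecat us e : etake (size us) (ecat us e) = us.
Proof.
by elim: us => [//|u us IH]; rewrite [ecat _ _]/= etake_econs IH.
Qed.

Lemma ecat_nth x us e i : ecat us e i =
  if i < size us then nth x us i else e (i - size us).
Proof.
elim: us i => [|u us IH] i /=; first by rewrite subn0.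
by case: i => [//|i] /=; rewrite IH ltnS subSS.
Qed.

Lemma ecat_take_drop l e : ecat (etake l e) (edrop l e) = e.
Proof.
apply: functional_extensionality => i; rewrite (ecat_nth (e 0)) size_mkseq.
by case: ltnP => h; [rewrite nth_mkseq|rewrite /edrop subnKC].
Qed.

End Semantics.

Definition models n (T : form n -> Prop) (M : model n) : Prop :=
  forall B, T B -> forall e : nat -> M, sat e B.

(** * Completeness *)

(** The Rasiowa-Sikorski argument for countably many dense sets. It is applied to finite consistent
    lists of formulas, and later to pairs of games without a flow. *)
Lemma generic_sequence (C : Type) (ext : C -> C -> Prop) (D : nat -> C -> Prop)
    c0 : (forall c, ext c c) -> (forall a b c, ext a b -> ext b c -> ext a c) ->
  (forall j c, exists c', ext c c' /\ D j c') ->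
  exists s : nat -> C, [/\ s 0 = c0, forall i j, i <= j -> ext (s i) (s j) &
    forall j, exists i, D j (s i)].
Proof.
move=> er et dense.
pose f j c := proj1_sig (constructive_indefinite_description _ (dense j c)).
have hf j c : ext c (f j c) /\ D j (f j c).
  exact: proj2_sig (constructive_indefinite_description _ (dense j c)).
pose s := fix s i := if i is j.+1 then f j (s j) else c0.
exists s; split=> //.
- move=> i j; elim: j => [|j IH]; first by rewrite leqn0 => /eqP ->.
  rewrite leq_eqVlt ltnS => /orP[/eqP -> //|/IH h].
  by apply: et h _; case: (hf j (s j)).
- by move=> j; exists j.+1; case: (hf j (s j)).
Qed.

(** * Countability of the syntax *)

Section Countable.
Variable n : nat.
Notation tree := (GenTree.tree nat).

Fixpoint code_fsym m (f : fsym n m) : tree :=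
  match f with
  | fZero => GenTree.Leaf 0
  | fOne => GenTree.Leaf 1
  | fLen => GenTree.Leaf 2
  | fAdd => GenTree.Leaf 3
  | fSub => GenTree.Leaf 4
  | fMul => GenTree.Leaf 5
  | fDiv => GenTree.Leaf 6
  | fSmash i _ => GenTree.Node 0 [:: GenTree.Leaf i]
  | fProj m i => GenTree.Node 1 [:: GenTree.Leaf m; GenTree.Leaf (val i)]
  | fComp m l g h => GenTree.Node 2 [:: GenTree.Leaf m, GenTree.Leaf l,
      code_fsym g & [seq code_fsym (h i) | i <- enum 'I_m]]
  | fRec m g h0 h1 b => GenTree.Node 3 [:: code_fsym g; code_fsym h0;
      code_fsym h1; code_fsym b]
  end.

Lemma map_enum_inj m (T : Type) (a b : 'I_m -> T) :
  [seq a i | i <- enum 'I_m] = [seq b i | i <- enum 'I_m] -> a =1 b.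
Proof.
move=> h i; have hi : i < size (enum 'I_m) by rewrite size_enum_ord.
have : nth (a i) [seq a i | i <- enum 'I_m] i =
  nth (a i) [seq b i | i <- enum 'I_m] i by rewrite h.
rewrite (nth_map i (a i) a hi) (nth_map i (a i) b hi). by rewrite (nth_ord_enum i i).
Qed.

Lemma existT_fsym_inj m (f g : fsym n m) :
  existT (fsym n) m f = existT (fsym n) m g -> f = g.
Proof. exact: inj_pair2_eq_dec _ PeanoNat.Nat.eq_dec _ _ _ _. Qed.

(** Stated with [existT] because symbols of all arities share one coding: in the induction, symbols
    with equal codes are not yet known to have equal arity. *)
Lemma code_fsym_inj m (f : fsym n m) m' (f' : fsym n m') :
  code_fsym f = code_fsym f' -> existT (fsym n) m f = existT (fsym n) m' f'.
Proof.
elim: f m' f' => {m}.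
1-7: by move=> m' [].
- move=> i hi m' [] //= i' hi' [] e; subst i'.
  by rewrite (bool_irrelevance hi hi').
- by move=> m i m' [] //= m2 i2 [] e; subst m2 => /val_inj ->.
- move=> m l g IHg h IHh m' [] //= m2 l2 g2 h2 [] em el; subst m2 l2.
  move=> /IHg /existT_fsym_inj <- /map_enum_inj hh.
  suff -> : h = h2 by [].
  apply: functional_extensionality => i.
  exact: (existT_fsym_inj (IHh i _ _ (hh i))).
- move=> m g IHg h0 IH0 h1 IH1 b IHb m' [] //= m2 g2 h02 h12 b2 [].
  move=> /IHg e; have em : m = m2 by case: e.
  subst m2; move/existT_fsym_inj: e => <-.
  move=> /IH0 /existT_fsym_inj <-.
  move=> /IH1 /existT_fsym_inj <-.
  by move=> /IHb /existT_fsym_inj <-.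
Qed.

Fixpoint code_term (t : term n) : tree :=
  match t with
  | Var i => GenTree.Leaf i
  | App m f a => GenTree.Node m
      (code_fsym f :: [seq code_term (a i) | i <- enum 'I_m])
  end.

Lemma code_term_inj t t' : code_term t = code_term t' -> t = t'.
Proof.
elim: t t' => [i|m f a IH] [i'|m' f' a'] //= [].
  by move=> ->.
move=> em; subst m'.
move=> /code_fsym_inj /existT_fsym_inj <-.
move=> /map_enum_inj h; congr App; apply: functional_extensionality => i.
exact: IH.
Qed.

Fixpoint code_form (A : form n) : tree :=
  match A with
  | Bot => GenTree.Leaf 0
  | Eq t u => GenTree.Node 0 [:: code_term t; code_term u]
  | Le t u => GenTree.Node 1 [:: code_term t; code_term u]
  | Imp B C => GenTree.Node 2 [:: code_form B; code_form C]
  | And B C => GenTree.Node 3 [:: code_form B; code_form C]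
  | Or B C => GenTree.Node 4 [:: code_form B; code_form C]
  | All B => GenTree.Node 5 [:: code_form B]
  | Ex B => GenTree.Node 6 [:: code_form B]
  end.

Lemma code_form_inj A A' : code_form A = code_form A' -> A = A'.
Proof.
elim: A A' => [|t u|t u|B IB C IC|B IB C IC|B IB C IC|B IB|B IB]
  [|t' u'|t' u'|B' C'|B' C'|B' C'|B'|B'] //= [].
1,2: by move=> /code_term_inj -> /code_term_inj ->.
1-3: by move=> /IB -> /IC ->.
1,2: by move=> /IB ->.
Qed.

Fixpoint code_prenex k : prenex n k -> tree :=
  if k is j.+1 return prenex n k -> tree then
    fun A => GenTree.Node 0 (code_prenex A.2 :: map code_term A.1)
  else code_form.

Lemma code_prenex_inj k (A A' : prenex n k) :
  code_prenex A = code_prenex A' -> A = A'.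
Proof.
elim: k A A' => [|k IH] /=; first exact: code_form_inj.
move=> [ps A] [ps' A'] /= [] /IH -> h; congr pair.
by elim: ps ps' h => [|p ps IHs] [|p' ps'] //= [] /code_term_inj -> /IHs ->.
Qed.

End Countable.

Lemma enumeration (X : Type) (x0 : X) (C : countType) (code : X -> C) :
  (forall x y, code x = code y -> x = y) ->
  exists f : nat -> X, forall x, exists j, f j = x.
Proof.
move=> inj.
have h j : exists x, forall y, unpickle j = Some (code y) -> x = y.
  case: (classic (exists y, unpickle j = Some (code y))) => [[y hy]|hn].
    by exists y => y'; rewrite hy => -[] /inj.
  by exists x0 => y hy; case: hn; exists y.
exists (fun j => proj1_sig (constructive_indefinite_description _ (h j))).
move=> x; exists (pickle (code x)).
apply: (proj2_sig (constructive_indefinite_description _ (h _))).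
exact: pickleK.
Qed.

Lemma choice_fun (X Y : Type) (R : X -> Y -> Prop) :
  (forall x, exists y, R x y) -> exists f : X -> Y, forall x, R x (f x).
Proof.
move=> h; exists (fun x => proj1_sig (constructive_indefinite_description _ (h x))).
by move=> x; exact: proj2_sig (constructive_indefinite_description _ (h x)).
Qed.

(** Finiteness of the set of variables, phrased through substitutions so that no function computing
    free variables is needed. *)
Lemma tsub_fresh n (t : term n) : exists N, forall s s' : nat -> term n,
  (forall i, i < N -> s i = s' i) -> tsub s t = tsub s' t.
Proof.
elim: t => [i|m f a IH]; first by exists i.+1 => s s'; apply.
have [N hN] := choice_fun IH; exists (\max_i N i) => s s' h /=; congr App.
apply: functional_extensionality => i; apply: hN => j hj; apply: h.
by apply: leq_trans hj _; exact: leq_bigmax.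
Qed.

Lemma fsub_fresh n (A : form n) : exists N, forall s s' : nat -> term n,
  (forall i, i < N -> s i = s' i) -> fsub s A = fsub s' A.
Proof.
elim: A => [|t u|t u|B [N1 h1] C [N2 h2]|B [N1 h1] C [N2 h2]
  |B [N1 h1] C [N2 h2]|B [N h]|B [N h]]; first by exists 0.
1,2: have [N1 h1] := tsub_fresh t; have [N2 h2] := tsub_fresh u.
1-5: by exists (maxn N1 N2) => s s' h /=; rewrite (h1 s s') ?(h2 s s') // => i hi;
  apply: h; rewrite leq_max hi ?orbT.
1,2: by exists N => s s' hs /=; congr (_ _); apply: h => -[//|i] /= hi;
  rewrite hs // ltnW.
Qed.

Lemma seq_fsub_fresh n (G : seq (form n)) : exists N, forall s s' : nat -> term n,
  (forall i, i < N -> s i = s' i) ->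
  forall A, List.In A G -> fsub s A = fsub s' A.
Proof.
elim: G => [|A G [N1 h1]]; first by exists 0.
have [N2 h2] := fsub_fresh A; exists (maxn N1 N2) => s s' h B /= [<-|hB].
- by apply: h2 => i hi; apply: h; rewrite leq_max hi orbT.
- by apply: h1 hB => i hi; apply: h; rewrite leq_max hi.
Qed.

(** * Weakening, substitution and equality in natural deduction *)

Section Provability.
Variables (n : nat) (T : form n -> Prop).
Implicit Types (G : seq (form n)) (A B C : form n).

Lemma prv_weak G G' A :
  (forall B, List.In B G -> List.In B G') -> prv T G A -> prv T G' A.
Proof.
move=> h p; elim: p G' h => {G A}.
- by move=> G A hA G' _; exact: prv_ax.
- by move=> G A hA G' h; apply: prv_hyp; exact: h.
- move=> G A _ IH G' h; apply: prv_raa; apply: IH => B /= [->|/h]; by [left|right].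
- move=> G A B _ IH G' h; apply: prv_impI; apply: IH => C /= [->|/h];
    by [left|right].
- by move=> G A B _ IH1 _ IH2 G' h; apply: prv_impE (IH1 _ h) (IH2 _ h).
- by move=> G A B _ IH1 _ IH2 G' h; apply: prv_andI (IH1 _ h) (IH2 _ h).
- by move=> G A B _ IH G' h; apply: prv_andE1 (IH _ h).
- by move=> G A B _ IH G' h; apply: prv_andE2 (IH _ h).
- by move=> G A B _ IH G' h; apply: prv_orI1 (IH _ h).
- by move=> G A B _ IH G' h; apply: prv_orI2 (IH _ h).
- move=> G A B C _ IH _ IH1 _ IH2 G' h; apply: prv_orE (IH _ h) _ _.
  + by apply: IH1 => D /= [->|/h]; [left|right].
  + by apply: IH2 => D /= [->|/h]; [left|right].
- move=> G A _ IH G' h; apply: prv_allI; apply: IH => B.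
  by move=> /List.in_map_iff[C [<- /h hC]]; apply: List.in_map.
- by move=> G A t _ IH G' h; apply: prv_allE (IH _ h).
- by move=> G A t _ IH G' h; apply: prv_exI (IH _ h).
- move=> G A C _ IH1 _ IH2 G' h; apply: prv_exE (IH1 _ h) _.
  apply: IH2 => B /= [->|/List.in_map_iff[D [<- /h hD]]]; first by left.
  by right; apply: List.in_map.
- by move=> G t G' _; exact: prv_refl.
- by move=> G A t u _ IH1 _ IH2 G' h; apply: prv_eqE (IH1 _ h) (IH2 _ h).
Qed.

(** The set [T] need not be closed under substitution. But an axiom is available under any
    hypotheses, so it can be generalized over its finitely many variables, and the quantifiers are
    then instantiated from the outside in. *)
Lemma prv_ax_sub G A s : T A -> prv T G (fsub s A).
Proof.
move=> hA; have [N hN] := fsub_fresh A.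
have hall m G' : prv T G' (iter m (@All n) A).
  elim: m G' => [|m IH] G' /=; first exact: prv_ax.
  exact: prv_allI.
have hel m r : prv T G (fsub r (iter m (@All n) A)) ->
    prv T G (fsub (fun i => if i < m then s i else r (i - m)) A).
  elim: m r => [|m IH] r /=.
    by move=> h; rewrite (fsub_ext (s' := r)) // => i; rewrite subn0.
  move=> /(prv_allE (s m)); rewrite inst_up => /IH h.
  rewrite (fsub_ext (s' := fun i => if i < m then s i
    else scons (s m) r (i - m))) // => i.
  rewrite ltnS; case: ltngtP => // hi; first by rewrite -(subnSK hi).
  by rewrite hi subnn.
have := hel N Var; rewrite fsub_Var => /(_ (hall N G)).
by rewrite (hN _ s) // => i ->.
Qed.

Lemma prv_sub G A s : prv T G A -> prv T (map (fsub s) G) (fsub s A).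
Proof.
move=> p; elim: p s => {G A}.
- by move=> G A hA s; exact: prv_ax_sub.
- by move=> G A hA s; apply: prv_hyp; exact: List.in_map.
- by move=> G A _ IH s; apply: prv_raa; exact: IH.
- by move=> G A B _ IH s; apply: prv_impI; exact: IH.
- by move=> G A B _ IH1 _ IH2 s; exact: prv_impE (IH1 s) (IH2 s).
- by move=> G A B _ IH1 _ IH2 s; exact: prv_andI (IH1 s) (IH2 s).
- by move=> G A B _ IH s; exact: prv_andE1 (IH s).
- by move=> G A B _ IH s; exact: prv_andE2 (IH s).
- by move=> G A B _ IH s; exact: prv_orI1 (IH s).
- by move=> G A B _ IH s; exact: prv_orI2 (IH s).
- by move=> G A B C _ IH _ IH1 _ IH2 s; exact: prv_orE (IH s) (IH1 s) (IH2 s).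
- move=> G A _ IH s; apply: prv_allI; move: (IH (up s)).
  by rewrite -!map_comp; congr prv; apply: eq_map => B /=; rewrite fsub_fshift.
- by move=> G A t _ IH s; rewrite fsub_inst; apply: prv_allE; exact: IH.
- move=> G A t _ IH s /=; apply: (@prv_exI _ _ _ _ (tsub s t)).
  by rewrite -fsub_inst; exact: IH.
- move=> G A C _ IH1 _ IH2 s; apply: prv_exE (IH1 s) _.
  move: (IH2 (up s)); rewrite /= fsub_fshift -!map_comp; congr prv.
  by congr cons; apply: eq_map => B /=; rewrite fsub_fshift.
- by move=> G t s; exact: prv_refl.
- move=> G A t u _ IH1 _ IH2 s; rewrite fsub_inst; apply: prv_eqE (IH1 s) _.
  by rewrite -fsub_inst.
Qed.

Lemma prv_eq_sym G t u : prv T G (Eq t u) -> prv T G (Eq u t).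
Proof.
move=> h.
have hi v : inst v (Eq (Var 0) (tshift 1 t)) = Eq v t.
  by rewrite /inst /= tinst_tshift.
by rewrite -hi; apply: prv_eqE h _; rewrite hi; exact: prv_refl.
Qed.

Lemma prv_eq_trans G t u v :
  prv T G (Eq t u) -> prv T G (Eq u v) -> prv T G (Eq t v).
Proof.
move=> h1 h2.
have hi w : inst w (Eq (tshift 1 t) (Var 0)) = Eq t w.
  by rewrite /inst /= tinst_tshift.
by rewrite -hi; apply: prv_eqE h2 _; rewrite hi.
Qed.

Lemma prv_eq_le G t t' u u' : prv T G (Eq t t') -> prv T G (Eq u u') ->
  prv T G (Le t u) -> prv T G (Le t' u').
Proof.
move=> h1 h2 h.
have hi w : inst w (Le (Var 0) (tshift 1 u)) = Le w u.
  by rewrite /inst /= tinst_tshift.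
have hi' w : inst w (Le (tshift 1 t') (Var 0)) = Le t' w.
  by rewrite /inst /= tinst_tshift.
rewrite -hi'; apply: prv_eqE h2 _; rewrite hi' -hi.
by apply: prv_eqE h1 _; rewrite hi.
Qed.

Lemma prv_eq_app G m (f : fsym n m) a b : (forall i, prv T G (Eq (a i) (b i))) ->
  prv T G (Eq (App f a) (App f b)).
Proof.
move=> h; have step j : j <= m ->
    prv T G (Eq (App f a) (App f (fun i => if i < j then b i else a i))).
  elim: j => [|j IH] hj; first exact: prv_refl.
  pose c v := Eq (App f a) (App f (fun i : 'I_m =>
    if i < j then b i else if i == j :> nat then v else a i)).
  have hc v : inst v (Eq (tshift 1 (App f a)) (App f (fun i : 'I_m =>
      if i < j then tshift 1 (b i) else if i == j :> nat then Var 0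
      else tshift 1 (a i)))) = c v.
    rewrite /inst /c /=; congr Eq; congr App; apply: functional_extensionality => i;
      first exact: tinst_tshift.
    by case: (i < j); last case: (_ == _) => //; rewrite tinst_tshift.
  have -> : Eq (App f a) (App f (fun i => if i < j.+1 then b i else a i)) =
      c (b (Ordinal hj)).
    rewrite /c; congr Eq; congr App; apply: functional_extensionality => i.
    rewrite ltnS; case: ltngtP => // hi; congr b; exact: val_inj.
  rewrite -hc; apply: prv_eqE (h (Ordinal hj)) _; rewrite hc /c.
  move: (IH (ltnW hj)); congr prv; congr Eq; congr App.
  apply: functional_extensionality => i.
  case: ltngtP => // hi; congr a; exact: val_inj.
have := step m (leqnn m); congr prv; congr Eq; congr App.
by apply: functional_extensionality => i; rewrite ltn_ord.
Qed.

(** A variable beyond all those of the finite context plays the part of a Henkin constant. If the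
    enlarged context were inconsistent, renaming this variable to 0 and shifting all others would
    produce the premise of [prv_exE]. *)
Lemma consistent_witness G B : ~ prv T (Ex B :: G) Bot ->
  exists t, ~ prv T [:: inst t B, Ex B & G] Bot.
Proof.
move=> hc; have [N hN] := seq_fsub_fresh (Ex B :: G).
have [N' hN'] := fsub_fresh B.
pose x := maxn N N'; exists (Var x) => /(prv_sub
  (fun i => if i == x then Var 0 else Var i.+1)) h; apply: hc.
apply: (@prv_exE _ _ _ B); first by apply: prv_hyp; left.
move: h; congr prv; rewrite map_cons.
have hG A : List.In A (Ex B :: G) ->
    fsub (fun i => if i == x then Var 0 else Var i.+1) A = fshift 1 A.
  apply: hN => i hi; case: eqP => // e.
  by move: hi; rewrite e /x ltnNge leq_maxl.
congr cons; last by apply: (List.map_ext_in _ _ (Ex B :: G)).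
rewrite /inst fsub_comp -[RHS]fsub_Var; apply: hN' => -[|i] hi /=.
  by rewrite eqxx.
case: eqP => // e; suff : i.+1 < i.+1 by rewrite ltnn.
by apply: leq_trans hi _; rewrite [X in _ <= X.+1]e leqW // leq_maxr.
Qed.

End Provability.

(** [Eq] is interpreted by equality of the domain, so terms have to be divided by [E]. The classes
    are the predicates [E t], and the operations are computed on chosen representatives. *)
Lemma term_model n (E L : term n -> term n -> Prop) :
  (forall t, E t t) -> (forall s t, E s t -> E t s) ->
  (forall s t u, E s t -> E t u -> E s u) ->
  (forall s s' t t', E s s' -> E t t' -> L s t -> L s' t') ->
  (forall m (f : fsym n m) a b, (forall i, E (a i) (b i)) ->
    E (App f a) (App f b)) ->
  exists (M : model n) (cls : term n -> M), [/\ forall d, exists t, d = cls t,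
    forall s t, cls s = cls t <-> E s t,
    forall s t, lem (cls s) (cls t) <-> L s t &
    forall e t, eval (fun i => cls (e i)) t = cls (tsub e t)].
Proof.
move=> Er Es Et EL EA.
pose D := {P : term n -> Prop | exists t, P = E t}.
pose c t : D := exist _ (E t) (ex_intro _ t erefl).
have cE s t : c s = c t <-> E s t.
  split=> [[e]|h]; first by rewrite e.
  have e : E s = E t.
    apply: functional_extensionality => u; apply: propositional_extensionality.
    by split; apply: Et; [exact: Es|].
  rewrite /c; move: (ex_intro _ s _) (ex_intro _ t _); rewrite e => p q.
  by congr exist; exact: proof_irrelevance.
have csurj d : exists t, d = c t.
  case: d => P [t e]; exists t; rewrite /c; subst P.
  by congr exist; exact: proof_irrelevance.
have [r hr] := choice_fun csurj.
have rE t : E t (r (c t)) by apply/cE; exact: hr.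
exists (@Model n D (fun m f a => c (App f (fun i => r (a i))))
  (fun x y => L (r x) (r y))), c; split=> //=.
- by move=> s t; split; apply: EL => //; exact: Es.
- move=> e; elim=> [//|m f a IH] /=; apply/cE; apply: EA => i.
  by apply: Es; rewrite IH.
Qed.

(** * Henkin models for the calculus *)

Section Completeness.
Variables (n : nat) (T : form n -> Prop).

(** Henkin's argument with finite consistent lists as conditions: the generic sequence decides every
    formula and contains an instance of every existential formula it accepts. A rejected universal
    formula is refuted by a witness for the negation of its body. *)
Lemma model_existence G0 : ~ prv T G0 Bot ->
  exists (M : model n) (e : nat -> M), models T M /\
    forall A, List.In A G0 -> sat e A.
Proof.
move=> hG0.
have [en hen] : exists f : nat -> form n, forall A, exists j, f j = A.
  exact: (@enumeration _ (Bot : form n) (GenTree.tree nat) (@code_form n)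
    (@code_form_inj n)).
pose cond := {G : seq (form n) | ~ prv T G Bot}.
pose ext (c d : cond) := forall A, List.In A (sval c) -> List.In A (sval d).
pose D j (c : cond) := (List.In (en j) (sval c) \/
    List.In (Imp (en j) Bot) (sval c)) /\
  forall B, en j = Ex B -> List.In (en j) (sval c) ->
    exists t, List.In (inst t B) (sval c).
have [||j c|s [s0 smono sD]] := @generic_sequence cond ext D (exist _ G0 hG0).
- by move=> c A.
- by move=> a b c h1 h2 A /h1 /h2.
- case: c => G hG; case: (classic (prv T (en j :: G) Bot)) => hA.
    have hG' : ~ prv T (Imp (en j) Bot :: G) Bot.
      by move=> /prv_raa h; apply: hG; apply: prv_impE (prv_impI hA) h.
    exists (exist _ (Imp (en j) Bot :: G) hG'); split; first by move=> A; right.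
    split; first by right; left.
    move=> B _ hin; exfalso; apply: (hG'); apply: (@prv_impE _ _ _ (en j)); apply: prv_hyp => //.
    by left.
  case: (classic (exists B, en j = Ex B)) => [[B e]|hB]; last first.
    exists (exist _ (en j :: G) hA); split; first by move=> A; right.
    by split; [left; left|move=> B e; case: hB; exists B].
  rewrite e in hA; have [t ht] := consistent_witness hA.
  exists (exist _ [:: inst t B, Ex B & G] ht); split; first by move=> A; right; right.
  split; first by rewrite e; left; right; left.
  by move=> B'; rewrite e => -[<-] _; exists t; left.
pose V A := exists i, List.In A (sval (s i)).
have Vs L : (forall A, List.In A L -> V A) ->
    exists i, forall A, List.In A L -> List.In A (sval (s i)).
  elim: L => [|A L IH] h; first by exists 0.
  have [i hi] := IH (fun A hA => h A (or_intror hA)).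
  have [i' hi'] := h A (or_introl erefl).
  exists (maxn i i') => B /= [<-|/hi hB].
  - by apply: (smono i') => //; exact: leq_maxr.
  - by apply: (smono i) => //; exact: leq_maxl.
have Vcon L : (forall A, List.In A L -> V A) -> ~ prv T L Bot.
  move=> /Vs[i hi] h; apply: (proj2_sig (s i)); exact: prv_weak h.
have Vdec A : V A \/ V (Imp A Bot).
  have [j hj] := hen A; have [i [hi _]] := sD j.
  by rewrite hj in hi; case: hi => hi; [left|right]; exists i.
have Vded L A : prv T L A -> (forall B, List.In B L -> V B) -> V A.
  move=> h hL; case: (Vdec A) => // hn; case: (@Vcon (Imp A Bot :: L)).
    by move=> B /= [<-|/hL].
  apply: (@prv_impE _ _ _ A); first by apply: prv_hyp; left.
  by apply: prv_weak h => B; right.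
have Vex B : V (Ex B) -> exists t, V (inst t B).
  move=> hB; have [j hj] := hen (Ex B); have [i [hi hw]] := sD j.
  rewrite hj in hi hw; case: hi => hi.
    by have [t ht] := hw _ erefl hi; exists t, i.
  case: (@Vcon [:: Ex B; Imp (Ex B) Bot]).
    by move=> A /= [<-//|[<-|//]]; exists i.
  by apply: (@prv_impE _ _ _ (Ex B)); apply: prv_hyp; [right; left|left].
have ded1 A B : V A -> prv T [:: A] B -> V B.
  by move=> hA /Vded; apply=> C /= [<-|].
have ded2 A A' B : V A -> V A' -> prv T [:: A; A'] B -> V B.
  by move=> hA hA' /Vded; apply=> C /= [<-//|[<-|]].
have ded0 B : prv T [::] B -> V B by move/Vded; apply.
have hyp0 A G' : prv T (A :: G') A by apply: prv_hyp; left.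
have hyp1 A A' G' : prv T [:: A', A & G'] A by apply: prv_hyp; right; left.
have [|||||M [cls [cls_surj clsE clsL evalE]]] :=
    @term_model n (fun s t => V (Eq s t)) (fun s t => V (Le s t)).
- by move=> t; apply: ded0; exact: prv_refl.
- by move=> s' t /ded1; apply; apply: prv_eq_sym.
- by move=> s' t u h1 /(ded2 _ _ _ h1); apply; apply: prv_eq_trans.
- move=> s1 s2 t1 t2 h1 h2 h3; apply: (@Vded [:: Eq s1 s2; Eq t1 t2; Le s1 t1]).
    apply: (@prv_eq_le _ _ _ s1 s2 t1 t2); apply: prv_hyp => /=; tauto.
  by move=> B /= [<-//|[<-//|[<-|]]].
- move=> m f a b h.
  apply: (@Vded [seq Eq (a i) (b i) | i <- enum 'I_m]).
    apply: prv_eq_app => i; apply: prv_hyp.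
    apply: (List.in_map (fun i => Eq (a i) (b i))).
    have : i \in enum 'I_m by rewrite mem_enum.
    elim: (enum _) => //= j l IH; rewrite inE => /orP[/eqP ->|/IH]; first by left.
    by right.
  by move=> B /List.in_map_iff[i [<- _]].
have truth A : forall r, sat (fun i => cls (r i)) A <-> V (fsub r A).
  elim: A => [|t u|t u|B IB C IC|B IB C IC|B IB C IC|B IB|B IB] r /=.
  - by split=> // h; case: (@Vcon [:: Bot]) => // A /= [<-|].
  - by rewrite !evalE clsE.
  - by rewrite !evalE clsL.
  - rewrite IB IC; split=> [h|h hB]; last first.
      by apply: (ded2 _ _ _ h hB); apply: prv_impE; [exact: hyp0|exact: hyp1].
    case: (Vdec (fsub r B)) => [/h hC|hn].
      by apply: ded1 hC _; apply: prv_impI.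
    apply: ded1 hn _; apply: prv_impI; apply: prv_raa.
    apply: (@prv_impE _ _ _ (fsub r B)); apply: prv_hyp => /=; tauto.
  - rewrite IB IC; split=> [[h1 h2]|h].
      by apply: (ded2 _ _ _ h1 h2); apply: prv_andI.
    by split; apply: ded1 h _; [apply: prv_andE1 _|apply: prv_andE2 _];
      exact: hyp0.
  - rewrite IB IC; split=> [[h|h]|h].
    + by apply: ded1 h _; apply: prv_orI1.
    + by apply: ded1 h _; apply: prv_orI2.
    + apply: NNPP => /not_or_and[hB hC].
      have {}hB : V (Imp (fsub r B) Bot) by case: (Vdec (fsub r B)).
      have {}hC : V (Imp (fsub r C) Bot) by case: (Vdec (fsub r C)).
      case: (@Vcon [:: Or (fsub r B) (fsub r C); Imp (fsub r B) Bot;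
                       Imp (fsub r C) Bot]).
        by move=> A /= [<-//|[<-//|[<-|]]].
      apply: (@prv_orE _ _ _ (fsub r B) (fsub r C)); first exact: hyp0.
      * apply: (@prv_impE _ _ _ (fsub r B)); apply: prv_hyp => /=; tauto.
      * apply: (@prv_impE _ _ _ (fsub r C)); apply: prv_hyp => /=; tauto.
  - have key t : sat (econs (cls t) (fun i => cls (r i))) B <->
        V (inst t (fsub (up r) B)).
      rewrite inst_up -IB; have -> // : econs (cls t) (fun i => cls (r i)) =
        fun i => cls (scons t r i).
      by apply: functional_extensionality => -[].
    split=> [h|h d]; last first.
      have [t ->] := cls_surj d; apply/key; apply: ded1 h _.
      by apply: prv_allE; exact: hyp0.
    case: (Vdec (All (fsub (up r) B))) => // hn.
    have [t ht] : exists t, V (inst t (Imp (fsub (up r) B) Bot)).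
      apply: Vex; apply: ded1 hn _; apply: prv_raa.
      apply: (@prv_impE _ _ _ (All (fsub (up r) B))); first exact: hyp1.
      apply: prv_allI => /=; apply: prv_raa.
      apply: (@prv_impE _ _ _ (fshift 1 (Ex (Imp (fsub (up r) B) Bot)))).
        by apply: prv_hyp => /=; tauto.
      apply: (@prv_exI _ _ _ (fsub (up (fun i => Var (1 + i)))
        (Imp (fsub (up r) B) Bot)) (Var 0)).
      rewrite inst_up (_ : scons _ _ = Var) ?fsub_Var; first exact: hyp0.
      by apply: functional_extensionality; case.
    case: (@Vcon [:: inst t (fsub (up r) B); inst t (Imp (fsub (up r) B) Bot)]).
      by move=> A /= [<-|[<-|//]] //; apply/key.
    by apply: (@prv_impE _ _ _ (inst t (fsub (up r) B))); [exact: hyp1|exact: hyp0].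
  - have key t : sat (econs (cls t) (fun i => cls (r i))) B <->
        V (inst t (fsub (up r) B)).
      rewrite inst_up -IB; have -> // : econs (cls t) (fun i => cls (r i)) =
        fun i => cls (scons t r i).
      by apply: functional_extensionality => -[].
    split=> [[d]|/Vex[t /key h]]; last by exists (cls t).
    have [t ->] := cls_surj d => /key h; apply: ded1 h _.
    by apply: (@prv_exI _ _ _ _ t).
exists M, (fun i => cls (Var i)); split.
- move=> B hB e; have [r hr] := choice_fun (fun i => cls_surj (e i)).
  have -> : e = fun i => cls (r i) by apply: functional_extensionality.
  by apply/truth; apply: ded0; exact: prv_ax_sub.
- move=> A hA; apply/truth; rewrite fsub_Var; exists 0; by rewrite s0.
Qed.

Lemma completeness A :
  (forall M, models T M -> forall e : nat -> M, sat e A) -> proves T A.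
Proof.
move=> h; apply: NNPP => hA.
have [|M [e [hM he]]] := @model_existence [:: Imp A Bot].
  by move=> /prv_raa.
by apply: (he (Imp A Bot)); [left|exact: h].
Qed.

Lemma provesP A :
  proves T A <-> forall M, models T M -> forall e : nat -> M, sat e A.
Proof.
split=> [h M hM e|]; last exact: completeness.
by apply: soundness hM h _ _.
Qed.

End Completeness.

(** * Arithmetic in models of PV *)

Record pvmodel (n : nat) := PVModel {
  pvm :> model n;
  pvmP : models (@PV_ax n) pvm }.

Arguments eval : simpl never.
Arguments tsub : simpl never.

(** Introduced before [fna], which uses it as the default entry of argument lists. *)
Definition zero n (M : model n) : M :=
  fn fZero (fun i : 'I_0 => match notF (ltn_ord i) with end).

Definition fna n (M : model n) m (f : fsym n m) (xs : seq M) : M :=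
  fn f (fun i : 'I_m => nth (zero M) xs i).

Lemma eval_ap n (M : model n) (e : nat -> M) m (f : fsym n m) ts :
  size ts = m -> eval e (ap f ts) = fna f (map (eval e) ts).
Proof.
move=> hs; rewrite /ap /eval -/eval /fna; congr fn.
by apply: functional_extensionality => i; rewrite (nth_map (Var 0)) // hs.
Qed.

Lemma eval_Var n (M : model n) (e : nat -> M) i : eval e (Var i) = e i.
Proof. by []. Qed.

Definition one n (M : model n) : M := fna fOne [::].
Definition add n (M : model n) (x y : M) : M := fna fAdd [:: x; y].
Definition sub n (M : model n) (x y : M) : M := fna fSub [:: x; y].
Definition mul n (M : model n) (x y : M) : M := fna fMul [:: x; y].
Definition quo n (M : model n) (x y : M) : M := fna fDiv [:: x; y].
Definition length n (M : model n) (x : M) : M := fna fLen [:: x].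
Definition minimum n (M : model n) (x y : M) : M := sub x (sub x y).

Declare Scope pvm_scope.
Delimit Scope pvm_scope with M.
Notation "0" := (zero _) : pvm_scope.
Notation "1" := (one _) : pvm_scope.
Notation "x + y" := (add x y) : pvm_scope.
Notation "x - y" := (sub x y) : pvm_scope.
Notation "x * y" := (mul x y) : pvm_scope.
Notation "x <= y" := (lem x y) : pvm_scope.
Notation "x < y" := (lem (add x (one _)) y) : pvm_scope.
Notation "x <= y <= z" := (lem x y /\ lem y z) : pvm_scope.
Local Open Scope pvm_scope.

Section EvalTerms.
Variables (n : nat) (M : model n) (e : nat -> M).
Implicit Types t u : term n.

Lemma eval_zero : eval e 0%pv = 0.
Proof.
rewrite eval_ap //; congr fn; apply: functional_extensionality => i.
by case: (notF (ltn_ord i)).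
Qed.
Lemma eval_one : eval e 1%pv = 1. Proof. exact: eval_ap. Qed.
Lemma eval_add t u : eval e (t + u)%pv = eval e t + eval e u.
Proof. exact: eval_ap. Qed.
Lemma eval_sub t u : eval e (t - u)%pv = eval e t - eval e u.
Proof. exact: eval_ap. Qed.
Lemma eval_mul t u : eval e (t * u)%pv = eval e t * eval e u.
Proof. exact: eval_ap. Qed.
Lemma eval_div1 t u : eval e (div1 t u) = quo (eval e t) (eval e u).
Proof. exact: eval_ap. Qed.
Lemma eval_len t : eval e (len t) = length (eval e t).
Proof. exact: eval_ap. Qed.
Lemma eval_tmin t u : eval e (tmin t u) = minimum (eval e t) (eval e u).
Proof. by rewrite /tmin !eval_sub. Qed.
Lemma eval_half t : eval e (half t) = quo (eval e t) 1.
Proof. by rewrite eval_div1 eval_one. Qed.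
Lemma eval_smash i (h : 1 < i <= n) t u :
  eval e (smash h t u) = fna (fSmash i h) [:: eval e t; eval e u].
Proof. exact: eval_ap. Qed.

Definition evalE := (eval_zero, eval_one, eval_add, eval_sub, eval_mul,
  eval_half, eval_div1, eval_len, eval_tmin, eval_smash, eval_Var).
End EvalTerms.

Section Arithmetic.
Variables (n : nat) (M : pvmodel n).
Implicit Types x y z u v : M.

Let basic (xs : seq M) A : basic_ax A -> sat (ecat xs (fun _ => zero M)) A.
Proof. by move=> h; apply: (pvmP (p := M)); exact: pv_basic. Qed.

Let pv (xs : seq M) A : PV_ax A -> sat (ecat xs (fun _ => zero M)) A.
Proof. by move=> h; apply: (pvmP (p := M)). Qed.

Local Notation V := (@Var n).

Lemma leM_trans x y z : x <= y -> y <= z -> x <= z.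
Proof.
by move=> h1 h2; apply: (basic [:: x; y; z] (basic8 (V 0%N) (V 1%N) (V 2%N))).
Qed.
Lemma leM_anti x y : x <= y -> y <= x -> x = y.
Proof.
by move=> h1 h2; apply: (basic [:: x; y] (basic7 (V 0%N) (V 1%N))).
Qed.
Lemma leM_total x y : x <= y \/ y <= x.
Proof. by case: (basic [:: x; y] (basic6 (V 0%N) (V 1%N))); [right|left]. Qed.
Lemma leMM x : x <= x.
Proof. by case: (leM_total x x). Qed.
Lemma le0M x : 0 <= x.
Proof.
by move: (basic [:: x] (basic3 (V 0%N))); rewrite /= !evalE.
Qed.
Lemma ltMP x y : x < y <-> x <= y /\ x <> y.
Proof.
move: (basic [:: x; y] (basic4 (V 0%N) (V 1%N))); rewrite /= !evalE /=.
by move=> [h1 h2]; split.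
Qed.
Lemma addMC x y : x + y = y + x.
Proof.
by move: (basic [:: x; y] (basic21 (V 0%N) (V 1%N))); rewrite /= !evalE.
Qed.
Lemma addM0 x : x + 0 = x.
Proof. by move: (basic [:: x] (basic22 (V 0%N))); rewrite /= !evalE. Qed.
Lemma add0M x : 0 + x = x. Proof. by rewrite addMC addM0. Qed.
Lemma addMA x y z : x + (y + z) = x + y + z.
Proof.
by move: (basic [:: x; y; z] (basic24 (V 0%N) (V 1%N) (V 2%N)));
  rewrite /= !evalE.
Qed.
Lemma leM_add2l x y z : x + y <= x + z <-> y <= z.
Proof.
by move: (basic [:: x; y; z] (basic25 (V 0%N) (V 1%N) (V 2%N)));
  rewrite /= !evalE.
Qed.
Lemma mulM0 x : x * 0 = 0.
Proof. by move: (basic [:: x] (basic26 (V 0%N))); rewrite /= !evalE. Qed.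
Lemma mulMC x y : x * y = y * x.
Proof.
by move: (basic [:: x; y] (basic28 (V 0%N) (V 1%N))); rewrite /= !evalE.
Qed.
Lemma mul0M x : 0 * x = 0. Proof. by rewrite mulMC mulM0. Qed.
Lemma mulMDr x y z : x * (y + z) = x * y + x * z.
Proof.
by move: (basic [:: x; y; z] (basic29 (V 0%N) (V 1%N) (V 2%N)));
  rewrite /= !evalE.
Qed.
Lemma mulMDl x y z : (y + z) * x = y * x + z * x.
Proof. by rewrite mulMC mulMDr !(mulMC x). Qed.
Lemma mulM1 x : x * 1 = x.
Proof.
move: (basic [:: x] (basic27 (V 0%N) 0%pv)); rewrite /= !evalE /=.
by rewrite mulM0 !add0M.
Qed.
Lemma mul1M x : 1 * x = x. Proof. by rewrite mulMC mulM1. Qed.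
Lemma leM_pmul2l x y z : 1 <= x -> (x * y <= x * z <-> y <= z).
Proof.
move=> hx; move: (basic [:: x; y; z] (basic30 (V 0%N) (V 1%N) (V 2%N))).
by rewrite /= !evalE; apply.
Qed.
Lemma subM_eq0 x y : x <= y -> x - y = 0.
Proof.
by move=> h; move: (pv [:: x; y] (pv_sub0 (V 0%N) (V 1%N))); rewrite /= !evalE;
  apply.
Qed.
Lemma subMK x y : y <= x -> x - y + y = x.
Proof.
by move=> h; move: (pv [:: x; y] (pv_subK (V 0%N) (V 1%N))); rewrite /= !evalE;
  apply.
Qed.
Lemma quo_le x y : quo x y * (y + 1) <= x.
Proof. by move: (pv [:: x; y] (pv_div_le (V 0%N) (V 1%N))); rewrite /= !evalE. Qed.
Lemma lt_quo x y : x < (quo x y + 1) * (y + 1).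
Proof. by move: (pv [:: x; y] (pv_div_lt (V 0%N) (V 1%N))); rewrite /= !evalE. Qed.
Lemma len0 : length (zero M) = 0.
Proof. by move: (basic [::] (@basic9 n)); rewrite /= !evalE. Qed.
Lemma len_mono x y : x <= y -> length x <= length y.
Proof.
by move=> h; move: (basic [:: x; y] (basic12 (V 0%N) (V 1%N))); rewrite /= !evalE;
  apply.
Qed.
Lemma halfP x : x = (1 + 1) * quo x 1 \/ x = (1 + 1) * quo x 1 + 1.
Proof.
move: (basic [:: quo x 1; x] (basic32 (V 0%N) (V 1%N))); rewrite /= !evalE /=.
by case=> /(_ erefl)[] ->; [left|right].
Qed.

Lemma leM_addr x y : x <= x + y.
Proof. by rewrite -{1}(addM0 x) leM_add2l; exact: le0M. Qed.
Lemma leM_addl x y : x <= y + x. Proof. by rewrite addMC; exact: leM_addr. Qed.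
Lemma leM_add2r x y z : y + x <= z + x <-> y <= z.
Proof. by rewrite -!(addMC x) leM_add2l. Qed.
Lemma addMI x y z : x + y = x + z -> y = z.
Proof.
by move=> h; apply: leM_anti; apply/(leM_add2l x); rewrite h; exact: leMM.
Qed.
Lemma addIM x y z : y + x = z + x -> y = z.
Proof. by rewrite -!(addMC x) => /addMI. Qed.
Lemma leM_add x y u v : x <= y -> u <= v -> x + u <= y + v.
Proof.
by move=> h1 h2; apply: (@leM_trans _ (x + v)); [apply/leM_add2l|apply/leM_add2r].
Qed.
Lemma ltM_irr x : ~ x < x. Proof. by case/ltMP. Qed.
Lemma ltMW x y : x < y -> x <= y. Proof. by case/ltMP. Qed.
Lemma ltM_le_trans x y z : x < y -> y <= z -> x < z.
Proof. exact: leM_trans. Qed.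
Lemma leMNgt x y : x <= y <-> ~ y < x.
Proof.
split=> [h h'|h]; first by apply: (@ltM_irr y); exact: ltM_le_trans h' h.
case: (leM_total x y) => // h'; case: (classic (y = x)) => [->|e]; first exact: leMM.
by case: h; apply/ltMP.
Qed.
Lemma notltM x y : ~ y < x -> x <= y.
Proof. by move=> h; apply/leMNgt. Qed.
Lemma ltMNge x y : x < y <-> ~ y <= x.
Proof.
split=> [h /leMNgt h'|h]; first exact: h' h.
by apply: NNPP => hn; apply: h; apply/leMNgt.
Qed.
Lemma leM_gtP x y : x <= y \/ y < x.
Proof. by case: (classic (x <= y)) => [|/ltMNge]; [left|right]. Qed.
Lemma ltMS x y : x < y + 1 <-> x <= y. Proof. exact: leM_add2r. Qed.
Lemma ltMSn x : x < x + 1. Proof. exact: leMM. Qed.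
Lemma leM0 x : x <= 0 <-> x = 0.
Proof.
by split=> [h|->]; [apply: leM_anti => //; exact: le0M|exact: leMM].
Qed.
Lemma posM x : x <> 0 <-> 1 <= x.
Proof.
rewrite -(add0M 1) ltMP; split=> [h|[_ h] e]; last by rewrite e in h.
by split; [exact: le0M|move=> e; case: h].
Qed.
Lemma oneM_neq0 : one M <> 0. Proof. apply/posM; exact: leMM. Qed.
Lemma subM0 x : x - 0 = x. Proof. by rewrite -[RHS](subMK (le0M x)) addM0. Qed.
Lemma subMM x : x - x = 0. Proof. by apply: subM_eq0; exact: leMM. Qed.
Lemma subM_eq0P x y : x - y = 0 <-> x <= y.
Proof.
split=> [h|]; last exact: subM_eq0.
by case: (leM_total x y) => // /subMK; rewrite h add0M => ->; exact: leMM.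
Qed.
Lemma subM_le x y : x - y <= x.
Proof.
case: (leM_total x y) => h; first by rewrite subM_eq0 //; exact: le0M.
by rewrite -{2}(subMK h); exact: leM_addr.
Qed.
Lemma subM_uniq x y z : z + y = x -> x - y = z.
Proof.
move=> h; apply: (@addIM y); rewrite h subMK // -h; exact: leM_addl.
Qed.
Lemma addMK x y : x + y - y = x. Proof. exact: subM_uniq. Qed.
Lemma subM_succ x y : y <= x -> x + 1 - y = x - y + 1.
Proof.
by move=> h; apply: subM_uniq; rewrite -addMA (addMC 1) addMA subMK.
Qed.
Lemma subMSS x y : x + 1 - (y + 1) = x - y.
Proof.
case: (leM_total x y) => h; first by rewrite !subM_eq0 //; exact/leM_add2r.
by apply: subM_uniq; rewrite addMA subMK.
Qed.
Lemma minM_l x y : x <= y -> minimum x y = x.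
Proof. by move=> h; rewrite /minimum (subM_eq0 h) subM0. Qed.
Lemma minM_r x y : y <= x -> minimum x y = y.
Proof. by move=> h; apply: subM_uniq; rewrite addMC subMK. Qed.
Lemma minM_ler x y : minimum x y <= y.
Proof.
by case: (leM_total x y) => h; [rewrite minM_l|rewrite minM_r //; exact: leMM].
Qed.
Lemma leM_mul x y u v : x <= y -> u <= v -> x * u <= y * v.
Proof.
move=> h1 h2; case: (classic (x = 0)) => [->|/posM hx].
  by rewrite mul0M; exact: le0M.
apply: (@leM_trans _ (x * v)); first exact/leM_pmul2l.
case: (classic (v = 0)) => [->|/posM hv]; first by rewrite !mulM0; exact: leMM.
by rewrite -!(mulMC v); apply/leM_pmul2l.
Qed.
Lemma quo_uniq x y q : q * (y + 1) <= x -> x < (q + 1) * (y + 1) -> quo x y = q.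
Proof.
have key a b : a * (y + 1) <= x -> x < (b + 1) * (y + 1) -> a <= b.
  move=> h1 h2; apply/ltMS/ltMNge => h.
  apply: (@ltM_irr x); apply: ltM_le_trans h2 (leM_trans _ h1).
  by apply: leM_mul => //; exact: leMM.
by move=> h1 h2; apply: leM_anti; apply: key => //; [exact: quo_le|exact: lt_quo].
Qed.
Lemma quoM0 y : quo (zero M) y = 0.
Proof.
apply: quo_uniq; first by rewrite mul0M; exact: leMM.
by rewrite add0M mul1M; exact: leM_addl.
Qed.

Lemma len_half x : x <> 0 -> length x = length (quo x 1) + 1.
Proof.
move=> hx; move: (basic [:: x] (basic31 (V 0%N))); rewrite /= !evalE; exact.
Qed.
End Arithmetic.

(** * Definability in PV *)

Lemma pv_provesP n (A : form n) :
  proves (@PV_ax n) A <-> forall (M : pvmodel n) (e : nat -> M), sat e A.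
Proof.
split=> [/provesP h M e|h]; first exact: h (pvmP (p := M)) _.
by apply/provesP => M hM e; exact: (h (PVModel hM)).
Qed.

(** The premises range over all models because [pv_ind] asks for provable premises; completeness
    converts truth in every model into provability. *)
Lemma pv_notation_ind n (A : form n) : qfree A ->
  (forall (M : pvmodel n) (e : nat -> M), sat (econs 0 e) A) ->
  (forall (M : pvmodel n) (e : nat -> M),
    sat (econs (quo (e 0%N) 1) (edrop 1 e)) A -> sat e A) ->
  forall (M : pvmodel n) (e : nat -> M), sat e A.
Proof.
move=> hA h0 hs M e; apply: (pvmP (p := M)); apply: pv_ind => //.
- by apply/pv_provesP => M' e'; rewrite sat_inst evalE; exact: h0.
- apply/pv_provesP => M' e' /=; rewrite sat_fsub => h; apply: hs.
  move: h; congr sat; apply: functional_extensionality => -[|i] //=.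
  by rewrite evalE.
Qed.

(** * Function symbols given by terms, and monotone bounds *)

Section FunctionSymbols.
Variable n : nat.
Implicit Type M : pvmodel n.

Lemma eval_block_vars M (xs : seq M) e :
  map (eval (ecat xs e)) (mkseq (@Var n) (size xs)) = xs.
Proof. by rewrite -[RHS](etake_ecat xs e) /etake /mkseq -map_comp. Qed.

Definition var_tuple m : m.-tuple (term n) :=
  @Tuple m _ (mkseq (@Var n) m) (introT eqP (size_mkseq _ _)).

Lemma eval_var_tuple M m (xs : seq M) e : size xs = m ->
  map (eval (ecat xs e)) (var_tuple m) = xs.
Proof. by move=> <-; exact: eval_block_vars. Qed.

Lemma fna_proj M m (i : 'I_m) (xs : seq M) : size xs = m ->
  fna (fProj i) xs = nth 0 xs i.
Proof.
move=> hs; have := pvmP (p := M) (pv_proj i (var_tuple m)) (ecat xs (fun _ => 0)).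
rewrite /= eval_ap ?size_tuple // eval_var_tuple // => ->.
by rewrite (tnth_nth (Var 0)) /= nth_mkseq // eval_Var (ecat_nth 0) hs ltn_ord.
Qed.

Lemma fna_comp M m l (g : fsym n m) (h : 'I_m -> fsym n l) (xs : seq M) :
  size xs = l -> fna (fComp g h) xs = fn g (fun j => fna (h j) xs).
Proof.
move=> hs; have := pvmP (p := M) (pv_comp g h (var_tuple l)) (ecat xs (fun _ => 0)).
rewrite /= eval_ap ?size_tuple // eval_var_tuple // => ->.
rewrite /eval -/eval; congr fn; apply: functional_extensionality => j.
by rewrite -[LHS]/(eval _ (ap _ _)) eval_ap ?size_tuple // eval_var_tuple.
Qed.

Section Rec.
Variables (m : nat) (g : fsym n m) (h0 h1 : fsym n m.+2) (b : fsym n m.+1).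
Let f := fRec g h0 h1 b.

Lemma fna_rec0 M (xs : seq M) : size xs = m ->
  fna f (0 :: xs) = minimum (fna g xs) (fna b (0 :: xs)).
Proof.
move=> hs; have := pvmP (p := M) (pv_rec0 g h0 h1 b (var_tuple m))
  (ecat xs (fun _ => 0)).
by cbn [sat]; rewrite evalE !eval_ap ?[size _]/= ?size_tuple // !map_cons evalE
  eval_var_tuple.
Qed.

Lemma shifted_vars M (y : M) xs e : size xs = m ->
  map (eval (ecat (y :: xs) e)) (map_tuple (tshift 1) (var_tuple m)) = xs.
Proof.
move=> hs; rewrite /= -map_comp -[RHS](eval_var_tuple e hs); apply: eq_map => t.
by rewrite /= eval_tshift edrop_econs.
Qed.

Lemma fna_recE M (y : M) xs : size xs = m -> y <> 0 ->
  fna f ((1 + 1) * y :: xs) =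
  minimum (fna h0 [:: y, fna f (y :: xs) & xs]) (fna b ((1 + 1) * y :: xs)).
Proof.
move=> hs hy; have := pvmP (p := M) (pv_recE g h0 h1 b (Var 0)
  (map_tuple (tshift 1) (var_tuple m))) (ecat (y :: xs) (fun _ => 0)).
cbn [sat]; rewrite !evalE !eval_ap ?[size _]/= ?size_tuple // !map_cons.
by rewrite !eval_ap ?[size _]/= ?size_tuple // !map_cons !evalE shifted_vars //;
  apply.
Qed.

Lemma fna_recO M (y : M) xs : size xs = m ->
  fna f ((1 + 1) * y + 1 :: xs) =
  minimum (fna h1 [:: y, fna f (y :: xs) & xs]) (fna b ((1 + 1) * y + 1 :: xs)).
Proof.
move=> hs; have := pvmP (p := M) (pv_recO g h0 h1 b (Var 0)
  (map_tuple (tshift 1) (var_tuple m))) (ecat (y :: xs) (fun _ => 0)).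
cbn [sat]; rewrite !evalE !eval_ap ?[size _]/= ?size_tuple // !map_cons.
by rewrite !eval_ap ?[size _]/= ?size_tuple // !map_cons !evalE shifted_vars.
Qed.

Lemma fna_rec_le M (y : M) xs : size xs = m -> fna f (y :: xs) <= fna b (y :: xs).
Proof.
move=> hs; case: (halfP y) => ->; last by rewrite fna_recO //; exact: minM_ler.
case: (classic (quo y 1 = 0)) => [->|h].
  by rewrite mulM0 fna_rec0 //; exact: minM_ler.
by rewrite fna_recE //; exact: minM_ler.
Qed.

End Rec.

Definition fn_zero m : fsym n m :=
  fComp fZero (fun i : 'I_0 => match notF (ltn_ord i) with end).

(** Bounded recursion takes symbols as data, whereas functions are easier to write as terms.
    Variables from [m] on are read as 0, which matches the zero environment in [fna_term_fsym]. *)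
Fixpoint term_fsym m (t : term n) : fsym n m :=
  match t with
  | Var i => if insub i is Some j then fProj (j : 'I_m) else fn_zero m
  | App l f a => fComp f (fun i => term_fsym m (a i))
  end.

Lemma fna_term_fsym M m (t : term n) (xs : seq M) : size xs = m ->
  fna (term_fsym m t) xs = eval (ecat xs (fun _ => 0)) t.
Proof.
move=> hs; elim: t => [i|l f a IH] /=; last first.
  rewrite fna_comp //; rewrite /eval -/eval; congr fn.
  exact: functional_extensionality.
rewrite eval_Var (ecat_nth 0) hs; case: insubP => [j hj <-|].
  by rewrite fna_proj // ltn_ord.
move=> /negbTE ->; rewrite /fn_zero fna_comp //.
by congr fn; apply: functional_extensionality => j; case: (notF (ltn_ord j)).
Qed.

Lemma eval_fresh (t : term n) : exists N, forall m, (N <= m)%N ->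
  forall (M : pvmodel n) (e : nat -> M),
  eval e t = eval (ecat (etake m e) (fun _ => 0)) t.
Proof.
have [N hN] := tsub_fresh t; exists N => m hm M e.
rewrite -[in LHS](tsub_Var t) (hN _ (fun i => if (i < m)%N then Var i else 0%pv)).
  rewrite eval_tsub; congr eval; apply: functional_extensionality => i.
  rewrite (ecat_nth 0) size_mkseq; case: ltnP => hi; last by rewrite evalE.
  by rewrite nth_mkseq.
by move=> i hi; rewrite (leq_trans hi hm).
Qed.

(** By [pv_smash_min] a smash is the least number of its length, so it is enough to compare lengths.
    Up to the summand 1 these are a product of lengths for the first smash, and the previous smash
    of the lengths afterwards. *)
Lemma fna_smash_mono M i (h : 1 < i <= n) (x y x' y' : M) :
  x <= x' -> y <= y' -> fna (fSmash i h) [:: x; y] <= fna (fSmash i h) [:: x'; y'].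
Proof.
case: i h => [//|[//|i]] h; elim: i h x y x' y' => [|i IH] h x y x' y' hx hy.
- have hl a b : length (fna (fSmash 2 h) [:: a; b]) = length a * length b + 1 :> M.
    have := pvmP (p := M) (pv_basic (basic13 (Var 0) (Var 1) h))
      (ecat [:: a; b] (fun _ => 0)).
    by cbn [sat]; rewrite !evalE.
  have := pvmP (p := M) (pv_smash_min (Var 0) (Var 1) (Var 2) h)
    (ecat [:: x; y; fna (fSmash 2 h) [:: x'; y']] (fun _ => 0)).
  cbn [sat]; rewrite !evalE; apply; rewrite [ecat _ _ _]/= !hl; apply/leM_add2r.
  by apply: leM_mul; exact: len_mono.
- have h' : 1 < i.+2 <= n by case/andP: h => _ /ltnW.
  have hl a b : length (fna (fSmash i.+3 h) [:: a; b]) =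
      fna (fSmash i.+2 h') [:: length a; length b] + 1 :> M.
    have := pvmP (p := M) (pv_smash_lenS (Var 0) (Var 1) h' h)
      (ecat [:: a; b] (fun _ => 0)).
    by cbn [sat]; rewrite !evalE.
  have := pvmP (p := M) (pv_smash_min (Var 0) (Var 1) (Var 2) h)
    (ecat [:: x; y; fna (fSmash i.+3 h) [:: x'; y']] (fun _ => 0)).
  cbn [sat]; rewrite !evalE; apply; rewrite [ecat _ _ _]/= !hl; apply/leM_add2r.
  by apply: IH; exact: len_mono.
Qed.

Definition monotone (t : term n) : Prop :=
  forall (M : pvmodel n) (e e' : nat -> M), (forall i, e i <= e' i) ->
  eval e t <= eval e' t.

Lemma monotone_sub t s : monotone t -> (forall i, monotone (s i)) ->
  monotone (tsub s t).
Proof.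
by move=> ht hs M e e' h; rewrite !eval_tsub; apply: ht => i; exact: hs.
Qed.

(** Symbols themselves need not be monotone. Differences and quotients are bounded by their first
    argument, compositions by the composed bounds, and a recursion by the bound of its cut-off,
    whatever the step functions are. *)
Lemma fsym_bound m (f : fsym n m) : exists2 T, monotone T &
  forall M (xs : seq M) e, size xs = m -> fna f xs <= eval (ecat xs e) T.
Proof.
elim: f => {m}.
- exists 0%pv => [M e e' _|M [] // e _]; first by rewrite !evalE; exact: leMM.
  by rewrite -(eval_ap e fZero (ts := [::])) //; exact: leMM.
- exists 1%pv => [M e e' _|M [] // e _]; first by rewrite !evalE; exact: leMM.
  by rewrite -(eval_ap e fOne (ts := [::])) //; exact: leMM.
- exists (len (Var 0)) => [M e e' h|M [//|x []] // e _].
    by rewrite !evalE; exact: len_mono.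
  by rewrite !evalE; exact: leMM.
- exists (Var 0 + Var 1)%pv => [M e e' h|M [//|x [//|y []]] // e _].
    by rewrite !evalE; exact: leM_add.
  by rewrite !evalE; exact: leMM.
- exists (Var 0) => [M e e' h|M [//|x [//|y []]] // e _].
    by rewrite !evalE.
  by rewrite !evalE; exact: subM_le.
- exists (Var 0 * Var 1)%pv => [M e e' h|M [//|x [//|y []]] // e _].
    by rewrite !evalE; exact: leM_mul.
  by rewrite !evalE; exact: leMM.
- exists (Var 0) => [M e e' h|M [//|x [//|y []]] // e _].
    by rewrite !evalE.
  rewrite !evalE; apply: leM_trans (quo_le x y); rewrite -{1}(mulM1 (fna _ _)).
  by apply: leM_mul; [exact: leMM|exact: leM_addl].
- move=> i h; exists (smash h (Var 0) (Var 1)) => [M e e' he|M [//|x [//|y []]] // e _].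
    by rewrite !evalE; exact: fna_smash_mono.
  by rewrite !evalE; exact: leMM.
- move=> m i; exists (Var i) => [M e e' he|M xs e hs]; first exact: he.
  by rewrite fna_proj // eval_Var (ecat_nth 0) hs ltn_ord; exact: leMM.
- move=> m l g [Tg mg hg] h IH.
  have [S hS] := choice_fun (fun i => let: ex_intro2 T a b := IH i in
    ex_intro (fun T => monotone T /\ forall M (xs : seq M) e, size xs = l ->
      fna (h i) xs <= eval (ecat xs e) T) T (conj a b)).
  pose s i := if insub i is Some j then S j else 0%pv.
  exists (tsub s Tg).
    apply: monotone_sub => // i; rewrite /s.
    case: insubP => [j _ _|_]; first by case: (hS j).
    by move=> M e e' _; rewrite !evalE; exact: leMM.
  move=> M xs e hs; rewrite fna_comp // eval_tsub.
  pose ys := [seq fna (h j) xs | j <- enum 'I_m].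
  have hys : size ys = m by rewrite size_map size_enum_ord.
  have nys (j : 'I_m) : nth 0 ys j = fna (h j) xs.
    by rewrite (nth_map j) ?size_enum_ord // (nth_ord_enum j j).
  have -> : fn g (fun j => fna (h j) xs) = fna g ys.
    by congr fn; apply: functional_extensionality => j.
  apply: leM_trans (hg _ _ (fun _ => 0) hys) _; apply: mg => i.
  rewrite (ecat_nth 0) hys /s; case: insubP => [j hj <-|].
    by rewrite ltn_ord nys; case: (hS j) => _; apply.
  by move=> /negbTE ->; rewrite evalE; exact: leMM.
- move=> m g _ h0 _ h1 _ b [T mT hT]; exists T => // M [//|y xs] e [hs].
  apply: leM_trans (hT M (y :: xs) e _); last by rewrite /= hs.
  exact: fna_rec_le.
Qed.

Lemma term_bound (t : term n) : exists2 T, monotone T &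
  forall M (e : nat -> M), eval e t <= eval e T.
Proof.
have [N hN] := eval_fresh t; have [T mT hT] := fsym_bound (term_fsym N t).
exists T => // M e; rewrite (hN N) // -(@fna_term_fsym _ N) ?size_mkseq //.
by rewrite -{2}(ecat_take_drop N e); apply: hT; rewrite size_mkseq.
Qed.

(** * Decidable predicates *)

Definition pred := forall M : pvmodel n, (nat -> M) -> Prop.

(** One term has to serve all models and environments. Truth is coded by 0, so that conjunction
    becomes addition and negation becomes [1 - t]. *)
Definition decidable (P : pred) : Prop :=
  exists t, forall (M : pvmodel n) (e : nat -> M), P M e <-> eval e t = 0.

Lemma decidable_ext (P Q : pred) : (forall M e, P M e <-> Q M e) ->
  decidable P -> decidable Q.
Proof. by move=> h [t ht]; exists t => M e; rewrite -h. Qed.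

Lemma decidable_not (P : pred) : decidable P -> decidable (fun M e => ~ P M e).
Proof.
move=> [t ht]; exists (1 - t)%pv => M e; rewrite ht evalE subM_eq0P evalE.
exact: posM.
Qed.

Lemma addM_eq0 (M : pvmodel n) (x y : M) : x + y = 0 <-> x = 0 /\ y = 0.
Proof.
split=> [h|[-> ->]]; last by rewrite addM0.
by split; apply/leM0; rewrite -h; [exact: leM_addr|exact: leM_addl].
Qed.

Lemma decidable_and (P Q : pred) : decidable P -> decidable Q ->
  decidable (fun M e => P M e /\ Q M e).
Proof.
move=> [t ht] [u hu]; exists (t + u)%pv => M e.
by rewrite ht hu evalE addM_eq0.
Qed.

Lemma decidable_or (P Q : pred) : decidable P -> decidable Q ->
  decidable (fun M e => P M e \/ Q M e).
Proof.
move=> /decidable_not hP /decidable_not hQ.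
apply: decidable_ext (decidable_not (decidable_and hP hQ)) => M e /=; tauto.
Qed.

Lemma decidable_imp (P Q : pred) : decidable P -> decidable Q ->
  decidable (fun M e => P M e -> Q M e).
Proof.
move=> /decidable_not hP hQ.
apply: decidable_ext (decidable_or hP hQ) => M e /=; tauto.
Qed.

Lemma decidable_le (t u : term n) :
  decidable (fun M e => eval e t <= eval e u).
Proof. by exists (t - u)%pv => M e; rewrite evalE subM_eq0P. Qed.

Lemma decidable_eq (t u : term n) :
  decidable (fun M e => eval e t = eval e u).
Proof.
apply: decidable_ext (decidable_and (decidable_le t u) (decidable_le u t)) => M e.
by split=> [[]|->]; [exact: leM_anti|split; exact: leMM].
Qed.

Lemma decidable_const (P : Prop) : decidable (fun _ _ => P).
Proof.
case: (classic P) => h; [exists 0%pv|exists 1%pv] => M e; rewrite evalE.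
- by split.
- by split=> // /oneM_neq0.
Qed.

Lemma decidable_sub (P : pred) s : decidable P ->
  decidable (fun M e => P M (fun i => eval e (s i))).
Proof. by move=> [t ht]; exists (tsub s t) => M e; rewrite eval_tsub. Qed.

(* [f] searches for a counterexample [i] and returns [i + 1], or [0] if there is
   none. *)
Lemma sharply_bounded_search m (c : fsym n m.+1) : exists f : fsym n m.+1,
  forall M (y : M) xs, size xs = m ->
  (fna f (y :: xs) = 0 -> forall i, i <= length y -> fna c (i :: xs) = 0) /\
  (fna f (y :: xs) <> 0 -> exists2 i, i <= length y & fna c (i :: xs) <> 0).
Proof.
pose ct l t : term n := ap c (t :: mkseq (fun j => Var (l + j)%N) m).
have ctE l t M (e : nat -> M) : eval e (ct l t) =
    fna c (eval e t :: etake m (edrop l e)).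
  by rewrite /ct eval_ap /= ?size_mkseq // /mkseq -map_comp.
pose g := term_fsym m (tmin (ct 0%N 0) 1)%pv.
(* [Var 0] is the half of the current argument, so the index to be tested is the length of [Var 0]
   plus 1. A nonzero earlier result [Var 1] is kept; otherwise a failure is recorded as the index
   plus 1. Only lengths matter, hence one symbol serves both digits. *)
pose h := term_fsym m.+2 (Var 1 + (1 - Var 1) *
  (tmin (ct 2%N (len (Var 0) + 1)) 1 * (len (Var 0) + 1 + 1)))%pv.
(* Results never exceed the length of the argument plus 1, so this cut-off never changes a value. *)
pose b := term_fsym m.+1 (len (Var 0) + 1)%pv.
pose f := fRec g h h b; exists f.
have gE M (xs : seq M) : size xs = m ->
    fna g xs = minimum (fna c (0 :: xs)) 1.
  move=> hs; rewrite /g fna_term_fsym // !evalE ctE evalE.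
  by rewrite /edrop -/(etake _ _) -[in etake m _]hs etake_ecat.
have hE M (y v : M) xs : size xs = m -> fna h [:: y, v & xs] =
    v + (1 - v) * (minimum (fna c (length y + 1 :: xs)) 1 * (length y + 1 + 1)).
  move=> hs; rewrite /h fna_term_fsym /= ?hs // !evalE ctE !evalE.
  by rewrite [edrop _ _](_ : _ = ecat xs (fun _ => 0)) // -[in etake m _]hs
    etake_ecat.
have bE M (y : M) xs : size xs = m -> fna b (y :: xs) = length y + 1.
  by move=> hs; rewrite /b fna_term_fsym /= ?hs // !evalE.
have f0 M (xs : seq M) : size xs = m ->
    fna f (0 :: xs) = minimum (fna c (0 :: xs)) 1.
  move=> hs; rewrite fna_rec0 // gE // bE // len0 add0M minM_l //.
  exact: minM_ler.
have lenS M (y : M) : y <> 0 -> length y = length (quo y 1) + 1.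
  exact: len_half.
have fS M (y : M) xs : size xs = m -> y <> 0 -> fna f (y :: xs) =
    let v := fna f (quo y 1 :: xs) in
    v + (1 - v) * (minimum (fna c (length y :: xs)) 1 * (length y + 1)).
  move=> hs hy /=.
  have e q : y = (1 + 1) * q \/ y = (1 + 1) * q + 1 -> fna f (y :: xs) =
      minimum (fna h [:: q, fna f (q :: xs) & xs]) (fna b (y :: xs)).
    case=> hq; rewrite hq; last by rewrite fna_recO.
    by rewrite fna_recE // => e; apply: hy; rewrite hq e mulM0.
  have hv : fna f (quo y 1 :: xs) <= length y.
    by rewrite (lenS _ y) // -(bE _ _ xs) //; exact: fna_rec_le.
  rewrite (e _ (halfP y)) hE // bE // -lenS // minM_l //.
  case: (classic (fna f (quo y 1 :: xs) = 0)) => [->|/posM h1].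
    rewrite add0M subM0 mul1M -{2}(mul1M (length y + 1)).
    by apply: leM_mul; [exact: minM_ler|exact: leMM].
  by rewrite (subM_eq0 h1) mul0M addM0; apply: leM_trans hv _; exact: leM_addr.
(* Both halves of the claim become quantifier-free statements about [f], as the induction rule
   requires: in [key1] the index is a parameter, in [key2] the witness is the explicit term
   [f - 1]. *)
have key1 M (y i : M) xs : size xs = m -> fna f (y :: xs) = 0 ->
    i <= length y -> fna c (i :: xs) = 0.
  pose ft : term n := ap f (Var 0 :: mkseq (fun j => Var (2 + j)%N) m).
  have ftE M' (e : nat -> M') : eval e ft = fna f (e 0%N :: etake m (edrop 2 e)).
    by rewrite /ft eval_ap /= ?size_mkseq // evalE /mkseq -map_comp.
  have := @pv_notation_ind n
    (ft == 0 -> Var 1 <= len (Var 0) -> ct 2%N (Var 1) == 0)%pv erefl.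
  move=> /(_ _ _ M (ecat [:: y, i & xs] (fun _ => 0))) /=.
  rewrite !ftE !ctE !evalE /= => H hs; move: H.
  rewrite [edrop _ _](_ : _ = ecat xs (fun _ => 0)) // -[in etake m _]hs etake_ecat.
  apply.
  - move=> M' e /=; rewrite !ftE !ctE !evalE /= f0 ?size_mkseq // len0.
    move=> h1 /leM0 ->; move: h1.
    case: (leM_total (fna c (0 :: etake m (edrop 2 (econs 0 e)))) 1) => h2.
      by rewrite minM_l.
    by rewrite minM_r // => /oneM_neq0.
  - move=> M' e /=; rewrite !ftE !ctE !evalE /= -/(etake m (edrop 2 e)).
    rewrite [edrop 2 (econs _ _)](_ : _ = edrop 2 e) // => IH.
    case: (classic (e 0%N = 0)) => [h0|h0]; first by rewrite h0 quoM0 in IH; rewrite h0.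
    rewrite fS ?size_mkseq //= => /addM_eq0[hv].
    rewrite hv subM0 mul1M => hc; case: (leM_gtP (e 1%N) (length (quo (e 0%N) 1))).
      by move=> hi _; exact: IH.
    rewrite -lenS // => h1 h2; rewrite (leM_anti h2 h1); move: hc.
    case: (leM_total (fna c (length (e 0%N) :: etake m (edrop 2 e))) 1) => h3.
      rewrite minM_l // => h4; apply: NNPP => /posM h5.
      have : 1 * (length (e 0%N) + 1) <= 0.
        by rewrite -h4; apply: leM_mul => //; exact: leMM.
      by rewrite mul1M => /leM0 /addM_eq0[_ /oneM_neq0].
    by rewrite minM_r // mul1M => /addM_eq0[_ /oneM_neq0].
have key2 M (y : M) xs : size xs = m -> fna f (y :: xs) <> 0 ->
    fna f (y :: xs) - 1 <= length y /\ fna c (fna f (y :: xs) - 1 :: xs) <> 0.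
  pose ft : term n := ap f (Var 0 :: mkseq (fun j => Var (1 + j)%N) m).
  have ftE M' (e : nat -> M') : eval e ft = fna f (e 0%N :: etake m (edrop 1 e)).
    by rewrite /ft eval_ap /= ?size_mkseq // evalE /mkseq -map_comp.
  have := @pv_notation_ind n (~ (ft == 0) ->
    (ft - 1 <= len (Var 0) /\ ~ (ct 1%N (ft - 1) == 0)))%pv erefl.
  move=> /(_ _ _ M (ecat (y :: xs) (fun _ => 0))) /=.
  rewrite !ctE !evalE !ftE ?evalE /= => H hs; move: H.
  rewrite [edrop _ _](_ : _ = ecat xs (fun _ => 0)) // -[in etake m _]hs etake_ecat.
  apply.
  - move=> M' e /=; rewrite !ctE !evalE !ftE ?evalE /= f0 ?size_mkseq // len0.
    case: (leM_total (fna c (0 :: etake m (edrop 1 (econs 0 e)))) 1) => h2.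
      rewrite minM_l // => h3; rewrite (subM_eq0 h2); split=> //; exact: leMM.
    rewrite minM_r // => h3; rewrite subMM; split; first exact: leMM.
    by move=> h4; apply: h3; apply/leM0; rewrite h4 in h2.
  - move=> M' e /=; rewrite !ctE !evalE !ftE ?evalE /=.
    rewrite [edrop 1 (econs _ _)](_ : _ = edrop 1 e) // => IH.
    case: (classic (e 0%N = 0)) => [h0|h0]; first by rewrite h0 quoM0 in IH; rewrite h0.
    rewrite fS ?size_mkseq //=.
    case: (classic (fna f (quo (e 0%N) 1 :: etake m (edrop 1 e)) = 0)) => hv.
      rewrite hv subM0 mul1M add0M => h1.
      case: (classic (fna c (length (e 0%N) :: etake m (edrop 1 e)) = 0)) => hc.
        by case: h1; rewrite hc minM_l ?mul0M //; exact: le0M.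
      move/posM: (hc) => hc'; rewrite minM_r // mul1M addMK; split=> //; exact: leMM.
    move/posM: (hv) => hv'; rewrite (subM_eq0 hv') mul0M addM0 => _.
    case: (IH hv) => h1 h2; split=> //; apply: leM_trans h1 _.
    by rewrite (lenS _ (e 0%N)) //; exact: leM_addr.
move=> M y xs hs; split=> [hy i hi|hy]; first exact: key1 hy hi.
by case: (key2 M y xs hs hy) => h1 h2; exists (fna f (y :: xs) - 1).
Qed.

Lemma decidable_ball (P : pred) t : decidable P ->
  decidable (fun M e => forall i : M, i <= length (eval e t) -> P M (econs i e)).
Proof.
move=> [c hc]; have [N hN] := eval_fresh c.
have [f hf] := sharply_bounded_search (term_fsym N.+1 c).
exists (ap f (t :: mkseq Var N)) => M e.
have eE : eval e (ap f (t :: mkseq Var N)) = fna f (eval e t :: etake N e).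
  by rewrite eval_ap /= ?size_mkseq // /mkseq -map_comp.
have cE i : fna (term_fsym N.+1 c) (i :: etake N e) = 0 <-> P M (econs i e).
  rewrite fna_term_fsym /= ?size_mkseq // hc (hN N.+1 _ M (econs i e)) //.
  by rewrite etake_econs.
rewrite eE; have [h1 h2] := hf M (eval e t) (etake N e) (size_mkseq _ _).
split=> [h|/h1 h i /h /cE //]; apply: NNPP => /h2[i hi hn].
by apply: hn; apply/cE; exact: h.
Qed.

Lemma decidable_sharply_bounded (A : form n) :
  sharply_bounded A -> decidable (fun M e => sat e A).
Proof.
elim=> {A}.
- exact: decidable_const.
- exact: decidable_eq.
- exact: decidable_le.
- by move=> A B _ hA _ hB; exact: decidable_imp.
- by move=> A B _ hA _ hB; exact: decidable_and.
- by move=> A B _ hA _ hB; exact: decidable_or.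
- move=> t A _ /(decidable_ball t); apply: decidable_ext => M e /=.
  by split=> h i; move: (h i); rewrite eval_tshift edrop_econs !evalE.
- move=> t A _ /decidable_not /(decidable_ball t) /decidable_not.
  apply: decidable_ext => M e /=; split=> [h|[i [hi hA]] h].
    apply: NNPP => hn; apply: h => i hi hA; apply: hn; exists i.
    by rewrite eval_tshift edrop_econs eval_len; split.
  apply: (h i) hA; move: hi.
  by rewrite eval_tshift edrop_econs !evalE.
Qed.

End FunctionSymbols.

Local Close Scope pvm_scope.

(** * Games *)

(* A [Pi_(k+1)] formula is read as a block of bounded universal quantifiers
   followed by the negation of a [Pi_k] formula, so that a single polarity is
   needed: in [X : game D k.+1], [X.1] holds the bounds and [X.2] maps a move
   to the game whose failure is claimed. *)
Fixpoint game (D : Type) (k : nat) : Type :=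
  if k is j.+1 then (seq D * (seq D -> game D j))%type else Prop.

Fixpoint geqv D k : game D k -> game D k -> Prop :=
  if k is j.+1 return game D k -> game D k -> Prop then fun X Y =>
    X.1 = Y.1 /\ forall us, size us = size X.1 -> geqv (X.2 us) (Y.2 us)
  else iff.

(** The order witnessed by copying moves. The arguments change places behind each block because
    there the inner game is the one to be refuted. *)
Fixpoint gle D k : game D k -> game D k -> Prop :=
  if k is j.+1 return game D k -> game D k -> Prop then fun X Y =>
    X.1 = Y.1 /\ forall us, size us = size X.1 -> gle (Y.2 us) (X.2 us)
  else fun X Y => X -> Y.

(** [b] selects conjunction. It is negated behind a block: refuting a conjunction means winning one
    of the inner games, that is, their disjunction. *)
Fixpoint gop D (b : bool) k : game D k -> game D k -> game D k :=
  if k is j.+1 return game D k -> game D k -> game D k then fun X Y =>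
    (X.1 ++ Y.1, fun us => gop (~~ b) (X.2 (take (size X.1) us))
                                      (Y.2 (drop (size X.1) us)))
  else fun X Y => if b then X /\ Y else X \/ Y.

Fixpoint gpad D k (P : Prop) : game D k :=
  if k is j.+1 return game D k then ([::], fun _ => gpad D j (~ P)) else P.

Section GameEquivalence.
Variable D : Type.

Lemma geqv_refl k (X : game D k) : geqv X X.
Proof. by elim: k X => [|k IH] X /=; split. Qed.

Lemma geqv_sym k (X Y : game D k) : geqv X Y -> geqv Y X.
Proof.
elim: k X Y => [|k IH] X Y /=; first by case; split.
by case=> e h; split=> // us hs; apply: IH; apply: h; rewrite e.
Qed.

Lemma geqv_trans k (X Y Z : game D k) : geqv X Y -> geqv Y Z -> geqv X Z.
Proof.
elim: k X Y Z => [|k IH] X Y Z /=; first by case=> h1 h2 [h3 h4]; split; auto.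
case=> e1 h1 [e2 h2]; split=> [|us hs]; first by rewrite e1.
by apply: IH (h1 _ hs) (h2 _ _); rewrite -e1.
Qed.

Lemma geqv_gle k (X Y : game D k) : geqv X Y -> gle X Y.
Proof.
elim: k X Y => [|k IH] X Y /=; first by case.
by case=> e h; split=> // us hs; apply: IH; apply: geqv_sym; exact: h.
Qed.

Lemma gop_geqv b k (X X' Y Y' : game D k) : geqv X X' -> geqv Y Y' ->
  geqv (gop b X Y) (gop b X' Y').
Proof.
elim: k b X X' Y Y' => [|k IH] b X X' Y Y' /=.
  by case=> h1 h2 [h3 h4]; case: b; split; case; auto.
case=> e1 h1 [e2 h2]; rewrite -e1 -e2; split=> // us; rewrite size_cat => hs.
apply: IH; [apply: h1|apply: h2].
- by rewrite size_takel // hs leq_addr.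
- by rewrite size_drop hs addKn.
Qed.

(** Linear distributivity: each of [X], [Y], [Z] occurs once on both sides, so copying moves
    suffices. Full distributivity would duplicate a game. The two halves are exchanged at every
    block. *)
Lemma gop_distr k (X Y Z : game D k) :
  gle (gop true X (gop false Y Z)) (gop false (gop true X Y) Z) /\
  gle (gop true (gop false X Y) Z) (gop false X (gop true Y Z)).
Proof.
elim: k X Y Z => [|k IH] X Y Z /=; first by tauto.
split; (split=> [|us]; first by rewrite catA).
- rewrite !size_cat => hs; rewrite drop_drop take_drop (addnC (size Y.1)).
  by rewrite take_takel ?leq_addr //; exact: (proj2 (IH _ _ _)).
- rewrite !size_cat => hs; rewrite drop_drop take_drop (addnC (size Y.1)).
  by rewrite take_takel ?leq_addr //; exact: (proj1 (IH _ _ _)).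
Qed.

Lemma gle_pad k (X : game D k) (P : Prop) :
  (P -> gle X (gop true X (gpad D k P))) /\
  (~ P -> gle (gop false X (gpad D k P)) X).
Proof.
elim: k X P => [|k IH] X P /=; first by tauto.
split=> hP; (split=> [|us]; first by rewrite cats0).
- move=> hs; rewrite -hs take_size; case: (IH (X.2 us) (~ P)) => _; apply.
  by [].
- rewrite cats0 => hs; rewrite -hs take_size; case: (IH (X.2 us) (~ P)).
  by move=> h _; exact: h.
Qed.

End GameEquivalence.

Arguments geqv : simpl never.
Arguments gle : simpl never.

Definition vles n (M : model n) : seq M -> seq M -> Prop := List.Forall2 (@lem n M).

Lemma vles_size n (M : model n) (us vs : seq M) : vles us vs -> size us = size vs.
Proof. by elim=> //= x y us' vs' _ _ ->. Qed.

Lemma vles_cat n (M : model n) (us us' vs vs' : seq M) :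
  size us = size vs -> vles (us ++ us') (vs ++ vs') <-> vles us vs /\ vles us' vs'.
Proof.
elim: us vs => [|u us IH] [|v vs] //= => [_|[hs]].
  by split=> [h|[]]; [split=> //; constructor|].
split=> [h|[h1 h2]].
- by inversion h; subst; have [h1 h2] := proj1 (IH _ hs) H4; split=> //; constructor.
- by inversion h1; subst; constructor=> //; apply/IH.
Qed.

Lemma vles_zeros n (M : pvmodel n) (us : seq M) r : size us = r ->
  vles (nseq r (zero M)) us.
Proof.
by move=> <-; elim: us => [|u us IH]; constructor=> //; exact: le0M.
Qed.

Section Games.
Variable n : nat.

(** A game given in all models and environments at once, since a strategy consists of terms and must
    be the same everywhere. *)
Definition ugame (k : nat) : Type :=
  forall M : pvmodel n, (nat -> M) -> game M k.

Definition usub k (s : nat -> term n) (X : ugame k) : ugame k :=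
  fun M e => X M (fun i => eval e (s i)).

Definition uop b k (X Y : ugame k) : ugame k := fun M e => gop b (X M e) (Y M e).

Definition upad k (P : pred n) : ugame k := fun M e => gpad M k (P M e).

Definition ublock k (ps : seq (term n)) (C : ugame k) : ugame k.+1 :=
  fun M e => (map (eval e) ps, fun us => C M (ecat us e)).

(** The count [N] of bounded quantifiers is the measure for two later inductions: the one proving
    [decision] and the one proving truth in the generic model. *)
Fixpoint rep k (N : nat) : ugame k -> Prop :=
  if k is j.+1 return ugame k -> Prop then fun X =>
    exists ps C N', [/\ N = size ps + N', rep N' C &
      forall M e, geqv (X M e) (ublock ps C e)]
  else fun X => decidable X.

Definition representable k (X : ugame k) : Prop := exists N, rep N X.

(** After a move, the context [E] holds the [l] entries of the move in front of the old environment.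
    [ucont] continues the game in which the move was made, [ucontf] the game answered by the terms
    [f]. *)
Definition ucont k l (X : ugame k.+1) : ugame k :=
  fun M E => (X M (edrop l E)).2 (etake l E).

Definition ucontf k l (f : seq (term n)) (X : ugame k.+1) : ugame k :=
  fun M E => (X M (edrop l E)).2 (map (eval E) f).

Definition within k l (G : pred n) (Y : ugame k.+1) : pred n :=
  fun M E => G M (edrop l E) /\ vles (etake l E) (Y M (edrop l E)).1.

(* Terms [f] compute a move in [X] from a move in [Y]; then the roles are
   exchanged. *)
Fixpoint red k : pred n -> ugame k -> ugame k -> Prop :=
  if k is j.+1 return pred n -> ugame k -> ugame k -> Prop then fun G X Y =>
    exists l f, [/\ forall M e, G M e -> size (Y M e).1 = l,
      forall M E, within l G Y E -> vles (map (eval E) f) (X M (edrop l E)).1 &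
      red (within l G Y) (ucont l Y) (ucontf l f X)]
  else fun G X Y => forall M e, G M e -> X M e -> Y M e.

Lemma rep_ext k N (X X' : ugame k) : (forall M e, geqv (X M e) (X' M e)) ->
  rep N X -> rep N X'.
Proof.
case: k X X' => [|k] X X' h /=; first exact: decidable_ext.
move=> [ps [C [N' [e hC hX]]]]; exists ps, C, N'; split=> // M e'.
by apply: geqv_trans (hX M e'); apply: geqv_sym; exact: h.
Qed.

Lemma representable_ext k (X X' : ugame k) : (forall M e, geqv (X M e) (X' M e)) ->
  representable X -> representable X'.
Proof. by move=> h [N hN]; exists N; exact: rep_ext hN. Qed.

Definition ups l (s : nat -> term n) (i : nat) : term n :=
  if i < l then Var i else tshift l (s (i - l)).

Lemma eval_ups (M : pvmodel n) (E : nat -> M) l s :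
  (fun i => eval E (ups l s i)) = ecat (etake l E) (fun i => eval (edrop l E) (s i)).
Proof.
apply: functional_extensionality => i; rewrite (ecat_nth (E 0)) size_mkseq /ups.
by case: ltnP => h; [rewrite nth_mkseq|rewrite eval_tshift].
Qed.

Lemma etake_size D l (E : nat -> D) : size (etake l E) = l.
Proof. exact: size_mkseq. Qed.

Lemma edrop_ups (M : pvmodel n) (E : nat -> M) l s :
  edrop l (fun i => eval E (ups l s i)) = fun i => eval (edrop l E) (s i).
Proof. by rewrite eval_ups -{1}(etake_size l E) edrop_ecat. Qed.

Lemma etake_ups (M : pvmodel n) (E : nat -> M) l s :
  etake l (fun i => eval E (ups l s i)) = etake l E.
Proof. by rewrite eval_ups -{1}(etake_size l E) etake_ecat. Qed.

Lemma eval_block_sub (M : pvmodel n) (E : nat -> M) ts l :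
  (fun i => eval E (block_sub ts l i)) = ecat (map (eval E) ts) (edrop l E).
Proof.
apply: functional_extensionality => i; rewrite (ecat_nth (E 0)) size_map /block_sub.
by case: ltnP => h; [rewrite (nth_map (Var 0))|].
Qed.

Lemma rep_sub k N (X : ugame k) s : rep N X -> rep N (usub s X).
Proof.
elim: k N X s => [|k IH] N X s /=; first exact: decidable_sub.
move=> [ps [C [N' [e hC hX]]]].
exists (map (tsub s) ps), (usub (ups (size ps) s) C), N'; split.
- by rewrite size_map.
- exact: IH.
- move=> M e'; apply: geqv_trans (hX _ _) _; split=> [|us] /=.
    by rewrite -map_comp; apply: eq_map => t /=; rewrite eval_tsub.
  rewrite size_map => hs; rewrite /usub eval_ups -hs edrop_ecat etake_ecat.
  exact: geqv_refl.
Qed.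

Lemma representable_sub k (X : ugame k) s :
  representable X -> representable (usub s X).
Proof. by move=> [N hN]; exists N; exact: rep_sub. Qed.

Lemma representable_op b k (X Y : ugame k) :
  representable X -> representable Y -> representable (uop b X Y).
Proof.
elim: k b X Y => [|k IH] b X Y [N1] /=.
  move=> hX [N2 hY]; exists 0; rewrite /= /uop /=; case: b.
    exact: decidable_and.
  exact: decidable_or.
move=> [ps [C [N1' [_ hC hX]]]] [N2] [qs [D [N2' [_ hD hY]]]].
pose l := size ps; pose r := size qs.
pose s1 i : term n := Var (if i < l then i else r + i).
pose s2 i : term n := Var (l + i).
have [N hN] : representable (uop (~~ b) (usub s1 C) (usub s2 D)).
  by apply: IH; apply: representable_sub; [exists N1'|exists N2'].
exists (size (ps ++ qs) + N), (ps ++ qs), (uop (~~ b) (usub s1 C) (usub s2 D)), N.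
split=> // M e; apply: geqv_trans (gop_geqv b (hX M e) (hY M e)) _.
split=> [|us] /=; first by rewrite map_cat.
rewrite size_cat !size_map => hs; apply: gop_geqv; rewrite /usub /s1 /s2.
- have -> : (fun i => eval (ecat us e) (Var (if i < l then i else r + i))) =
    ecat (take l us) e; last exact: geqv_refl.
  apply: functional_extensionality => i; rewrite eval_Var !(ecat_nth (e 0)).
  rewrite size_takel hs ?leq_addr // -/l -/r; case: (ltnP i l) => hi.
    by rewrite ltn_addr // nth_take.
  by rewrite addnC ltn_add2r ltnNge hi /= subnDr.
- have -> : (fun i => eval (ecat us e) (Var (l + i))) = ecat (drop l us) e;
    last exact: geqv_refl.
  apply: functional_extensionality => i; rewrite eval_Var !(ecat_nth (e 0)).
  by rewrite size_drop hs addKn ltn_add2l nth_drop subnDl.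
Qed.

Lemma representable_pad k (P : pred n) : decidable P -> representable (upad k P).
Proof.
move=> hP; exists 0; elim: k P hP => [//|k IH] P hP /=.
exists [::], (upad k (fun M e => ~ P M e)), 0; split=> //.
- by apply: IH; exact: decidable_not.
- by move=> M e; split=> // -[] //= _; exact: geqv_refl.
Qed.

Lemma representable_block k ps (C : ugame k) :
  representable C -> representable (ublock ps C).
Proof.
move=> [N hN]; exists (size ps + N), ps, C, N; split=> // M e.
exact: geqv_refl.
Qed.

Lemma representable_cont k (X : ugame k.+1) : representable X ->
  exists ps, [/\ forall M e, (X M e).1 = map (eval e) ps,
    representable (ucont (size ps) X) &
    forall l f, size f = size ps -> representable (ucontf l f X)].
Proof.
move=> [N [ps [C [N' [_ hC hX]]]]]; exists ps; split.
- by move=> M e; case: (hX M e).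
- exists N'; apply: rep_ext hC => M E; rewrite /ucont.
  case: (hX M (edrop (size ps) E)) => e /(_ (etake (size ps) E)).
  rewrite e /= size_map etake_size ecat_take_drop => /(_ erefl).
  exact: geqv_sym.
- move=> l f hf; exists N'; apply: rep_ext (rep_sub (block_sub f l) hC) => M E.
  rewrite /ucontf /usub eval_block_sub.
  case: (hX M (edrop l E)) => e /(_ (map (eval E) f)).
  by rewrite e /= !size_map => /(_ hf); exact: geqv_sym.
Qed.

(** * Reductions *)

Lemma red_ext k (G G' : pred n) (X X' Y Y' : ugame k) :
  (forall M e, G' M e -> [/\ G M e, geqv (X M e) (X' M e) & geqv (Y M e) (Y' M e)]) ->
  red G X Y -> red G' X' Y'.
Proof.
elim: k G G' X X' Y Y' => [|k IH] G G' X X' Y Y' h /=.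
  by move=> r M e hG; have [g hX hY] := h M e hG => /hX /(r _ _ g) /hY.
move=> [l [f [hl hf r]]]; exists l, f.
have hw (M : pvmodel n) (E : nat -> M) : within l G' Y' E -> within l G Y E.
  by move=> [g hE]; have [g' _ [e _]] := h _ _ g; rewrite /within e.
split.
- by move=> M e g; have [g' _ [e' _]] := h _ _ g; rewrite -e' hl.
- move=> M E w; have [g _] := w; have [_ [e' _] _] := h _ _ g.
  by rewrite -e'; exact: hf _ _ (hw _ _ w).
- apply: IH r => M E w; have w' := hw _ _ w; split=> //; have [g _] := w;
    have [_ [eX hX] [eY hY]] := h _ _ g.
  + by apply: hY; rewrite -(vles_size (proj2 w')).
  + by apply: hX; rewrite -(vles_size (hf _ _ w')).
Qed.

Lemma red_weak k (G G' : pred n) (X Y : ugame k) :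
  (forall M e, G' M e -> G M e) -> red G X Y -> red G' X Y.
Proof.
by move=> h; apply: red_ext => M e /h; split=> //; exact: geqv_refl.
Qed.

Lemma red_absurd k (G : pred n) (X Y : ugame k) :
  (forall M e, ~ G M e) -> red G X Y.
Proof.
elim: k G X Y => [|k IH] G X Y h /=; first by move=> M e /h.
exists 0, [::]; split=> [M e /h //|M E [/h]//|].
by apply: IH => M E [/h].
Qed.

Lemma red_sub k (G : pred n) (X Y : ugame k) s : red G X Y ->
  red (fun M e => G M (fun i => eval e (s i))) (usub s X) (usub s Y).
Proof.
elim: k G X Y s => [|k IH] G X Y s /=; first by move=> h M e; exact: h.
move=> [l [f [hl hf r]]]; exists l, (map (tsub (ups l s)) f).
have ev (M : pvmodel n) (E : nat -> M) : map (eval E) (map (tsub (ups l s)) f) =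
    map (eval (fun i => eval E (ups l s i))) f.
  by rewrite -map_comp; apply: eq_map => t /=; rewrite eval_tsub.
split=> [M e /hl //|M E|].
- move=> w; rewrite ev; have := hf M (fun i => eval E (ups l s i)).
  by rewrite /within edrop_ups etake_ups; apply.
- apply: red_ext (IH _ _ _ (ups l s) r) => M E w.
  rewrite /usub /within /ucont /ucontf edrop_ups etake_ups ev.
  by split=> //; exact: geqv_refl.
Qed.

Lemma red_trans k (G : pred n) (X Y Z : ugame k) :
  red G X Y -> red G Y Z -> red G X Z.
Proof.
elim: k G X Y Z => [|k IH] G X Y Z /=.
  by move=> h1 h2 M e g /(h1 _ _ g) /(h2 _ _ g).
move=> [l [f [hl hf r]]] [l' [g [hl' hg r']]].
exists l', (map (tsub (block_sub g l')) f).
have ev (M : pvmodel n) (E : nat -> M) : map (eval E) (map (tsub (block_sub g l')) f) =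
    map (eval (ecat (map (eval E) g) (edrop l' E))) f.
  by rewrite -map_comp; apply: eq_map => t /=; rewrite eval_tsub eval_block_sub.
have key (M : pvmodel n) (E : nat -> M) : within l' G Z E ->
    [/\ edrop l (ecat (map (eval E) g) (edrop l' E)) = edrop l' E,
     etake l (ecat (map (eval E) g) (edrop l' E)) = map (eval E) g &
     within l G Y (ecat (map (eval E) g) (edrop l' E))].
  move=> w; have hs : size (map (eval E) g) = l.
    by rewrite (vles_size (hg _ _ w)) hl //; case: w.
  rewrite /within -{1 2 3 4 5}hs edrop_ecat etake_ecat; split=> //; split.
    by case: w.
  exact: hg.
split=> // [M E w|].
- by rewrite ev; have [h1 h2 h3] := key _ _ w; have := hf _ _ h3; rewrite h1.
- apply: IH r' _; apply: red_ext (red_sub (block_sub g l') r) => M E w.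
  have [h1 h2 h3] := key _ _ w; rewrite eval_block_sub /usub /ucont /ucontf.
  by rewrite eval_block_sub h1 h2 ev; split=> //; exact: geqv_refl.
Qed.

Lemma map_eval_Var (M : pvmodel n) (E : nat -> M) l :
  map (eval E) (mkseq Var l) = etake l E.
Proof. by rewrite /etake /mkseq -map_comp. Qed.

Lemma red_gle k (G : pred n) (X Y : ugame k) :
  representable X -> representable Y ->
  (forall M e, G M e -> gle (X M e) (Y M e)) -> red G X Y.
Proof.
elim: k G X Y => [|k IH] G X Y; first by move=> _ _ h M e; exact: h.
move=> /representable_cont[ps [hps _ h2]] /representable_cont[qs [hqs h1 _]] h.
(* The two blocks are known to have equal length only where [G] holds; if it holds nowhere, there is
   nothing to play. *)
case: (classic (exists M e, G M e)) => [[M0 [e0 g0]]|hG]; last first.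
  by apply: red_absurd => M e g; apply: hG; exists M, e.
have hs : size ps = size qs.
  have [e _] := h _ _ g0.
  by rewrite -(size_map (eval e0) ps) -hps e hqs size_map.
have hw (M : pvmodel n) (E : nat -> M) : within (size qs) G Y E ->
    vles (etake (size qs) E) (X M (edrop (size qs) E)).1.
  by move=> [g w]; have [-> _] := h _ _ g.
exists (size qs), (mkseq Var (size qs)); split.
- by move=> M e _; rewrite hqs size_map.
- by move=> M E w; rewrite map_eval_Var; exact: hw.
- apply: IH => //; first by apply: h2; rewrite size_mkseq.
  move=> M E w; rewrite /ucont /ucontf map_eval_Var.
  have [_] := h _ _ (proj1 w); apply; exact: (vles_size (hw _ _ w)).
Qed.

Lemma red_refl k (G : pred n) (X : ugame k) : representable X -> red G X X.
Proof.
by move=> hX; apply: red_gle => // M e _; apply: geqv_gle; exact: geqv_refl.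
Qed.

Lemma red_geqv k (G : pred n) (X Y : ugame k) :
  representable X -> representable Y ->
  (forall M e, G M e -> geqv (X M e) (Y M e)) -> red G X Y.
Proof. by move=> hX hY h; apply: red_gle => // M e g; apply: geqv_gle; exact: h. Qed.

Definition ite (c a b : term n) : term n := ((1 - c) * a + (1 - (1 - c)) * b)%pv.

Lemma eval_ite (M : pvmodel n) (E : nat -> M) c a b :
  (eval E c = zero M -> eval E (ite c a b) = eval E a) /\
  (eval E c <> zero M -> eval E (ite c a b) = eval E b).
Proof.
rewrite /ite !evalE; split=> [->|/posM h].
- by rewrite subM0 subMM mul1M mul0M addM0.
- by rewrite (subM_eq0 h) mul0M add0M subM0 mul1M.
Qed.

(** Terms are closed under definition by cases, so two strategies can be glued along a decidable
    condition on the environment. *)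
Lemma red_case k (c G : pred n) (X Y : ugame k) :
  decidable c -> representable X -> representable Y ->
  red (fun M e => G M e /\ c M e) X Y -> red (fun M e => G M e /\ ~ c M e) X Y ->
  red G X Y.
Proof.
elim: k c G X Y => [|k IH] c G X Y.
  move=> _ _ _ h1 h2 M e g; case: (classic (c M e)) => hc; [exact: h1|exact: h2].
move=> hc /representable_cont[ps [hps _ hX]] /representable_cont[qs [hqs hY _]].
move=> [l [f [hl hf r]]] [l' [f' [hl' hf' r']]].
have [t ht] := hc.
(* [f] and [f'] are known to have the right length only if their guards hold somewhere, so the glued
   tuple takes its length from [ps]. *)
pose g := mkseq (fun i => ite (tshift (size qs) t) (nth (Var 0) f i)
  (nth (Var 0) f' i)) (size ps).
have hg : size g = size ps by rewrite size_mkseq.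
have ng i : i < size ps -> nth (Var 0) g i = ite (tshift (size qs) t)
    (nth (Var 0) f i) (nth (Var 0) f' i) by move=> hi; rewrite nth_mkseq.
clearbody g.
have key1 (M : pvmodel n) (E : nat -> M) : within (size qs) G Y E ->
    c M (edrop (size qs) E) ->
    [/\ l = size qs, within l (fun M e => G M e /\ c M e) Y E &
      map (eval E) g = map (eval E) f].
  move=> [w1 w2] hcE.
  have e : l = size qs by rewrite -(hl M (edrop (size qs) E)) // hqs size_map.
  have w : within l (fun M e => G M e /\ c M e) Y E by rewrite e.
  split=> //; have hs := vles_size (hf _ _ w).
  rewrite size_map hps size_map in hs.
  apply: (@eq_from_nth _ (E 0)) => [|i]; first by rewrite !size_map hg.
  rewrite size_map hg => hi; rewrite !(nth_map (Var 0)) ?hg ?hs // ng //.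
  by apply: (proj1 (eval_ite _ _ _ _)); rewrite eval_tshift -ht.
have key2 (M : pvmodel n) (E : nat -> M) : within (size qs) G Y E ->
    ~ c M (edrop (size qs) E) ->
    [/\ l' = size qs, within l' (fun M e => G M e /\ ~ c M e) Y E &
      map (eval E) g = map (eval E) f'].
  move=> [w1 w2] hcE.
  have e : l' = size qs by rewrite -(hl' M (edrop (size qs) E)) // hqs size_map.
  have w : within l' (fun M e => G M e /\ ~ c M e) Y E by rewrite e.
  split=> //; have hs := vles_size (hf' _ _ w).
  rewrite size_map hps size_map in hs.
  apply: (@eq_from_nth _ (E 0)) => [|i]; first by rewrite !size_map hg.
  rewrite size_map hg => hi; rewrite !(nth_map (Var 0)) ?hg ?hs // ng //.
  by apply: (proj2 (eval_ite _ _ _ _)); rewrite eval_tshift -ht.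
exists (size qs), g; split.
- by move=> M e _; rewrite hqs size_map.
- move=> M E w; case: (classic (c M (edrop (size qs) E))) => hcE.
  + by have [e w' ->] := key1 _ _ w hcE; rewrite -e; exact: hf.
  + by have [e w' ->] := key2 _ _ w hcE; rewrite -e; exact: hf'.
- apply: (IH (fun M E => c M (edrop (size qs) E))) => //.
  + by apply: (decidable_sub (fun i => Var (size qs + i)) hc).
  + exact: hX.
  + apply: red_ext r => M E [w hcE]; have [e w' eg] := key1 _ _ w hcE.
    by split=> //; rewrite /ucont /ucontf ?eg e; exact: geqv_refl.
  + apply: red_ext r' => M E [w hcE]; have [e w' eg] := key2 _ _ w hcE.
    by split=> //; rewrite /ucont /ucontf ?eg e; exact: geqv_refl.
Qed.

Lemma eval_zeros (M : pvmodel n) (E : nat -> M) r :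
  map (eval E) (nseq r 0%pv) = nseq r (zero M).
Proof. by rewrite map_nseq evalE. Qed.

Lemma red_pad k (G P : pred n) (X : ugame k) : representable X ->
  ((forall M e, G M e -> P M e) -> red G X (upad k P)) /\
  ((forall M e, G M e -> ~ P M e) -> red G (upad k P) X).
Proof.
elim: k G P X => [|k IH] G P X.
  by move=> _; split=> h M e g; [move=> _; exact: h|move=> /(h _ _ g)].
move=> /representable_cont[ps [hps h1 h2]]; split=> h.
- exists 0, (nseq (size ps) 0%pv); split=> // [M E [_ w]|].
    by rewrite eval_zeros; apply: vles_zeros; rewrite hps size_map.
  have /h2 hr : size (nseq (size ps) (0%pv : term n)) = size ps by rewrite size_nseq.
  have [_ r] := IH (within 0 G (upad k.+1 P)) (fun M e => ~ P M e) _ (hr 0).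
  apply: red_ext (r _) => [M E w|M E [g _] hP].
    by split=> //; exact: geqv_refl.
  by apply: hP; exact: h.
- exists (size ps), [::]; split=> [M e _|M E _|]; first by rewrite hps size_map.
    by constructor.
  have [r _] := IH (within (size ps) G X)
    (fun M e => ~ P M (edrop (size ps) e)) _ h1.
  apply: red_ext (r _) => [M E w|M E [g _]]; last exact: h.
  by split=> //; exact: geqv_refl.
Qed.

Lemma eval_vars (M : pvmodel n) (E : nat -> M) j l :
  map (eval E) (mkseq (fun i => Var (j + i)) l) = etake l (edrop j E).
Proof. by rewrite /etake /mkseq -map_comp. Qed.

Lemma take_etake D l r (E : nat -> D) : take l (etake (l + r) E) = etake l E.
Proof.
rewrite /etake /mkseq -map_take take_iota; congr map; congr iota.
by apply/minn_idPl; exact: leq_addr.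
Qed.

Lemma drop_etake D l r (E : nat -> D) :
  drop l (etake (l + r) E) = etake r (edrop l E).
Proof.
by rewrite /etake /mkseq -map_drop drop_iota addKn add0n -{1}[l]addn0 iotaDl -map_comp.
Qed.

Lemma etake_cat D l r (E : nat -> D) :
  etake (l + r) E = etake l E ++ etake r (edrop l E).
Proof. by rewrite -{1}(cat_take_drop l (etake _ E)) take_etake drop_etake. Qed.

(** Weakening: zeros satisfy every bound, so the additional game can always be played with zeros. *)
Lemma red_proj k (G : pred n) (X Y : ugame k) :
  representable X -> representable Y ->
  red G (uop true X Y) X /\ red G X (uop false X Y).
Proof.
elim: k G X Y => [|k IH] G X Y.
  by move=> _ _; split=> M e _; [case|left].
move=> /representable_cont[ps [hps hX1 hX2]] /representable_cont[qs [hqs hY1 hY2]].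
split.
- exists (size ps), (mkseq Var (size ps) ++ nseq (size qs) 0%pv); split.
  + by move=> M e _; rewrite hps size_map.
  + move=> M E [_ w]; rewrite map_cat eval_zeros map_eval_Var.
    apply/vles_cat; first by rewrite etake_size hps size_map.
    by split=> //; apply: vles_zeros; rewrite hqs size_map.
  + have hz := hY2 (size ps) (nseq (size qs) 0%pv) (size_nseq _ _).
    have [_ r] := IH (within (size ps) G X) _ _ hX1 hz.
    apply: red_ext r => M E w; split=> //; first exact: geqv_refl.
    rewrite /uop /ucontf map_cat map_eval_Var /=.
    by rewrite take_size_cat ?drop_size_cat ?etake_size ?hps ?size_map //;
      exact: geqv_refl.
- exists (size ps + size qs), (mkseq Var (size ps)); split.
  + by move=> M e _; rewrite /= size_cat hps hqs !size_map.
  + move=> M E [_ w]; rewrite map_eval_Var; move: w; rewrite etake_cat.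
    by move=> /vles_cat[]; rewrite ?etake_size ?hps ?size_map.
  + have h1 := hX2 (size ps + size qs) (mkseq Var (size ps)) (size_mkseq _ _).
    have h2 := hY2 (size ps + size qs) (mkseq (fun i => Var (size ps + i)) (size qs))
      (size_mkseq _ _).
    have [r _] := IH (within (size ps + size qs) G (uop false X Y)) _ _ h1 h2.
    apply: red_ext r => M E w; split=> //; last exact: geqv_refl.
    rewrite /uop /ucontf /ucont map_eval_Var eval_vars /= etake_cat.
    by rewrite take_size_cat ?drop_size_cat ?etake_size ?hps ?size_map //;
      exact: geqv_refl.
Qed.

Lemma red_comm b k (G : pred n) (X Y : ugame k) :
  representable X -> representable Y -> red G (uop b X Y) (uop b Y X).
Proof.
elim: k b G X Y => [|k IH] b G X Y.
  by move=> _ _ M e _; rewrite /uop /=; case: b; tauto.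
move=> /representable_cont[ps [hps hX1 hX2]] /representable_cont[qs [hqs hY1 hY2]].
exists (size qs + size ps),
  (mkseq (fun i => Var (size qs + i)) (size ps) ++ mkseq Var (size qs)); split.
- by move=> M e _; rewrite /= size_cat hps hqs !size_map.
- move=> M E [_]; rewrite /= etake_cat map_cat map_eval_Var eval_vars.
  move=> /vles_cat[]; first by rewrite etake_size hqs size_map.
  by move=> w1 w2; apply/vles_cat; [rewrite etake_size hps size_map|split].
- have h1 := hX2 (size qs + size ps) (mkseq (fun i => Var (size qs + i)) (size ps))
    (size_mkseq _ _).
  have h2 := hY2 (size qs + size ps) (mkseq Var (size qs)) (size_mkseq _ _).
  have r := IH (~~ b) (within (size qs + size ps) G (uop b Y X)) _ _ h2 h1.
  apply: red_ext r => M E w; split=> //;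
  rewrite /uop /ucontf /ucont ?map_cat map_eval_Var eval_vars /= ?etake_cat;
  rewrite take_size_cat ?drop_size_cat ?etake_size ?hps ?hqs ?size_map //;
  exact: geqv_refl.
Qed.

Lemma red_mono b k (G : pred n) (X X' Y Y' : ugame k) :
  red G X X' -> red G Y Y' -> red G (uop b X Y) (uop b X' Y').
Proof.
elim: k b G X X' Y Y' => [|k IH] b G X X' Y Y'.
  move=> h1 h2 M e g; move: (h1 _ _ g) (h2 _ _ g); rewrite /uop /=.
  by case: b; tauto.
move=> [l [f [hl hf r]]] [l' [f' [hl' hf' r']]].
pose s i : term n := Var (if i < l then i else l' + i).
pose s' i : term n := Var (l + i).
exists (l + l'), (map (tsub s) f ++ map (tsub s') f').
have ev (M : pvmodel n) (E : nat -> M) : map (eval E) (map (tsub s) f ++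
    map (tsub s') f') = map (eval (ecat (etake l E) (edrop (l + l') E))) f ++
    map (eval (edrop l E)) f'.
  rewrite map_cat -!map_comp; congr cat; apply: eq_map => t /=; rewrite eval_tsub.
    congr eval; apply: functional_extensionality => i.
    rewrite eval_Var (ecat_nth (E 0)) etake_size; case: ltnP => hi.
      by rewrite nth_mkseq.
    by rewrite /edrop (addnC l) -addnA subnKC.
  by congr eval.
have dd (M : pvmodel n) (E : nat -> M) : edrop l' (edrop l E) = edrop (l + l') E.
  by apply: functional_extensionality => i; rewrite /edrop addnA.
have e1 (M : pvmodel n) (E : nat -> M) :
    edrop l (ecat (etake l E) (edrop (l + l') E)) = edrop (l + l') E.
  by rewrite -{1}(etake_size l E) edrop_ecat.
have e2 (M : pvmodel n) (E : nat -> M) :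
    etake l (ecat (etake l E) (edrop (l + l') E)) = etake l E.
  by rewrite -{1}(etake_size l E) etake_ecat.
have key (M : pvmodel n) (E : nat -> M) : within (l + l') G (uop b X' Y') E ->
    within l G X' (ecat (etake l E) (edrop (l + l') E)) /\
    within l' G Y' (edrop l E).
  move=> [g]; rewrite /= etake_cat => /vles_cat[]; first by rewrite etake_size hl.
  move=> w1 w2; rewrite /within dd e1 e2.
  by split; split.
split.
- by move=> M e g; rewrite /= size_cat hl // hl'.
- move=> M E w; have [w1 w2] := key _ _ w; rewrite ev /=.
  have h1 := hf _ _ w1; have h2 := hf' _ _ w2.
  rewrite e1 in h1; rewrite dd in h2; apply/vles_cat => //.
  by rewrite (vles_size h1).
- apply: (@red_ext _ _ _ _ _ _ _ _ (IH (~~ b) (within (l + l') G (uop b X' Y'))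
    (usub s (ucont l X')) (usub s (ucontf l f X))
    (usub s' (ucont l' Y')) (usub s' (ucontf l' f' Y)) _ _)).
  + have es (M : pvmodel n) (E : nat -> M) : (fun i => eval E (s i)) =
        ecat (etake l E) (edrop (l + l') E).
      apply: functional_extensionality => i.
      rewrite eval_Var (ecat_nth (E 0)) etake_size; case: ltnP => hi.
        by rewrite nth_mkseq.
      by rewrite /edrop (addnC l) -addnA subnKC.
    move=> M E w; have [w1 w2] := key _ _ w; split=> //.
    * rewrite /uop /usub /ucont es e1 e2 /= etake_cat -dd.
      have g : G M (edrop l' (edrop l E)) by rewrite dd; case: w.
      rewrite take_size_cat ?drop_size_cat ?etake_size ?hl //.
      exact: geqv_refl.
    * rewrite /uop /usub /ucontf es e1 ev /=.
      have hs := vles_size (hf _ _ w1); rewrite e1 in hs.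
      rewrite take_size_cat ?drop_size_cat // -dd.
      exact: geqv_refl.
  + apply: (red_weak _ (red_sub s r)) => M E w; have [w1 _] := key _ _ w.
    have -> // : (fun i => eval E (s i)) = ecat (etake l E) (edrop (l + l') E).
    apply: functional_extensionality => i.
    rewrite eval_Var (ecat_nth (E 0)) etake_size; case: ltnP => hi.
      by rewrite nth_mkseq.
    by rewrite /edrop (addnC l) -addnA subnKC.
  + by apply: (red_weak _ (red_sub s' r')) => M E w; have [_ w2] := key _ _ w.
Qed.

End Games.

Local Open Scope pvm_scope.

(** * Flows *)

Section Definable.
Variable n : nat.

Definition value := forall M : pvmodel n, (nat -> M) -> M.
Definition transformer := forall M : pvmodel n, (nat -> M) -> (nat -> M).

Definition defv (f : value) : Prop :=
  exists t, forall (M : pvmodel n) (e : nat -> M), f M e = eval e t.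

Definition defe (s : transformer) : Prop :=
  exists r, forall (M : pvmodel n) (e : nat -> M), s M e = fun i => eval e (r i).

Lemma defe_id : defe (fun M e => e).
Proof. by exists (@Var n). Qed.

Lemma defe_drop l : defe (fun M e => edrop l e).
Proof. by exists (fun i => Var (l + i)%N). Qed.

Lemma defe_cons f s : defv f -> defe s -> defe (fun M e => econs (f M e) (s M e)).
Proof.
move=> [t ht] [r hr]; exists (scons t r) => M e; rewrite ht hr.
by apply: functional_extensionality => -[].
Qed.

Lemma defe_comp s s' : defe s -> defe s' -> defe (fun M e => s M (s' M e)).
Proof.
move=> [r hr] [r' hr']; exists (fun i => tsub r' (r i)) => M e; rewrite hr hr'.
by apply: functional_extensionality => i; rewrite eval_tsub.
Qed.

Lemma defv_comp f s : defv f -> defe s -> defv (fun M e => f M (s M e)).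
Proof.
by move=> [t ht] [r hr]; exists (tsub r t) => M e; rewrite ht hr eval_tsub.
Qed.

Lemma defv_nth s i : defe s -> defv (fun M e => s M e i).
Proof. by move=> [r hr]; exists (r i) => M e; rewrite hr. Qed.

Lemma defv_eval t s : defe s -> defv (fun M e => eval (s M e) t).
Proof. by move=> [r hr]; exists (tsub r t) => M e; rewrite hr eval_tsub. Qed.

Lemma defv_zero : defv (fun M e => 0).
Proof. by exists 0%pv => M e; rewrite evalE. Qed.

Lemma defv_one : defv (fun M e => 1).
Proof. by exists 1%pv => M e; rewrite evalE. Qed.

Lemma defv_add f g : defv f -> defv g -> defv (fun M e => f M e + g M e).
Proof. by move=> [t ht] [u hu]; exists (t + u)%pv => M e; rewrite evalE ht hu. Qed.

Lemma defv_sub f g : defv f -> defv g -> defv (fun M e => f M e - g M e).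
Proof. by move=> [t ht] [u hu]; exists (t - u)%pv => M e; rewrite evalE ht hu. Qed.

Lemma defv_mul f g : defv f -> defv g -> defv (fun M e => f M e * g M e).
Proof. by move=> [t ht] [u hu]; exists (t * u)%pv => M e; rewrite evalE ht hu. Qed.

Lemma defv_quo f g : defv f -> defv g -> defv (fun M e => quo (f M e) (g M e)).
Proof. by move=> [t ht] [u hu]; exists (div1 t u) => M e; rewrite evalE ht hu. Qed.

Lemma defv_min f g : defv f -> defv g -> defv (fun M e => minimum (f M e) (g M e)).
Proof. by move=> [t ht] [u hu]; exists (tmin t u) => M e; rewrite evalE ht hu. Qed.

Lemma dec_le f g : defv f -> defv g -> decidable (fun M e => f M e <= g M e).
Proof.
move=> [t ht] [u hu]; apply: decidable_ext (decidable_le t u) => M e.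
by rewrite ht hu.
Qed.

Lemma dec_eq f g : defv f -> defv g -> decidable (fun M e => f M e = g M e).
Proof.
move=> [t ht] [u hu]; apply: decidable_ext (decidable_eq t u) => M e.
by rewrite ht hu.
Qed.

Lemma dec_env (c : pred n) s : defe s -> decidable c ->
  decidable (fun M e => c M (s M e)).
Proof.
move=> [r hr] hc; apply: decidable_ext (decidable_sub r hc) => M e.
by rewrite hr.
Qed.

Lemma rep_env k (X : ugame n k) s : defe s -> representable X ->
  representable (fun M e => X M (s M e)).
Proof.
move=> [r hr] hX; apply: representable_ext (representable_sub r hX) => M e.
by rewrite /usub hr; exact: geqv_refl.
Qed.

Lemma red_env s k (G G' : pred n) (X X' Y Y' : ugame n k) : defe s -> red G X Y ->
  (forall M e, G' M e -> [/\ G M (s M e), X' M e = X M (s M e) &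
     Y' M e = Y M (s M e)]) ->
  red G' X' Y'.
Proof.
move=> [r hr] h h'; apply: red_ext (red_sub r h) => M e /h'[].
by rewrite hr => g -> ->; split=> //; exact: geqv_refl.
Qed.

Lemma red_eq k (G G' : pred n) (X X' Y Y' : ugame n k) : red G X Y ->
  (forall M e, G' M e -> [/\ G M e, X' M e = X M e & Y' M e = Y M e]) ->
  red G' X' Y'.
Proof. exact: red_env defe_id. Qed.

Lemma red_reflE k (G : pred n) (X Y : ugame n k) : representable X ->
  (forall M e, G M e -> Y M e = X M e) -> red G X Y.
Proof. by move=> hX h; apply: red_eq (red_refl G hX) _ => M e g; rewrite h. Qed.

Lemma defv_bound f : defv f -> exists g : value, [/\ defv g,
  forall M e, f M e <= g M e &
  forall M e e', (forall i, e i <= e' i) -> g M e <= g M e'].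
Proof.
move=> [t ht]; have [T mT hT] := term_bound t.
exists (fun M e => eval e T); split=> [|M e|M e e']; first by exists T.
- by rewrite ht.
- exact: mT.
Qed.

End Definable.

Ltac defs := repeat first
  [ exact: defe_id | exact: defe_drop | exact: (defv_nth _ (@defe_id _)) | apply: defe_cons | exact: defv_zero
  | exact: defv_one | apply: defv_add | apply: defv_sub | apply: defv_mul
  | apply: defv_quo | apply: defv_min | assumption
  | (apply: defv_nth; solve [defs]) | (apply: defv_eval; solve [defs])
  | (apply: defv_comp; [assumption|]) ].

Lemma defe_next n : @defe n (fun M e => econs (e 0%N + 1) (edrop 1 e)).
Proof. by defs. Qed.

Lemma defe_at n (f : value n) : defv f -> defe (fun M e => econs (f M e) e).
Proof. by move=> hf; defs. Qed.

Section Flows.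
Variable n : nat.
Notation pred := (pred n).
Notation ugame := (ugame n).
Notation value := (value n).

Definition lift k l (X : ugame k) : ugame k := fun M e => X M (edrop l e).

Definition at0 k (f : value) (H : ugame k) : ugame k :=
  fun M e => H M (econs (f M e) e).

Definition below (G : pred) (t : value) : pred :=
  fun M e => G M (edrop 1 e) /\ e 0%N < t M (edrop 1 e).

Definition next k (H : ugame k) : ugame k :=
  fun M e => H M (econs (e 0%N + 1) (edrop 1 e)).

(** The ends are attached by reductions in one direction only, which is easier to maintain under the
    closure operations; [flow_ends] recovers equivalences. The guard [G] is there because induction
    steps are flows valid only below a bound. *)
Definition flow k (G : pred) (X Y : ugame k) : Prop :=
  exists t H, [/\ defv t, representable H, red G X (at0 (fun _ _ => 0) H),
    red G (at0 t H) Y & red (below G t) H (next H)].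

Definition unot k (X : ugame k) : ugame k.+1 := fun M e => ([::], fun _ => X M e).

(** The games [X] and [Y] selected by [c], written as a disjunction of conjunctions so that it stays
    on level [k]. *)
Definition ucase k (c : pred) (X Y : ugame k) : ugame k :=
  uop false (uop true (upad k c) X) (uop true (upad k (fun (M : pvmodel n) e => ~ c M e)) Y).

Lemma rep_case k (c : pred) (X Y : ugame k) : decidable c -> representable X ->
  representable Y -> representable (ucase c X Y).
Proof.
move=> hc hX hY; apply: representable_op; apply: representable_op => //;
  apply: representable_pad => //; exact: decidable_not.
Qed.

Lemma rep_not k (X : ugame k) : representable X -> representable (unot X).
Proof.
move=> /(representable_block [::]); apply: representable_ext => M e.
by split=> // -[] // _; exact: geqv_refl.
Qed.

Lemma rep_lift k l (X : ugame k) : representable X -> representable (lift l X).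
Proof. by apply: rep_env; defs. Qed.

Section Case.
Variables (k : nat) (G c : pred) (X Y : ugame k).
Arguments G : clear implicits.
Arguments c : clear implicits.
Arguments X : clear implicits.
Arguments Y : clear implicits.
Hypotheses (hc : decidable c) (hX : representable X) (hY : representable Y).

Let hp : representable (upad k c). Proof. exact: representable_pad. Qed.
Let hn : representable (upad k (fun (M : pvmodel n) e => ~ c M e)).
Proof. by apply: representable_pad; exact: decidable_not. Qed.
Let hpX : representable (uop true (upad k c) X).
Proof. exact: representable_op. Qed.
Let hnY : representable (uop true (upad k (fun (M : pvmodel n) e => ~ c M e)) Y).
Proof. exact: representable_op. Qed.

Lemma red_case_intro1 : (forall M e, G M e -> c M e) -> red G X (ucase c X Y).
Proof.
move=> h; apply: red_trans (proj2 (red_proj G hpX hnY)).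
apply: red_trans (red_comm true G hX hp); apply: red_gle => //.
  exact: representable_op.
by move=> M e g; apply: (proj1 (gle_pad (X M e) (c M e))); exact: h.
Qed.

Lemma red_case_elim1 : (forall M e, G M e -> c M e) -> red G (ucase c X Y) X.
Proof.
move=> h; apply: red_trans (proj1 (red_proj G hX hp)).
apply: red_trans (red_comm true G hp hX).
apply: red_trans (red_mono false (red_refl G hpX) (proj1 (red_proj G hn hY))) _.
apply: red_gle => //; first exact: representable_op.
move=> M e g; apply: (proj2 (gle_pad _ (~ c M e))) => hn'.
by apply: hn'; exact: h.
Qed.

Lemma red_case_intro2 : (forall M e, G M e -> ~ c M e) -> red G Y (ucase c X Y).
Proof.
move=> h; apply: red_trans (red_comm false G hnY hpX).
apply: red_trans (proj2 (red_proj G hnY hpX)).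
apply: red_trans (red_comm true G hY hn); apply: red_gle => //.
  exact: representable_op.
by move=> M e g; apply: (proj1 (gle_pad (Y M e) (~ c M e))); exact: h.
Qed.

Lemma red_case_elim2 : (forall M e, G M e -> ~ c M e) -> red G (ucase c X Y) Y.
Proof.
move=> h; apply: red_trans (proj1 (red_proj G hY hn)).
apply: red_trans (red_comm true G hn hY).
apply: red_trans (red_comm false G hpX hnY) _.
apply: red_trans (red_mono false (red_refl G hnY) (proj1 (red_proj G hp hX))) _.
apply: red_gle => //; first exact: representable_op.
by move=> M e g; apply: (proj2 (gle_pad _ (c M e))); exact: h.
Qed.

End Case.

Lemma flow_red k (G : pred) (X Y : ugame k) : representable X -> red G X Y ->
  flow G X Y.
Proof.
move=> hX h; exists (fun M e => 0), (lift 1 X); split.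
- by defs.
- exact: rep_lift.
- by apply: red_eq (red_refl G hX) _ => M e g.
- by apply: red_eq h _ => M e g.
- by apply: red_eq (red_refl (below G (fun M e => 0)) (rep_lift 1 hX)) _.
Qed.

Lemma flow_redl k (G : pred) (X X' Y : ugame k) : red G X X' -> flow G X' Y ->
  flow G X Y.
Proof.
move=> h [t [H [h1 h2 h3 h4 h5]]]; exists t, H; split=> //.
exact: red_trans h h3.
Qed.

Lemma flow_redr k (G : pred) (X Y Y' : ugame k) : flow G X Y -> red G Y Y' ->
  flow G X Y'.
Proof.
move=> [t [H [h1 h2 h3 h4 h5]]] h; exists t, H; split=> //.
exact: red_trans h4 h.
Qed.

Lemma flow_env s k (G G' : pred) (X X' Y Y' : ugame k) : defe s -> flow G X Y ->
  (forall M e, G' M e -> [/\ G M (s M e), X' M e = X M (s M e) &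
     Y' M e = Y M (s M e)]) ->
  flow G' X' Y'.
Proof.
move=> hs [t [H [h1 h2 h3 h4 h5]]] h.
have ds : defe (fun M e => econs (e 0%N) (s M (edrop 1 e)) : nat -> M).
  by apply: defe_cons; [defs|exact: defe_comp hs (defe_drop n 1)].
exists (fun M e => t M (s M e)), (fun M e => H M (econs (e 0%N) (s M (edrop 1 e)))).
split.
- exact: defv_comp.
- exact: rep_env.
- by apply: (red_env hs h3) => M e /h[].
- by apply: (red_env hs h4) => M e /h[].
- by apply: (red_env ds h5) => M e [/h[g _ _] h6].
Qed.

Lemma flow_weak k (G G' : pred) (X Y : ugame k) :
  (forall M e, G' M e -> G M e) -> flow G X Y -> flow G' X Y.
Proof. by move=> h /(flow_env (@defe_id n)); apply=> M e /h. Qed.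

Lemma flow_trans k (G : pred) (X Y Z : ugame k) :
  flow G X Y -> flow G Y Z -> flow G X Z.
Proof.
move=> [t1 [H1 [d1 r1 s1 e1 n1]]] [t2 [H2 [d2 r2 s2 e2 n2]]].
pose c : pred := fun M e => e 0%N <= t1 M (edrop 1 e).
have hc : decidable c by apply: dec_le; defs.
pose s : transformer n := fun M e =>
  econs (e 0%N - (t1 M (edrop 1 e) + 1)) (edrop 1 e).
have hs : defe s by apply: defe_cons; defs.
pose K2 : ugame k := fun M e => H2 M (s M e).
have hK2 : representable K2 by exact: rep_env.
have d0 := @defe_at n.
have dn := defe_next n.
(* The two sequences are placed one after the other. The extra step, from time [t1] to [t1 + 1],
   passes from the end of [H1] through [Y] to the start of [H2]. *)
pose t M e := t1 M e + 1 + t2 M e.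
exists t, (ucase c H1 K2); split.
- by rewrite /t; defs.
- exact: rep_case.
- apply: red_trans s1 _.
  apply: (red_case_intro1 (c := fun M e => c M (econs 0 e)) _
    (rep_env (d0 _ (@defv_zero n)) r1) (rep_env (d0 _ (@defv_zero n)) hK2)).
    exact: (dec_env (d0 _ (@defv_zero n)) hc).
  by move=> M e _; exact: le0M.
- have dt : defv t by rewrite /t; defs.
  apply: red_trans (red_case_elim2 (c := fun M e => c M (econs (t M e) e)) _
    (rep_env (d0 _ dt) r1) (rep_env (d0 _ dt) hK2) _) _.
  + exact: dec_env (d0 _ dt) hc.
  + move=> M e _; rewrite /c /t edrop_econs /= => /leMNgt; apply.
    exact: leM_addr.
  + apply: red_eq e2 _ => M e g; split=> //.
    by rewrite /K2 /s /at0 /t edrop_econs /= addMC addMK.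
- have rc : representable (ucase c H1 K2) by exact: rep_case.
  apply: (red_case (c := fun M e => e 0%N < t1 M (edrop 1 e))) => //.
  + by apply: dec_le; defs.
  + exact: rep_env.
  + apply: red_trans (red_case_elim1 hc r1 hK2 _) _.
      by move=> M e [_ /ltMW].
    apply: red_trans (red_case_intro1 (c := fun M e => c M (econs (e 0%N + 1) (edrop 1 e)))
      _ (rep_env dn r1) (rep_env dn hK2) _).
    * by apply: red_weak n1 => M e [[g _] h].
    * exact: (dec_env dn hc).
    * by move=> M e [_].
  + apply: (red_case (c := c)) => //; first exact: rep_env.
    * apply: red_trans (red_case_elim1 hc r1 hK2 _) _; first by move=> M e [].
      apply: red_trans (red_case_intro2 (c := fun M e => c M (econs (e 0%N + 1) (edrop 1 e)))
        _ (rep_env dn r1) (rep_env dn hK2) _).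
      - apply: (@red_trans _ _ _ _ (lift 1 Y)).
          apply: (red_env (defe_drop n 1) e1) => M e [[[g _] h1] h2]; split=> //.
          rewrite /at0 -(leM_anti h2 (proj2 (leMNgt _ _) h1)).
          by congr H1; apply: functional_extensionality => -[].
        apply: (red_env (defe_drop n 1) s2) => M e [[[g _] h1] h2]; split=> //.
        rewrite /K2 /s /at0 edrop_econs /=.
        by rewrite (leM_anti h2 (proj2 (leMNgt _ _) h1)) subMM.
      - exact: (dec_env dn hc).
      - by move=> M e [[_ h1] _].
    * apply: red_trans (red_case_elim2 hc r1 hK2 _) _; first by move=> M e [].
      apply: red_trans (red_case_intro2 (c := fun M e => c M (econs (e 0%N + 1) (edrop 1 e)))
        _ (rep_env dn r1) (rep_env dn hK2) _).
      - apply: (red_env hs n2) => M e [[[g h0] _] /ltMNge h2].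
        rewrite /s /below /K2 /next edrop_econs /=; split=> //.
          split=> //; apply/(leM_add2r (t1 M (edrop 1 e) + 1)).
          rewrite -addMA (addMC 1) addMA subMK //.
          by rewrite (addMC (t2 _ _)).
        by rewrite /s edrop_econs subM_succ.
      - exact: (dec_env dn hc).
      - by move=> M e [[_ h1] _].
Qed.

End Flows.

Lemma divmod n (M : pvmodel n) (w L : M) :
  let q := quo w L in let j := w - q * (L + 1) in
  [/\ q * (L + 1) + j = w, j <= L,
    j < L -> quo (w + 1) L = q /\ w + 1 - q * (L + 1) = j + 1 &
    ~ j < L -> w + 1 = (q + 1) * (L + 1) /\ j = L].
Proof.
move=> q j; have e : q * (L + 1) + j = w by rewrite addMC subMK //; exact: quo_le.
have hj : j <= L.
  apply/ltMS; apply/(leM_add2l (q * (L + 1))); rewrite addMA e.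
  by apply: leM_trans (lt_quo w L) _; rewrite mulMDl mul1M; exact: leMM.
split=> // h.
- split; last by rewrite subM_succ //; exact: quo_le.
  apply: quo_uniq; first exact: leM_trans (quo_le w L) (ltMW (ltMSn w)).
  rewrite -{1}e mulMDl mul1M -!addMA; apply/leM_add2l.
  by rewrite addMA; apply/leM_add2r.
- have ej : j = L by apply: leM_anti => //; apply/leMNgt.
  by split=> //; rewrite -{1}e ej mulMDl mul1M addMA.
Qed.

(** * Iteration, negation and case distinction for flows *)

Section FlowRules.
Variable n : nat.
Notation pred := (pred n).
Notation ugame := (ugame n).
Notation value := (value n).
Implicit Type k : nat.

(* The flow from [H u] to [H (u + 1)] has a length depending on [u]; all of them are
   stretched to a common length [L], and the position within the concatenation is
   found by division by [L + 1]. *)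
Lemma flow_ind k (G : pred) (H : ugame k) (T : value) : defv T -> representable H ->
  flow (below G T) H (next H) -> flow G (at0 (fun _ _ => 0) H) (at0 T H).
Proof.
move=> dT rH [s [K [ds rK s1 e1 n1]]].
have [g [dg hg mg]] := defv_bound ds.
(* The bound [g] of [s] is monotone, so its value at [u = T] bounds the lengths [s u] for all [u] up
   to [T]. *)
pose L : value := fun M e => g M (econs (T M e) e).
have dL : defv L by apply: defv_comp dg (defe_at dT).
have sL (M : pvmodel n) (u : M) e : u <= T M e -> s M (econs u e) <= L M e.
  move=> hu; apply: leM_trans (hg _ _) _; apply: mg => -[//|i]; exact: leMM.
pose q : value := fun M e => quo (e 0%N) (L M (edrop 1 e)).
pose j : value := fun M e => e 0%N - q M e * (L M (edrop 1 e) + 1).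
have dj : defv j by rewrite /j; defs.
pose r : transformer n := fun M e => econs (q M e) (edrop 1 e).
have dr : defe r by rewrite /r; defs.
(* Within a stretch the inner flow runs for [s u] steps and then rests until position [L]. *)
pose p : transformer n := fun M e => econs (minimum (j M e) (s M (r M e))) (r M e).
have dp : defe p by rewrite /p; apply: defe_cons => //; apply: defv_min => //;
  exact: defv_comp.
pose A : ugame k := fun M e => K M (p M e).
have rA : representable A by exact: rep_env.
pose t : value := fun M e => T M e * (L M e + 1).
have dt : defv t by rewrite /t; defs.
(* At time [t] the quotient is [T], where nothing is known about [K]; the final game is therefore
   supplied separately. *)
pose B : ugame k := fun M e => at0 T H (edrop 1 e).
have rB : representable B.
  by apply: (rep_env (s := fun M e => econs (T M (edrop 1 e)) (edrop 1 e))) => //; defs.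
pose c : pred := fun M e => e 0%N < t M (edrop 1 e).
have hc : decidable c by apply: dec_le; defs.
have d0 := defe_at (@defv_zero n).
have dn := defe_next n.
have dat := defe_at dt.
have qT (M : pvmodel n) (e : nat -> M) : c M e -> q M e < T M (edrop 1 e).
  move=> h; apply/ltMNge => h'; apply: (@ltM_irr _ M (e 0%N)).
  apply: leM_trans h _; apply: leM_trans _ (quo_le (e 0%N) (L M (edrop 1 e))).
  by apply: leM_mul => //; exact: leMM.
exists t, (ucase c A B); split=> //.
- exact: rep_case.
- apply: (red_case (c := fun M e => c M (econs 0 e))).
  + exact: dec_env d0 hc.
  + exact: rep_env d0 rH.
  + exact: rep_env d0 (rep_case hc rA rB).
  + apply: red_trans (red_case_intro1 (c := fun M e => c M (econs 0 e))
      (dec_env d0 hc) (rep_env d0 rA) (rep_env d0 rB) _); last by move=> M e [].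
    apply: (red_env d0 s1) => M e [g0 h0].
    have e0 : r M (econs 0 e) = econs 0 e by rewrite /r /q edrop_econs quoM0.
    split=> //.
      split; first by rewrite edrop_econs.
      by have := qT _ _ h0; rewrite /q /= quoM0.
    rewrite /A /p e0 /at0 /j /q /= quoM0 mul0M subM0 minM_l //; exact: le0M.
  + apply: red_trans (red_case_intro2 (c := fun M e => c M (econs 0 e))
      (dec_env d0 hc) (rep_env d0 rA) (rep_env d0 rB) _); last by move=> M e [].
    apply: (red_reflE (rep_env d0 rH)) => M e [g0 h0].
    have hT : T M e = 0.
      apply: NNPP => /posM h; apply: h0; rewrite /c /t edrop_econs /= add0M.
      by rewrite -{1}(mulM1 1); apply: leM_mul => //; exact: leM_addl.
    by rewrite /B edrop_econs /at0 hT.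
- apply: red_trans (red_case_elim2 (c := fun M e => c M (econs (t M e) e))
    (dec_env dat hc) (rep_env dat rA) (rep_env dat rB) _) _.
    by move=> M e _; rewrite /c edrop_econs; exact: ltM_irr.
  by apply: (red_reflE (rep_env (defe_at dT) rH)).
- have rAn := rep_env dn rA; have rBn := rep_env dn rB; have hcn := dec_env dn hc.
  have rn := rep_case hcn rAn rBn.
  apply: red_trans (red_case_elim1 hc rA rB _) _; first by move=> M e [].
  have djL : decidable (fun M e => j M e < L M (edrop 1 e)) by apply: dec_le; defs.
  apply: (red_case (c := fun M e => j M e < L M (edrop 1 e))) => //.
  + apply: red_trans (red_case_intro1 hcn rAn rBn _); last first.
      move=> M e [[g0 h0] h1]; have [_ _ /(_ h1)[h2 h3] _] := divmod (e 0%N) (L M (edrop 1 e)).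
      rewrite /c edrop_econs /t /=; apply: leM_trans (lt_quo _ (L M (edrop 1 e))) _.
      rewrite h2; apply: leM_mul; last exact: leMM.
      exact: (qT _ _ h0).
    have next_r (M : pvmodel n) (e : nat -> M) : j M e < L M (edrop 1 e) ->
        r M (econs (e 0%N + 1) (edrop 1 e)) = r M e /\
        j M (econs (e 0%N + 1) (edrop 1 e)) = j M e + 1.
      move=> h1; have [_ _ /(_ h1)[h2 h3] _] := divmod (e 0%N) (L M (edrop 1 e)).
      by rewrite /r /j /q !edrop_econs /= h2 h3.
    apply: (red_case (c := fun M e => j M e < s M (r M e))) => //.
    * by apply: dec_le; defs.
    * apply: (red_env (s := fun M e => econs (j M e) (r M e)) _ n1).
        by apply: defe_cons.
      move=> M e [[[g0 h0] h1] h2]; have [er ej] := next_r _ _ h1.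
      split.
      - split; last exact: h2.
        by split; [exact: g0|exact: (qT _ _ h0)].
      - by rewrite /A /p (minM_l (ltMW h2)).
      - by rewrite /A /p /next er ej (minM_l h2).
    * apply: (red_reflE rA) => M e [[[g0 h0] h1] /notltM h2].
      have [er ej] := next_r _ _ h1.
      by rewrite /next /A /p er ej !minM_r //; exact: leM_trans h2 (ltMW (ltMSn _)).
  + have next_q (M : pvmodel n) (e : nat -> M) : ~ j M e < L M (edrop 1 e) ->
        [/\ e 0%N + 1 = (q M e + 1) * (L M (edrop 1 e) + 1),
          j M e = L M (edrop 1 e), r M (econs (e 0%N + 1) (edrop 1 e)) =
            econs (q M e + 1) (edrop 1 e) &
          j M (econs (e 0%N + 1) (edrop 1 e)) = 0].
      move=> h1; have [_ _ _ /(_ h1)[h2 h3]] := divmod (e 0%N) (L M (edrop 1 e)).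
      have hq : quo (e 0%N + 1) (L M (edrop 1 e)) = q M e + 1.
        rewrite h2; apply: quo_uniq; first exact: leMM.
        rewrite [X in _ <= X]mulMDl; apply/leM_add2l.
        by rewrite mul1M; exact: leM_addl.
      by rewrite /r /j /q !edrop_econs /= hq h2 subMM.
    (* At the end of a stretch the inner flow has arrived at [H (q + 1)]. This is the start of the
       next stretch or, if [q + 1 = T], the final game. *)
    apply: (@red_trans _ _ _ _ (fun M e => H M (econs (q M e + 1) (edrop 1 e)))).
      apply: (red_env dr e1) => M e [[g0 h0] h1].
      have [_ ej _ _] := next_q _ _ h1; split.
      - by split; rewrite /r edrop_econs //; exact: (qT _ _ h0).
      - rewrite /A /p ej minM_r //; apply: sL; apply: ltMW; exact: (qT _ _ h0).
      - by rewrite /next /r edrop_econs.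
    have dq1T : decidable (fun M e => q M e + 1 < T M (edrop 1 e)).
      by apply: dec_le; defs.
    have rHq : representable (fun M e => H M (econs (q M e + 1) (edrop 1 e))).
      by apply: (rep_env (s := fun M e => econs (q M e + 1) (edrop 1 e))) => //; defs.
    apply: (red_case (c := fun M e => q M e + 1 < T M (edrop 1 e))) => //.
    * apply: red_trans (red_case_intro1 hcn rAn rBn _); last first.
        move=> M e [[[g0 h0] h1] h2]; have [ee _ _ _] := next_q _ _ h1.
        rewrite /c edrop_econs /t /= ee.
        apply: leM_trans _ (leM_mul h2 (leMM (L M (edrop 1 e) + 1))).
        rewrite [X in _ <= X]mulMDl; apply/leM_add2l.
        by rewrite mul1M; exact: leM_addl.
      apply: (red_env (s := fun M e => econs (q M e + 1) (edrop 1 e)) _ s1).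
        by defs.
      move=> M e [[[g0 h0] h1] h2]; have [ee _ er ej] := next_q _ _ h1.
      split=> //.
      by rewrite /A /p er ej /at0 minM_l //; exact: le0M.
    * apply: red_trans (red_case_intro2 hcn rAn rBn _); last first.
        move=> M e [[[g0 h0] h1] /notltM h2]; have [ee _ _ _] := next_q _ _ h1.
        rewrite /c edrop_econs /t /= ee; apply: (proj1 (leMNgt _ _)).
        by apply: leM_mul => //; exact: leMM.
      apply: (red_reflE rHq) => M e [[[g0 h0] h1] /notltM h2].
      rewrite /B edrop_econs /at0; congr H; congr econs.
      by apply: leM_anti => //; exact: (qT _ _ h0).
Qed.

(** This is [flow_ind] for the family read backwards, [H (T - u)]. *)
Lemma flow_ind_down k (G : pred) (H : ugame k) (T : value) : defv T ->
  representable H -> flow (below G T) (next H) H ->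
  flow G (at0 T H) (at0 (fun _ _ => 0) H).
Proof.
move=> dT rH h.
pose s : transformer n := fun M e => econs (T M (edrop 1 e) - e 0%N) (edrop 1 e).
have ds : defe s by rewrite /s; defs.
have := @flow_ind k G (fun M e => H M (s M e)) T dT (rep_env ds rH).
move=> h'; apply: (flow_env (defe_id n) (h' _)) => [|M e g].
  pose s' : transformer n := fun M e =>
    econs (T M (edrop 1 e) - (e 0%N + 1)) (edrop 1 e).
  apply: (flow_env (s := s') _ h) => [|M e [g hu]]; first by rewrite /s'; defs.
  have e1 : T M (edrop 1 e) - (e 0%N + 1) + 1 = T M (edrop 1 e) - e 0%N.
    by rewrite -subM_succ // subMSS.
  split.
  - split=> //; rewrite /s' edrop_econs /= e1; exact: subM_le.
  - by rewrite /next /s' edrop_econs /= e1.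
  - by rewrite /next /s edrop_econs.
by split=> //; rewrite /at0 /s edrop_econs /= ?subM0 ?subMM.
Qed.

Lemma red_not k (G : pred) (P Q : ugame k) : red G P Q -> red G (unot Q) (unot P).
Proof.
move=> h; exists 0%N, [::]; split=> // [M E _|]; first by constructor.
by apply: red_eq h _ => M e [].
Qed.

(** Negation reverses every reduction, so the sequence of negated games has to be walked from its
    end to its start. *)
Lemma flow_not k (G : pred) (P Q : ugame k) : flow G P Q ->
  flow G (unot Q) (unot P).
Proof.
move=> [t [H [dt rH s1 e1 n1]]].
apply: flow_redl (red_not e1) _; apply: flow_redr (red_not s1).
apply: (@flow_ind_down _ G (unot H) t) => //; first exact: rep_not.
apply: flow_red; last exact: red_not.
by apply: rep_not; exact: rep_env (defe_next n) rH.
Qed.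

Lemma flow_opl b k (G : pred) (X X' Y : ugame k) : representable Y ->
  flow G X X' -> flow G (uop b X Y) (uop b X' Y).
Proof.
move=> hY [t [H [dt rH s1 e1 n1]]].
exists t, (uop b H (lift 1 Y)); split=> //.
- by apply: representable_op => //; exact: rep_lift.
- exact: red_mono s1 (red_refl _ hY).
- exact: red_mono e1 (red_refl _ hY).
- apply: red_mono n1 _.
  exact: (red_reflE (rep_lift 1 hY)).
Qed.

Lemma flow_opr b k (G : pred) (X Y Y' : ugame k) : representable X ->
  flow G Y Y' -> flow G (uop b X Y) (uop b X Y').
Proof.
move=> hX [t [H [dt rH s1 e1 n1]]].
exists t, (uop b (lift 1 X) H); split=> //.
- by apply: representable_op => //; exact: rep_lift.
- exact: red_mono (red_refl _ hX) s1.
- exact: red_mono (red_refl _ hX) e1.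
- apply: red_mono _ n1.
  exact: (red_reflE (rep_lift 1 hX)).
Qed.

(** Since [c] does not depend on the time, the two flows are kept side by side, each resting at its
    own end; [t1 + t2] is long enough for both. *)
Lemma flow_case k (c G : pred) (X Y : ugame k) : decidable c ->
  representable X -> representable Y ->
  flow (fun M e => G M e /\ c M e) X Y -> flow (fun M e => G M e /\ ~ c M e) X Y ->
  flow G X Y.
Proof.
move=> hc rX rY [t1 [H1 [dt1 rH1 s1 e1 n1]]] [t2 [H2 [dt2 rH2 s2 e2 n2]]].
pose p (t : value) : transformer n := fun M e =>
  econs (minimum (e 0%N) (t M (edrop 1 e))) (edrop 1 e).
have dp t : defv t -> defe (p t).
  move=> dt; have dt' : defv (fun M e => t M (edrop 1 e)).
    by apply: defv_comp dt _; defs.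
  by rewrite /p; defs.
have p0 t (M : pvmodel n) (e : nat -> M) : p t M (econs 0 e) = econs 0 e.
  by rewrite /p edrop_econs minM_l //; exact: le0M.
have pS t (M : pvmodel n) (e : nat -> M) : e 0%N < t M (edrop 1 e) ->
    p t M e = e /\ p t M (econs (e 0%N + 1) (edrop 1 e)) =
    econs (e 0%N + 1) (edrop 1 e).
  move=> h; rewrite /p edrop_econs /= minM_l ?(minM_l h); last exact: ltMW.
  by split=> //; apply: functional_extensionality => -[].
have pE t (M : pvmodel n) (e : nat -> M) : t M (edrop 1 e) <= e 0%N ->
    p t M (econs (e 0%N + 1) (edrop 1 e)) = p t M e.
  move=> h; rewrite /p edrop_econs /= !minM_r //.
  exact: leM_trans h (ltMW (ltMSn _)).
pose c1 : pred := fun M e => c M (edrop 1 e).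
pose K1 : ugame k := fun M e => H1 M (p t1 M e).
pose K2 : ugame k := fun M e => H2 M (p t2 M e).
have rK1 : representable K1 by exact: rep_env (dp _ dt1) rH1.
have rK2 : representable K2 by exact: rep_env (dp _ dt2) rH2.
have hc1 : decidable c1 by apply: dec_env hc; defs.
pose t : value := fun M e => t1 M e + t2 M e.
have dt : defv t by rewrite /t; defs.
have d0 := defe_at (@defv_zero n); have dat := defe_at dt; have dn := defe_next n.
have rC := rep_case hc1 rK1 rK2.
exists t, (ucase c1 K1 K2); split=> //.
- apply: (red_case hc) => //; first exact: rep_env d0 rC.
  + apply: red_trans (red_case_intro1 (c := fun M e => c1 M (econs 0 e))
      (dec_env d0 hc1) (rep_env d0 rK1) (rep_env d0 rK2) _).
      by apply: red_eq s1 _ => M e g; split=> //; rewrite /K1 p0.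
    by move=> M e []; rewrite /c1 edrop_econs.
  + apply: red_trans (red_case_intro2 (c := fun M e => c1 M (econs 0 e))
      (dec_env d0 hc1) (rep_env d0 rK1) (rep_env d0 rK2) _).
      by apply: red_eq s2 _ => M e g; split=> //; rewrite /K2 p0.
    by move=> M e []; rewrite /c1 edrop_econs.
- apply: (red_case hc) => //; first exact: rep_env dat rC.
  + apply: red_trans (red_case_elim1 (c := fun M e => c1 M (econs (t M e) e))
      (dec_env dat hc1) (rep_env dat rK1) (rep_env dat rK2) _) _.
      by move=> M e []; rewrite /c1 edrop_econs.
    apply: red_eq e1 _ => M e g; split=> //; rewrite /K1 /p edrop_econs /at0 /t /=.
    by rewrite minM_r //; exact: leM_addr.
  + apply: red_trans (red_case_elim2 (c := fun M e => c1 M (econs (t M e) e))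
      (dec_env dat hc1) (rep_env dat rK1) (rep_env dat rK2) _) _.
      by move=> M e []; rewrite /c1 edrop_econs.
    apply: red_eq e2 _ => M e g; split=> //; rewrite /K2 /p edrop_econs /at0 /t /=.
    by rewrite minM_r //; exact: leM_addl.
- have rCn := rep_env dn rC; have hcn := dec_env dn hc1.
  have rn1 := rep_env dn rK1; have rn2 := rep_env dn rK2.
  have dl (u : value) : defv u -> decidable (fun M e => e 0%N < u M (edrop 1 e)).
    move=> du; have du' : defv (fun M e => u M (edrop 1 e)).
      by apply: defv_comp du _; defs.
    by apply: dec_le; defs.
  apply: (red_case hc1) => //.
  + apply: red_trans (red_case_elim1 hc1 rK1 rK2 _) _; first by move=> M e [].
    apply: red_trans (red_case_intro1 hcn rn1 rn2 _); last first.
      by move=> M e []; rewrite /c1 edrop_econs.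
    apply: (red_case (c := fun M e => e 0%N < t1 M (edrop 1 e))) => //.
    * exact: dl.
    * apply: red_eq n1 _ => M e [[[g _] h1] h2]; have [e3 e4] := pS _ _ _ h2.
      by rewrite /K1 e3 e4.
    * apply: (red_reflE rK1) => M e [_ /notltM h2].
      by rewrite /K1 (pE _ _ _ h2).
  + apply: red_trans (red_case_elim2 hc1 rK1 rK2 _) _; first by move=> M e [].
    apply: red_trans (red_case_intro2 hcn rn1 rn2 _); last first.
      by move=> M e []; rewrite /c1 edrop_econs.
    apply: (red_case (c := fun M e => e 0%N < t2 M (edrop 1 e))) => //.
    * exact: dl.
    * apply: red_eq n2 _ => M e [[[g _] h1] h2]; have [e3 e4] := pS _ _ _ h2.
      by rewrite /K2 e3 e4.
    * apply: (red_reflE rK2) => M e [_ /notltM h2].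
      by rewrite /K2 (pE _ _ _ h2).
Qed.

End FlowRules.

(** * Flows under a block of universal quantifiers *)

Section UniversalBlock.
Variable n : nat.
Notation pred := (pred n).
Notation ugame := (ugame n).
Notation value := (value n).
Implicit Type k : nat.

Lemma defe_ecat r (f : nat -> value) (s : transformer n) :
  (forall i, defv (f i)) -> defe s ->
  defe (fun M e => ecat (mkseq (fun i => f i M e) r) (s M e)).
Proof.
move=> hf [q hq]; have [t ht] := choice_fun hf.
exists (fun i => if (i < r)%N then t i else q (i - r)%N) => M e.
apply: functional_extensionality => i; rewrite (ecat_nth (e 0%N)) size_mkseq.
by case: ltnP => hi; [rewrite nth_mkseq // ht|rewrite hq].
Qed.

Definition inblock (ps : seq (term n)) (G : pred) : pred := fun M E =>
  G M (edrop (size ps) E) /\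
  vles (etake (size ps) E) (map (eval (edrop (size ps) E)) ps).

Lemma ecat_mono (M : pvmodel n) (us vs : seq M) e i : vles us vs ->
  ecat us e i <= ecat vs e i.
Proof.
move=> h; elim: h i => [|u v us' vs' huv _ IH] i; first exact: leMM.
by case: i => [|i] /=; [exact: huv|exact: IH].
Qed.

Lemma vles_mkseq (M : pvmodel n) r (f g : nat -> M) :
  (forall i, (i < r)%N -> f i <= g i) -> vles (mkseq f r) (mkseq g r).
Proof.
elim: r f g => [|r IH] f g h; first by constructor.
rewrite !mkseqS -!cats1; apply/vles_cat; first by rewrite !size_mkseq.
by split; [apply: IH => i hi; apply: h; exact: ltnW|constructor; [exact: h|constructor]].
Qed.

Lemma vles_nth (M : pvmodel n) (us vs : seq M) i : vles us vs ->
  (i < size us)%N -> nth 0 us i <= nth 0 vs i.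
Proof.
move=> h; elim: h i => [|u v us' vs' huv _ IH] [|i] //= hi; exact: IH.
Qed.

(* Within a block a bound cannot depend on the other variables of the block:
   the bounds of [H] are replaced by monotone upper bounds, and the moves are
   cut off at the original ones. *)
Lemma forall_block k ps (H : ugame k.+1) : representable H ->
  exists A : ugame k.+1, [/\ representable A,
    forall G U, red (inblock ps G) (lift (size ps) U) H -> red G U A &
    forall G, red (inblock ps G) (lift (size ps) A) H].
Proof.
move=> [N [qs [C [N' [_ rC hH]]]]].
have [b hb] := choice_fun (fun t => let: ex_intro2 T a b := @term_bound n t in
  ex_intro (fun T => monotone T /\ forall (M : pvmodel n) e, eval e t <= eval e T)
    T (conj a b)).
pose l := size ps; pose r := size qs.
(* The monotone bound of each [q] is evaluated at the bounds [ps] in place of the block variables;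
   it dominates [q] for all legal values of the block. *)
pose Qs := map (fun q => tsub (block_sub ps 0) (b q)) qs.
pose rho : transformer n := fun M E =>
  ecat (mkseq (fun i => E i) l) (edrop (l + r)%N E).
have drho : defe rho.
  by apply: defe_ecat; [move=> i; defs|defs].
(* The enlarged bounds admit moves that are illegal in [H]; these are lowered to the true bound, and
   legal moves stay unchanged. *)
pose mins (M : pvmodel n) (E : nat -> M) :=
  mkseq (fun i => minimum (E (l + i)%N) (eval (rho M E) (nth (Var 0) qs i))) r.
pose tau : transformer n := fun M E => ecat (mins M E) (rho M E).
have dtau : defe tau.
  apply: (@defe_ecat r (fun i M E => minimum (E (l + i)%N)
    (eval (rho M E) (nth (Var 0) qs i))) rho) => // i.
  by apply: defv_min; [defs|exact: defv_eval].
have [rt hrt] := dtau.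
pose C' : ugame k := fun M E => C M (tau M E).
have rC' : representable C' by apply: rep_env => //; exists N'.
pose A := ublock (ps ++ Qs) C'.
have sQ : size Qs = r by rewrite size_map.
have rho1 (M : pvmodel n) (E : nat -> M) : edrop l (rho M E) = edrop (l + r) E.
  by rewrite /rho -{1}(etake_size l E) edrop_ecat.
have rho2 (M : pvmodel n) (E : nat -> M) : etake l (rho M E) = etake l E.
  by rewrite /rho -{1}(etake_size l E) etake_ecat.
have sm (M : pvmodel n) (E : nat -> M) : size (mins M E) = r by rewrite size_mkseq.
have tau1 (M : pvmodel n) (E : nat -> M) : edrop r (tau M E) = rho M E.
  by rewrite /tau -{1}(sm M E) edrop_ecat.
have tau2 (M : pvmodel n) (E : nat -> M) : etake r (tau M E) = mins M E.
  by rewrite /tau -{1}(sm M E) etake_ecat.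
have hH1 (M : pvmodel n) (E : nat -> M) : (H M E).1 = map (eval E) qs.
  by case: (hH M E).
have hH2 (M : pvmodel n) (E : nat -> M) us : size us = r ->
    geqv ((H M E).2 us) (C M (ecat us E)).
  by move=> hs; case: (hH M E) => _; apply; rewrite hH1 size_map.
exists A; split; first exact: representable_block.
- move=> G U [l' [f [hl hf h]]].
  have key (M : pvmodel n) (E : nat -> M) : within (l + r) G A E ->
      l' = r /\ within l' (inblock ps G) H (tau M E).
    move=> [g]; rewrite [_.1]/= etake_cat map_cat => /vles_cat[].
      by rewrite etake_size size_map.
    move=> w1 w2.
    have i1 : inblock ps G (rho M E) by rewrite /inblock -/l rho1 rho2.
    have e : l' = r by rewrite -(hl _ _ i1) hH1 size_map.
    split=> //; rewrite e /within tau1 tau2; split=> //.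
    rewrite hH1 (_ : map _ qs = mkseq (fun i => eval (rho M E) (nth (Var 0) qs i)) r).
      by apply: vles_mkseq => i _; exact: minM_ler.
    by rewrite -{1}(mkseq_nth (Var 0) qs) /mkseq -map_comp.
  have ev (M : pvmodel n) (E : nat -> M) :
      map (eval E) (map (tsub rt) f) = map (eval (tau M E)) f.
    by rewrite -map_comp hrt; apply: eq_map => t /=; rewrite eval_tsub.
  exists (l + r)%N, (map (tsub rt) f); split.
  + by move=> M e _; rewrite /= size_map size_cat sQ.
  + move=> M E w; have [e w'] := key _ _ w.
    have := hf _ _ w'; rewrite e tau1 /lift rho1 ev; exact.
  + have h' : red (fun M E => within l' (inblock ps G) H (tau M E))
        (fun M E => ucont l' H (tau M E))
        (fun M E => ucontf l' f (lift (size ps) U) (tau M E)).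
      exact: (red_env dtau h).
    apply: red_ext h' => M E w; have [e w'] := key _ _ w; split=> //.
    * rewrite /ucont e tau1 tau2 /= ecat_take_drop; exact: hH2.
    * rewrite /ucontf ev e tau1 /lift rho1; exact: geqv_refl.
- move=> G; pose f : seq (term n) :=
    mkseq (fun i => Var (r + i)%N) l ++ mkseq Var r.
  have ef (M : pvmodel n) (E : nat -> M) :
      map (eval E) f = etake l (edrop r E) ++ etake r E.
    by rewrite map_cat eval_vars map_eval_Var.
  have key (M : pvmodel n) (E : nat -> M) : within r (inblock ps G) H E ->
      vles (etake l (edrop r E)) (map (eval (edrop (r + l) E)) ps) /\
      vles (etake r E) (map (eval (edrop r E)) qs).
    rewrite /within /inblock hH1 => -[[_ w1] w2]; split=> //.
    move: w1; congr vles; apply: eq_map => t; congr eval.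
    by apply: functional_extensionality => i; rewrite /edrop addnA.
  have rl (M : pvmodel n) (E : nat -> M) : edrop l (edrop r E) = edrop (r + l) E.
    by apply: functional_extensionality => i; rewrite /edrop addnA.
  exists r, f; split.
  + by move=> M e _; rewrite hH1 size_map.
  + move=> M E w; have [w1 w2] := key _ _ w; rewrite ef /lift rl /= map_cat.
    apply/vles_cat; first by rewrite etake_size size_map.
    split=> //; rewrite /Qs -map_comp.
    rewrite (_ : map _ qs = mkseq (fun i => eval (edrop (r + l) E)
      (tsub (block_sub ps 0) (b (nth (Var 0) qs i)))) r); last first.
      by rewrite -{1}(mkseq_nth (Var 0) qs) /mkseq -map_comp.
    apply: vles_mkseq => i hi; rewrite eval_tsub eval_block_sub.
    have [mb hbi] := hb (nth (Var 0) qs i).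
    have := vles_nth (i := i) w2; rewrite etake_size => /(_ hi).
    rewrite nth_mkseq // (nth_map (Var 0)) // => hle.
    apply: leM_trans hle _; apply: leM_trans (hbi _ _) _; apply: mb => j.
    rewrite -{1}(ecat_take_drop l (edrop r E)) rl.
    exact: ecat_mono.
  + apply: red_ext (red_refl (within r (inblock ps G) H) (ex_intro _ N' rC)) => M E w.
    have [w1 w2] := key _ _ w; split=> //; apply: geqv_sym.
      by rewrite -{2}(ecat_take_drop r E); apply: hH2; rewrite etake_size.
    rewrite /ucontf ef /lift rl /= /C'.
    have eE : edrop (l + r) (ecat (etake l (edrop r E) ++ etake r E)
        (edrop (r + l) E)) = edrop (r + l) E.
      rewrite -{1}(_ : size (etake l (edrop r E) ++ etake r E) = (l + r)%N).
        by rewrite edrop_ecat.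
      by rewrite size_cat !etake_size.
    set E' := ecat _ _ in eE *.
    have e1 : rho M E' = edrop r E.
      rewrite /rho eE -[RHS](ecat_take_drop l) rl; congr ecat.
      rewrite -[mkseq _ _]/(etake l E') /E' -{1}(etake_size l (edrop r E)) ecat_cat.
      exact: etake_ecat.
    have -> : tau M E' = E; last exact: geqv_refl.
    rewrite /tau e1 -[RHS](ecat_take_drop r E); congr ecat.
    rewrite /mins e1; apply: (@eq_from_nth _ 0); rewrite ?size_mkseq // => i hi.
    rewrite !nth_mkseq //.
    have -> : E' (l + i)%N = E i.
      rewrite /E' ecat_cat (ecat_nth 0) etake_size ltnNge leq_addr /= addKn.
      by rewrite (ecat_nth 0) etake_size hi nth_mkseq.
    apply: minM_l; have := vles_nth (i := i) w2; rewrite etake_size => /(_ hi).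
    by rewrite nth_mkseq // (nth_map (Var 0)).
Qed.

Lemma red_block_intro k ps (G : pred) (U : ugame k.+1) (P : ugame k) :
  red (inblock ps G) (lift (size ps) U) (unot P) -> red G U (ublock ps P).
Proof.
move=> [l [f [hl hf h]]].
have key (M : pvmodel n) (E : nat -> M) : within (size ps) G (ublock ps P) E ->
    l = 0%N /\ within l (inblock ps G) (unot P) E.
  move=> [g w]; have i1 : inblock ps G E by split.
  have e : l = 0%N by rewrite -(hl _ _ i1).
  by split=> //; rewrite e; split; [exact: i1|constructor].
exists (size ps), f; split.
- by move=> M e _; rewrite size_map.
- move=> M E w; have [e w'] := key _ _ w; have := hf _ _ w'.
  by rewrite e.
- apply: red_ext h => M E w; have [e w'] := key _ _ w; split=> //.
  + by rewrite /ucont /= ecat_take_drop e; exact: geqv_refl.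
  + by rewrite /ucontf e; exact: geqv_refl.
Qed.

(** The flow is run for all values of the block simultaneously: the game at time [u] is the
    universal closure of the one given for each value. The lengths differ from value to value, so
    each sequence rests once it has reached its end. *)
Lemma flow_forall k ps (G : pred) (U : ugame k.+1) (P : ugame k) :
  representable P ->
  flow (inblock ps G) (lift (size ps) U) (unot P) -> flow G U (ublock ps P).
Proof.
move=> rP [t [H [dt rH s1 e1 n1]]].
have [b [db hb mb]] := defv_bound dt.
pose l := size ps.
(* The context of [H1] consists of the block, the time and [e]. *)
pose tE : value := fun M E => t M (ecat (etake l E) (edrop l.+1 E)).
pose sg : transformer n := fun M E =>
  econs (minimum (E l) (tE M E)) (ecat (etake l E) (edrop l.+1 E)).
pose us : transformer n := fun M E => ecat (mkseq (fun i => E i) l) (edrop l.+1 E).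
have dus : defe us by apply: defe_ecat; [move=> i; defs|defs].
have dsg : defe sg by apply: defe_cons => //; apply: defv_min => //; defs.
pose H1 : ugame k.+1 := fun M E => H M (sg M E).
have rH1 : representable H1 by exact: rep_env.
pose ps1 := map (tshift 1) ps.
have sps1 : size ps1 = l by rewrite size_map.
have [A [rA Ai Ae]] := forall_block ps1 rH1.
(* The block stays below [ps], so the monotone bound of the length, taken at [ps], is at least every
   individual length. *)
pose T : value := fun M e => b M (ecat (map (eval e) ps) e).
have dT : defv T.
  apply: defv_comp db _.
  have -> : (fun M (e : nat -> M) => ecat (map (eval e) ps) e) =
      (fun (M : pvmodel n) (e : nat -> M) =>
        ecat (mkseq (fun i => eval e (nth (Var 0) ps i)) l) e) :> transformer n.
    apply: functional_extensionality_dep => M.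
    apply: functional_extensionality => e.
    by rewrite -{1}(mkseq_nth (Var 0) ps) /mkseq -map_comp.
  by apply: (@defe_ecat l (fun i M e => eval e (nth (Var 0) ps i)));
    [move=> i; defs|defs].
have drS (M : pvmodel n) (E : nat -> M) : edrop 1 (edrop l E) = edrop l.+1 E.
  by apply: functional_extensionality => i; rewrite /edrop addnA addn1.
have psE (M : pvmodel n) (e : nat -> M) : map (eval e) ps1 = map (eval (edrop 1 e)) ps.
  by rewrite /ps1 -map_comp; apply: eq_map => q /=; rewrite eval_tshift.
have inb (G0 : pred) (M : pvmodel n) (E : nat -> M) : inblock ps1 G0 E ->
    G0 M (edrop l E) /\
    vles (etake l E) (map (eval (edrop l.+1 E)) ps).
  by rewrite /inblock sps1 psE drS.
have ed (M : pvmodel n) (E : nat -> M) :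
    edrop l (ecat (etake l E) (edrop l.+1 E)) = edrop l.+1 E.
  by rewrite -{1}(etake_size l E) edrop_ecat.
have et (M : pvmodel n) (E : nat -> M) :
    etake l (ecat (etake l E) (edrop l.+1 E)) = etake l E.
  by rewrite -{1}(etake_size l E) etake_ecat.
exists T, A; split=> //.
- have h0 : red (fun M e => G M (edrop 1 e) /\ e 0%N = 0) (lift 1 U) A.
    apply: Ai; apply: (red_env dus s1) => M E /inb[[g h0] w].
    rewrite /us -[mkseq _ _]/(etake l E); split.
    + by rewrite /inblock -/l ed et; split=> //; rewrite -drS.
    + by rewrite /lift -/l ed sps1 drS.
    + rewrite /H1 /sg /at0 -(_ : E l = 0); last by rewrite -h0 /edrop addn0.
      rewrite minM_l //; move: h0; rewrite /edrop addn0 => ->; exact: le0M.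
  by apply: (red_env (defe_at (@defv_zero n)) h0).
- apply: red_block_intro.
  have h1 : red (inblock ps G) (lift l (at0 T A))
      (fun M E => H1 M (ecat (etake l E) (econs (T M (edrop l E)) (edrop l E)))).
    have h1 := Ae (fun M e => G M (edrop 1 e)).
    pose s1' : transformer n := fun M E => ecat (mkseq (fun i => E i) l)
        (econs (T M (edrop l E)) (edrop l E)).
    have d1 : defe s1'.
      apply: defe_ecat; first by move=> i; defs.
      by apply: defe_cons; [apply: defv_comp dT _; defs|defs].
    apply: (red_env d1 h1) => M E [g w]; rewrite /s1' -[mkseq _ _]/(etake l E).
    have f1 : edrop l (ecat (etake l E) (econs (T M (edrop l E)) (edrop l E))) =
        econs (T M (edrop l E)) (edrop l E).
      by rewrite -{1}(etake_size l E) edrop_ecat.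
    have f2 : etake l (ecat (etake l E) (econs (T M (edrop l E)) (edrop l E))) =
        etake l E.
      by rewrite -{1}(etake_size l E) etake_ecat.
    split=> //.
    + by rewrite /inblock sps1 f1 f2 psE edrop_econs.
    + by rewrite /lift sps1 f1.
  apply: red_trans h1 _; apply: red_eq e1 _ => M E [g w]; split=> //.
  rewrite /H1 /sg /tE.
  have f1 : edrop l (ecat (etake l E) (econs (T M (edrop l E)) (edrop l E))) =
      econs (T M (edrop l E)) (edrop l E).
    by rewrite -{1}(etake_size l E) edrop_ecat.
  have f2 : etake l (ecat (etake l E) (econs (T M (edrop l E)) (edrop l E))) =
      etake l E.
    by rewrite -{1}(etake_size l E) etake_ecat.
  rewrite f2 -drS f1 edrop_econs ecat_take_drop /at0.
  have -> : ecat (etake l E) (econs (T M (edrop l E)) (edrop l E)) l = T M (edrop l E).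
    by rewrite (ecat_nth 0) etake_size ltnn subnn.
  rewrite minM_r //; apply: leM_trans (hb _ _) _; apply: mb => i.
  by rewrite -{1}(ecat_take_drop l E); apply: ecat_mono.
(* [Ai] yields reductions whose target is [A] itself, at the current time. Hence the step is proved
   from time [u - 1] to [u] for [1 <= u <= T], and afterwards shifted by [defe_next]. *)
- pose v1 : transformer n := fun M e => econs (e 0%N - 1) (edrop 1 e).
  pose G1 : pred := fun M e => [/\ G M (edrop 1 e), 1 <= e 0%N &
    e 0%N <= T M (edrop 1 e)].
  pose w1 : transformer n := fun M E =>
    ecat (mkseq (fun i => E i) l) (econs (E l - 1) (edrop l.+1 E)).
  have dw1 : defe w1 by apply: defe_ecat; [move=> i; defs|defs].
  have w1d (M : pvmodel n) (E : nat -> M) : edrop l (w1 M E) = econs (E l - 1) (edrop l.+1 E).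
    by rewrite /w1 -[mkseq _ _]/(etake l E) -{1}(etake_size l E) edrop_ecat.
  have w1t (M : pvmodel n) (E : nat -> M) : etake l (w1 M E) = etake l E.
    by rewrite /w1 -[mkseq _ _]/(etake l E) -{1}(etake_size l E) etake_ecat.
  have w1l (M : pvmodel n) (E : nat -> M) : w1 M E l = E l - 1.
    by rewrite /w1 (ecat_nth 0) size_mkseq ltnn subnn.
  have El (M : pvmodel n) (E : nat -> M) : edrop l E 0%N = E l.
    by rewrite /edrop addn0.
  have sgw (M : pvmodel n) (E : nat -> M) : sg M (w1 M E) =
      econs (minimum (E l - 1) (tE M E)) (ecat (etake l E) (edrop l.+1 E)).
    by rewrite /sg /tE w1t -drS w1d edrop_econs w1l.
  have h : red G1 (fun M e => A M (v1 M e)) A.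
    apply: Ai; rewrite sps1.
    apply: (@red_trans _ _ _ _ (fun M E => H1 M (w1 M E))).
      apply: (red_env dw1 (Ae (fun M e => G M (edrop 1 e)))) => M E /inb[[g _ _] w].
      split=> //; first by rewrite /inblock sps1 w1d w1t psE edrop_econs; split=> //; rewrite -drS.
      by rewrite /lift /v1 sps1 w1d El drS.
    have rw : representable (fun M E => H1 M (w1 M E)) by exact: rep_env.
    apply: (red_case (c := fun M E => E l - 1 < tE M E)) => //.
      by apply: dec_le; defs.
      pose sg' : transformer n := fun M E =>
        econs (E l - 1) (ecat (mkseq (fun i => E i) l) (edrop l.+1 E)).
      have dsg' : defe sg' by apply: defe_cons; [defs|].
      apply: (red_env dsg' n1) => M E [/inb[[g g1 g2] w] hlt].
      have e' : E l - 1 + 1 = E l by apply: subMK; rewrite -El.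
      split.
      + split; last exact: hlt.
        rewrite /sg' edrop_econs -[mkseq _ _]/(etake l E) /inblock -/l ed et.
        by split=> //; rewrite -drS.
      + by rewrite /H1 sgw minM_l //; exact: ltMW.
      + by rewrite /H1 /sg /next /sg' edrop_econs /= e' minM_l // -e'.
    apply: red_reflE => // M E [/inb[[g g1 g2] w] /notltM hge].
    have e' : E l - 1 + 1 = E l by apply: subMK; rewrite -El.
    rewrite /H1 sgw /sg !minM_r //; rewrite -e'; exact: leM_trans hge (ltMW (ltMSn _)).
  apply: (red_env (defe_next n) h) => M e [g hT]; split=> //.
  + by split; rewrite ?edrop_econs //=; exact: leM_addl.
  + rewrite /v1 edrop_econs /= addMK; congr A.
    by apply: functional_extensionality => -[].
Qed.

End UniversalBlock.

(** * Contraction *)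

Fixpoint gval n (M : model n) k : game M k -> Prop :=
  if k is j.+1 return game M k -> Prop then fun X =>
    forall us, vles us X.1 -> ~ gval (X.2 us)
  else id.

Lemma gval_geqv n (M : model n) k (X Y : game M k) :
  geqv X Y -> gval X <-> gval Y.
Proof.
elim: k X Y => [//|k IH] X Y [e h] /=; split=> hX us hus.
- rewrite -e in hus; rewrite -(IH _ _ (h us (vles_size hus))); exact: hX.
- rewrite (IH _ _ (h us (vles_size hus))); apply: hX; by rewrite -e.
Qed.

(** * Splitting off one bounded quantifier *)

Section Decomposition.
Variable n : nat.
Notation pred := (pred n).
Notation ugame := (ugame n).
Notation value := (value n).
Implicit Type k : nat.

Definition always : pred := fun _ _ => True.

Definition uconst k (b : Prop) : ugame k := upad k (fun _ _ => b).

Lemma rep_const k (b : Prop) : representable (uconst k b).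
Proof. by apply: representable_pad; exact: decidable_const. Qed.

(* [X] is equivalent to [forall i < t, P i], and [Z i] to [forall j < i, P j]. *)
Definition all_chain k (X Z P : ugame k) (t : value) : Prop :=
  [/\ red always (uconst k True) (at0 (fun _ _ => 0) Z),
    red (below always t) (uop true Z P) (next Z), red always (at0 t Z) X,
    red (below always t) (lift 1 X) P &
    forall M e, (forall d, d < t M e -> gval (P M (econs d e))) -> gval (X M e)].

(** The dual notion: [X] is equivalent to [exists i < t, P i], and [Z i] to [exists j < i, P j]. As
    in [all_chain], the last clause speaks of truth in a model, because passing between [X] and all
    its instances takes a whole flow and not one reduction. *)
Definition ex_chain k (X Z P : ugame k) (t : value) : Prop :=
  [/\ red always (at0 (fun _ _ => 0) Z) (uconst k False),
    red (below always t) (next Z) (uop false Z P), red always X (at0 t Z),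
    red (below always t) P (lift 1 X) &
    forall M e, gval (X M e) -> exists2 d, d < t M e & gval (P M (econs d e))].

Lemma rep_env_count k N (X : ugame k) s : defe s -> rep N X ->
  rep N (fun M e => X M (s M e)).
Proof.
move=> [r hr] hX; apply: rep_ext (rep_sub r hX) => M e.
by rewrite /usub hr; exact: geqv_refl.
Qed.

Lemma red_and_pad k (G c : pred) (X : ugame k) : decidable c -> representable X ->
  (forall M e, G M e -> c M e) -> red G X (uop true (upad k c) X).
Proof.
move=> hc hX h; have hp : representable (upad k c) by exact: representable_pad.
apply: red_trans (red_comm true G hX hp); apply: red_gle => //.
  exact: representable_op.
by move=> M e g; apply: (proj1 (gle_pad (X M e) (c M e))); exact: h.
Qed.

Lemma red_proj2 k (G : pred) (X Y : ugame k) : representable X ->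
  representable Y -> red G (uop true X Y) Y.
Proof.
by move=> hX hY; apply: red_trans (red_comm _ _ hX hY) (proj1 (red_proj _ hY hX)).
Qed.

Lemma red_inj2 k (G : pred) (X Y : ugame k) : representable X ->
  representable Y -> red G Y (uop false X Y).
Proof.
by move=> hX hY; apply: red_trans (proj2 (red_proj _ hY hX)) (red_comm _ _ hY hX).
Qed.

Section Insert.
Variables (M : pvmodel n) (l : nat) (E : nat -> M).

Lemma insert_at (e : nat -> M) : ecat (etake l E) e l = e 0%N.
Proof. by rewrite (ecat_nth (E 0%N)) etake_size ltnn subnn. Qed.

Lemma insert_drop (e : nat -> M) : edrop l (ecat (etake l E) e) = e.
Proof. by rewrite -{1}(etake_size l E) edrop_ecat. Qed.

Lemma insert_dropS (e : nat -> M) :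
  edrop l.+1 (ecat (etake l E) e) = edrop 1 e.
Proof.
rewrite -[in RHS](insert_drop e); apply: functional_extensionality => i.
by rewrite /edrop addnA addn1.
Qed.

Lemma insert_take (e : nat -> M) : etake l (ecat (etake l E) e) = etake l E.
Proof. by rewrite -{1}(etake_size l E) etake_ecat. Qed.

End Insert.

Lemma gpad_geqv (D : Type) k (P Q : Prop) : (P <-> Q) ->
  geqv (gpad D k P) (gpad D k Q).
Proof.
elim: k P Q => [//|k IH] P Q h; split=> // us _; apply: IH.
by split=> h1 h2; apply: h1; apply/h.
Qed.

(** The first variable of the block becomes the time. [P] fixes it to the current time and so has
    one quantifier less; [Z] keeps it but restricts it to values below the time. The length is
    [p + 1] because the bound [p] is inclusive. *)
Lemma block_chain k N p ps (C : ugame k) : rep N C ->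
  exists Z P t, [/\ defv t, representable Z, rep (size ps + N) P &
    all_chain (ublock (p :: ps) C) Z P t].
Proof.
move=> rC; have RC : representable C by exists N.
pose l' := size ps; pose l := l'.+1.
pose us1 : transformer n := fun M E => ecat (mkseq (fun i => E i) l) (edrop l.+1 E).
pose us2 : transformer n := fun M E =>
  econs (E l') (ecat (mkseq (fun i => E i) l') (edrop l'.+1 E)).
have dus1 : defe us1 by apply: defe_ecat; [move=> i; defs|defs].
have dus2 : defe us2.
  by apply: defe_cons; [defs|apply: defe_ecat; [move=> i; defs|defs]].
(* [E 0] is the first entry of the move and [E l] the time. What follows the block is to be refuted,
   so conjoining this condition to it restricts the universal quantifier to values below the
   time. *)
pose c : pred := fun M E => E 0%N < E l.
have dc : decidable c by apply: dec_le; defs.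
pose D : ugame k := fun M E => C M (us1 M E).
pose Z := ublock (map (tshift 1) (p :: ps)) (uop true (upad k c) D).
pose P := ublock (map (tshift 1) ps) (fun M E => C M (us2 M E)).
pose t : value := fun M e => eval e p + 1.
have dt : defv t by rewrite /t; defs.
have rD : representable D by exact: rep_env.
have rpc : representable (upad k c) by exact: representable_pad.
have rZc : representable (uop true (upad k c) D) by exact: representable_op.
have drS (M : pvmodel n) (E : nat -> M) j : edrop 1 (edrop j E) = edrop j.+1 E.
  by apply: functional_extensionality => i; rewrite /edrop addnA addn1.
have evs (M : pvmodel n) (e : nat -> M) qs :
    map (eval e) (map (tshift 1) qs) = map (eval (edrop 1 e)) qs.
  by rewrite -map_comp; apply: eq_map => q /=; rewrite eval_tshift.
have rtrue := rep_const k (~ True).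
exists Z, P, t; split=> //; first exact: representable_block.
  exists (map (tshift 1) ps), (fun M E => C M (us2 M E)), N.
  by split=> [||M e]; [rewrite size_map|exact: rep_env_count|exact: geqv_refl].
split.
- exists l, [::]; split=> [M e _|M E _|]; first by rewrite !size_map.
    by constructor.
  pose tau : transformer n := fun M E =>
    ecat (mkseq (fun i => E i) l) (econs 0 (edrop l E)).
  have dtau : defe tau by apply: defe_ecat; [move=> i; defs|defs].
  have tau0 (M : pvmodel n) (E : nat -> M) : tau M E l = 0.
    by rewrite /tau (ecat_nth 0) size_mkseq ltnn subnn.
  apply: (@red_trans _ _ _ _ (fun M E => upad k c (tau M E))).
    apply: (red_env dtau (proj1 (red_proj always rpc rD))) => M E _.
    by split.
  apply: (proj2 (red_pad _ (fun M E => c M (tau M E)) rtrue)) => M E _.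
  by rewrite /c tau0; move/leM0/addM_eq0=> [_ /oneM_neq0].
- pose D' : ugame k := fun M E => C M (econs (E l)
    (ecat (mkseq (fun i => E (1 + i)%N) l') (edrop l.+1 E))).
  have rD' : representable D'.
    apply: (rep_env (s := fun M E => econs (E l)
      (ecat (mkseq (fun i => E (1 + i)%N) l') (edrop l.+1 E)))) => //.
    by apply: defe_cons; [defs|apply: defe_ecat; [move=> i; defs|defs]].
  (* The same move is used in both conjuncts: unchanged in [Z], without its first entry in [P]. If
     that entry is below the time, [Z] answers; if it equals the time, [P] does. *)
  exists l, (mkseq Var l ++ mkseq (fun j => Var (1 + j)%N) l'); split.
  + by move=> M e _; rewrite /= !size_map.
  + move=> M E [_]; rewrite map_cat map_eval_Var eval_vars => w.
    have {}w : vles (etake l E) (map (eval (edrop 1 (edrop l E))) (p :: ps)).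
      move: w; rewrite -[(next Z _).1]/(map (eval (econs (edrop l E 0%N + 1)
        (edrop 1 (edrop l E)))) (map (tshift 1) (p :: ps))) evs; exact.
    suff : vles (etake l E ++ etake l' (edrop 1 E))
        (map (eval (edrop 1 (edrop l E))) (p :: ps) ++
         map (eval (edrop 1 (edrop l E))) ps) by rewrite -!evs.
    apply/vles_cat; first by rewrite etake_size /= size_map.
    split=> //; rewrite etakeS in w; by inversion w.
  + pose c' : pred := fun M E => E 0%N < E l + 1.
    have dc' : decidable c' by apply: dec_le; defs.
    have rpc' : representable (upad k c') by exact: representable_pad.
    have rT : representable (uop false (uop true (upad k c) D) D').
      exact: representable_op.
    have rS : representable (uop true (upad k c') D) by exact: representable_op.
    have main G0 : red G0 (uop true (upad k c') D)
        (uop false (uop true (upad k c) D) D').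
      apply: (red_case dc) => //.
        apply: red_trans (proj2 (red_proj _ rZc rD')).
        apply: red_trans (red_proj2 _ rpc' rD) _.
        by apply: red_and_pad => // M E [].
      apply: (red_case dc') => //.
        apply: red_trans (red_inj2 _ rZc rD').
        apply: red_trans (red_proj2 _ rpc' rD) _.
        apply: red_reflE => // M E [[_ h1] h2].
        have e0 : E 0%N = E l by apply: leM_anti; [exact/ltMS|exact: notltM].
        rewrite /D /D' /us1 -e0; congr C.
        by rewrite -[mkseq (fun i => E i) l]/(etake l E) etakeS.
      apply: red_trans (proj1 (red_proj _ rpc' rD)) _.
      by apply: (proj2 (red_pad _ c' rT)) => M E [].
    apply: red_ext (main _) => M E w; split; first exact: w.
    * apply: gop_geqv.
        apply: gpad_geqv; rewrite /c' /c insert_at etakeS.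
        by rewrite /= /edrop addn0.
      rewrite /D /us1 -[mkseq _ _]/(etake l E) -[mkseq _ _]/(etake l _).
      rewrite insert_take insert_dropS  edrop_econs drS; exact: geqv_refl.
    * pose fs := etake l E ++ etake l' (edrop 1 E).
      have sz : size (Z M (edrop l E)).1 = l by rewrite !size_map.
      have -> : ucontf l (mkseq Var l ++ mkseq (fun j => Var (1 + j)%N) l')
          (uop true Z P) E =
          gop false ((Z M (edrop l E)).2 (take (size (Z M (edrop l E)).1) fs))
            ((P M (edrop l E)).2 (drop (size (Z M (edrop l E)).1) fs)).
        by rewrite /fs -map_eval_Var -eval_vars -map_cat.
      rewrite sz /fs take_size_cat ?drop_size_cat ?etake_size //.
      have -> : (Z M (edrop l E)).2 (etake l E) = uop true (upad k c) D E.
        by rewrite -[in RHS](ecat_take_drop l E).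
      have -> : (P M (edrop l E)).2 (etake l' (edrop 1 E)) =
        C M (us2 M (ecat (etake l' (edrop 1 E)) (edrop l E))) by [].
      apply: gop_geqv; first exact: geqv_refl.
      rewrite /D' /us2 -[mkseq _ _]/(etake l' (edrop 1 E)) -[mkseq _ _]/(etake l' _).
      rewrite insert_take insert_at insert_dropS drS.
      have -> : edrop l E 0%N = E l by rewrite /edrop addn0.
      exact: geqv_refl.
- exists l, (mkseq Var l); split=> [M e _|M E|].
  + by rewrite /= !size_map.
  + move=> [_ w]; rewrite map_eval_Var.
    have := evs M (econs (t M (edrop l E)) (edrop l E)) (p :: ps).
    by rewrite edrop_econs => ew; rewrite /at0 /Z [_.1]ew.
  + apply: red_ext (red_and_pad (G := within l always (ublock (p :: ps) C))
      (c := fun M E => E 0%N < t M (edrop l E)) _ RC _) => [M E w||M E [_]].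
    * split=> //.
        by rewrite -[X in geqv X](congr1 (C M) (ecat_take_drop l E)); exact: geqv_refl.
      rewrite /ucontf map_eval_Var; apply: gop_geqv.
        by apply: gpad_geqv; rewrite /c insert_at etakeS.
      rewrite /D /us1 -[mkseq _ _]/(etake l _) insert_take insert_dropS edrop_econs.
      by rewrite ecat_take_drop; exact: geqv_refl.
    * have dtl : defv (fun M e => t M (edrop l e)) by apply: defv_comp dt _; defs.
      by apply: dec_le; defs.
    * rewrite etakeS => w; inversion w; apply/ltMS.
      by move: H2; rewrite /t.
- exists l', (Var l' :: mkseq Var l'); split=> [M e _|M E|].
  + by rewrite /= !size_map.
  + move=> [[_ hd] w]; rewrite [map _ (_ :: _)]/= map_eval_Var /lift.
    have e0 : edrop l' E 0%N = E l' by rewrite /edrop addn0.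
    rewrite e0 in hd; constructor; first exact/ltMS.
    by move: w; rewrite /P [_.1]/= evs.
  + pose X' : ugame k := fun M E => C M (us2 M E).
    have rX' : representable X' by exact: rep_env.
    apply: red_ext (red_refl (within l' (below always t) P) rX') => M E w; split=> //.
      rewrite /X' /ucont /P /= ecat_take_drop; exact: geqv_refl.
    rewrite /X' /ucontf /us2 /lift /= map_eval_Var drS; exact: geqv_refl.
- move=> M e h us hus hC.
  case: us hus hC => [|d us] hus hC; inversion hus; subst.
  have hd : d < t M e by apply/ltMS.
  apply: (h d hd us); first by rewrite /P [_.1]/= evs edrop_econs.
  rewrite /P /= /us2 -[mkseq _ _]/(etake l' _).
  have sz : size us = l' by rewrite (vles_size H4) size_map.
  rewrite -sz etake_ecat -drS edrop_ecat edrop_econs.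
  by rewrite (ecat_nth d) ltnn subnn.
Qed.

End Decomposition.

Section Contraction.
Variable n : nat.
Notation pred := (pred n).
Notation ugame := (ugame n).
Notation value := (value n).
Notation always := (@always n).
Implicit Type k : nat.

Definition flat k (X : ugame k) : Prop :=
  exists2 c, decidable c & forall M e, geqv (X M e) (upad k c e).

Lemma all_chain_ext k (X X' Z P : ugame k) t :
  (forall M e, geqv (X M e) (X' M e)) -> all_chain X Z P t -> all_chain X' Z P t.
Proof.
move=> h [h1 h2 h3 h4 h5]; split=> //.
- by apply: red_ext h3 => M e _; split=> //; exact: geqv_refl.
- by apply: red_ext h4 => M e w; split=> //; [exact: h|exact: geqv_refl].
- by move=> M e hP; rewrite -(gval_geqv (h M e)); exact: h5.
Qed.

Lemma ex_chain_ext k (X X' Z P : ugame k) t :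
  (forall M e, geqv (X M e) (X' M e)) -> ex_chain X Z P t -> ex_chain X' Z P t.
Proof.
move=> h [h1 h2 h3 h4 h5]; split=> //.
- by apply: red_ext h3 => M e _; split=> //; exact: geqv_refl.
- by apply: red_ext h4 => M e w; split=> //; [exact: geqv_refl|exact: h].
- by move=> M e; rewrite -(gval_geqv (h M e)); exact: h5.
Qed.

Lemma gval_not (M : pvmodel n) k (X : ugame k) e :
  gval (unot X e) <-> ~ gval (X M e).
Proof.
split=> [h|h us _ //]; apply: (h [::]); by constructor.
Qed.

Lemma all_chain_not k (X Z P : ugame k) t :
  all_chain X Z P t -> ex_chain (unot X) (unot Z) (unot P) t.
Proof.
move=> [h1 h2 h3 h4 h5]; split.
- apply: red_ext (red_not h1) => M e _; split=> //; first exact: geqv_refl.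
  by split=> // us _; apply: gpad_geqv; tauto.
- exact: red_not h2.
- exact: red_not h3.
- exact: red_not h4.
- move=> M e /gval_not hX; apply: NNPP => hn; apply: hX; apply: h5 => d hd.
  by apply: NNPP => hP; apply: hn; exists d => //; apply/gval_not.
Qed.

Lemma ex_chain_not k (X Z P : ugame k) t :
  ex_chain X Z P t -> all_chain (unot X) (unot Z) (unot P) t.
Proof.
move=> [h1 h2 h3 h4 h5]; split.
- apply: red_ext (red_not h1) => M e _; split=> //; last exact: geqv_refl.
  by split=> // us _; apply: gpad_geqv; tauto.
- exact: red_not h2.
- exact: red_not h3.
- exact: red_not h4.
- move=> M e h; apply/gval_not => /h5[d hd hP].
  by move: (h d hd) => /gval_not.
Qed.

(** The outermost nonempty block is the one to split. Empty blocks in front of it act as negations,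
    and each exchanges the two kinds of chain. *)
Lemma decomposition k N (X : ugame k) : rep N X -> flat X \/
  exists N' Z P t, [/\ N = N'.+1, defv t, representable Z, rep N' P &
    all_chain X Z P t \/ ex_chain X Z P t].
Proof.
elim: k N X => [|k IH] N X; first by move=> hX; left; exists X => // M e.
move=> [[|p ps] [C [N1 [-> rC hX]]]].
- have hX' (M : pvmodel n) e : geqv (X M e) (unot C e).
    by apply: geqv_trans (hX M e) _; split=> // -[] // _; exact: geqv_refl.
  have hX'' (M : pvmodel n) e : geqv (unot C e) (X M e) by apply: geqv_sym.
  case: (IH _ _ rC) => [[c hc hC]|[N' [Z [P [t [e dt rZ rP h]]]]]].
    left; exists (fun M e => ~ c M e); first exact: decidable_not.
    move=> M e; apply: geqv_trans (hX' M e) _; split=> // us _.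
    by apply: geqv_trans (hC M e) _; apply: gpad_geqv; tauto.
  right; exists N', (unot Z), (unot P), t; split=> //; first exact: rep_not.
    exists [::], P, N'; split=> // M e'.
    by split=> // -[] // _; exact: geqv_refl.
  case: h => h; [right|left].
  + exact: ex_chain_ext hX'' (all_chain_not h).
  + exact: all_chain_ext hX'' (ex_chain_not h).
- have [Z [P [t [dt rZ rP h]]]] := block_chain p ps rC.
  right; exists (size ps + N1)%N, Z, P, t; split=> //.
  left; apply: all_chain_ext h => M e; exact: geqv_sym.
Qed.

Definition gcase D k (c : Prop) (X Y : game D k) : game D k :=
  gop false (gop true (gpad D k c) X) (gop true (gpad D k (~ c)) Y).

(* The meet of [unot P] and [unot Q], as a choice of which of them to play. *)
Definition umeet k (P Q : ugame k) : ugame k.+1 := fun M e =>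
  ([:: one M], fun us => gcase (nth 0 us 0 = 0) (P M e) (Q M e)).

Lemma umeet_block k (P Q : ugame k) (M : pvmodel n) (e : nat -> M) :
  geqv (umeet P Q e)
    (ublock [:: 1%pv] (ucase (fun M e => e 0%N = 0) (lift 1 P) (lift 1 Q)) e).
Proof.
split; first by rewrite /= evalE.
by move=> [|u []] // _; exact: geqv_refl.
Qed.

Lemma dec_zero : decidable (fun (M : pvmodel n) e => e 0%N = 0).
Proof. by apply: dec_eq; defs. Qed.

Lemma rep_umeet k (P Q : ugame k) : representable P -> representable Q ->
  representable (umeet P Q).
Proof.
move=> rP rQ.
have h := rep_case dec_zero (rep_lift 1 rP) (rep_lift 1 rQ).
apply: representable_ext (representable_block [:: 1%pv] h) => M e.
by apply: geqv_sym; exact: umeet_block.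
Qed.

(** Universal quantification over the choice, followed by a case distinction on it. Only one of the
    two flows is used for each choice, so no contraction is involved; pairing the flows into a
    conjunction would need it. *)
Lemma umeet_intro k (G : pred) (U : ugame k.+1) (P Q : ugame k) :
  representable U -> representable P -> representable Q ->
  flow G U (unot P) -> flow G U (unot Q) -> flow G U (umeet P Q).
Proof.
move=> rU rP rQ hP hQ.
have rPl := rep_lift 1 rP; have rQl := rep_lift 1 rQ.
have rc := rep_case dec_zero rPl rQl.
apply: (@flow_redr _ _ _ _ (ublock [:: 1%pv]
  (ucase (fun M e => e 0%N = 0) (lift 1 P) (lift 1 Q)))); last first.
  apply: red_geqv.
  - exact: representable_block.
  - exact: rep_umeet.
  - by move=> M e _; apply: geqv_sym; exact: umeet_block.
apply: flow_forall => //.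
apply: (flow_case dec_zero); [exact: rep_lift|exact: rep_not| |].
- apply: (@flow_redr _ _ _ _ (lift 1 (unot P))).
    by apply: (flow_env (defe_drop n 1) hP) => M e [[g _] _].
  by apply: red_not; apply: red_case_elim1 => //; [exact: dec_zero|move=> M e []].
- apply: (@flow_redr _ _ _ _ (lift 1 (unot Q))).
    by apply: (flow_env (defe_drop n 1) hQ) => M e [[g _] _].
  by apply: red_not; apply: red_case_elim2 => //; [exact: dec_zero|move=> M e []].
Qed.

Lemma red_umeet1 k (G : pred) (P Q : ugame k) :
  representable P -> representable Q -> red G (umeet P Q) (unot P).
Proof.
move=> rP rQ; exists 0%N, [:: 0%pv]; split=> // [M E _|].
  by rewrite /= evalE; constructor; [exact: le0M|constructor].
have h := red_case_intro1 (G := within 0 G (unot P)) (@decidable_const n True) rP rQ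
  (fun _ _ _ => Logic.I).
apply: red_ext h => M E w; split=> //; first exact: geqv_refl.
apply: gop_geqv; apply: gop_geqv; try exact: geqv_refl.
- by apply: gpad_geqv; rewrite /= evalE.
- by apply: gpad_geqv; rewrite /= evalE.
Qed.

Lemma red_umeet2 k (G : pred) (P Q : ugame k) :
  representable P -> representable Q -> red G (umeet P Q) (unot Q).
Proof.
move=> rP rQ; exists 0%N, [:: 1%pv]; split=> // [M E _|].
  by rewrite /= evalE; constructor; [exact: leMM|constructor].
have h := red_case_intro2 (G := within 0 G (unot Q)) (@decidable_const n False) rP rQ
  (fun _ _ _ f => f).
have n1 (M : pvmodel n) : one M = 0 <-> False by split=> // /oneM_neq0.
apply: red_ext h => M E w; split=> //; first exact: geqv_refl.
apply: gop_geqv; apply: gop_geqv; try exact: geqv_refl.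
- by apply: gpad_geqv; rewrite /= evalE n1.
- by apply: gpad_geqv; rewrite /= evalE n1.
Qed.

(** The choice is copied. For choice 0 both sides play [R] and [P] together; for choice 1 the game
    [R] is discarded. *)
Lemma red_umeet_or k (G : pred) (R P Q : ugame k) :
  representable R -> representable P -> representable Q ->
  red G (umeet (uop true R P) Q) (uop false (unot R) (umeet P Q)).
Proof.
move=> rR rP rQ; exists 1%N, [:: Var 0]; split=> // [M E [_ w]|].
  by move: w; rewrite /= eval_Var.
have rRP : representable (uop true R P) by exact: representable_op.
have dz := dec_zero.
have l1 := fun X (rX : representable X) => @rep_lift n k 1 X rX.
have main G0 : red G0
    (uop true (lift 1 R) (ucase (fun M e => e 0%N = 0) (lift 1 P) (lift 1 Q)))
    (ucase (fun M e => e 0%N = 0) (lift 1 (uop true R P)) (lift 1 Q)).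
  have rc := rep_case dz (l1 _ rP) (l1 _ rQ).
  apply: (red_case dz).
  - by apply: representable_op => //; exact: l1.
  - by apply: rep_case => //; exact: l1.
  - apply: red_trans (red_case_intro1 dz (l1 _ rRP) (l1 _ rQ) _).
      apply: (red_mono true (red_refl _ (l1 _ rR))).
      by apply: red_case_elim1 => //; [exact: l1|exact: l1|move=> M e []].
    by move=> M e [].
  - apply: red_trans (red_case_intro2 dz (l1 _ rRP) (l1 _ rQ) _).
      apply: red_trans (red_proj2 _ (l1 _ rR) rc) _.
      by apply: red_case_elim2 => //; [exact: l1|exact: l1|move=> M e []].
    by move=> M e [].
apply: red_ext (main _) => M E w; split; first exact: w; exact: geqv_refl.
Qed.

(** * Lattice rules that follow from contraction *)

Section Lattice.
Variable k : nat.

Definition contraction_at : Prop := forall (G : pred) (X : ugame k),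
  representable X -> flow G (uop false X X) X /\ flow G X (uop true X X).

Hypothesis contr : contraction_at.
Variable G : pred.
Implicit Types A B C : ugame k.

Lemma flow_refl A : representable A -> flow G A A.
Proof. by move=> rA; apply: flow_red => //; exact: red_refl. Qed.

Lemma flow_and A B C : representable A -> representable B -> representable C ->
  flow G A B -> flow G A C -> flow G A (uop true B C).
Proof.
move=> rA rB rC h1 h2; apply: flow_trans (proj2 (contr G rA)) _.
by apply: flow_trans (flow_opl true rA h1) (flow_opr true rB h2).
Qed.

Lemma flow_or A B C : representable A -> representable B -> representable C ->
  flow G A C -> flow G B C -> flow G (uop false A B) C.
Proof.
move=> rA rB rC h1 h2; apply: flow_trans _ (proj1 (contr G rC)).
by apply: flow_trans (flow_opl false rB h1) (flow_opr false rC h2).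
Qed.

Lemma flow_proj1 A B C : representable A -> representable B -> flow G A C ->
  flow G (uop true A B) C.
Proof. by move=> rA rB h; apply: flow_redl h; case: (red_proj G rA rB). Qed.

Lemma flow_proj2 A B C : representable A -> representable B -> flow G B C ->
  flow G (uop true A B) C.
Proof. by move=> rA rB h; apply: flow_redl h; exact: red_proj2. Qed.

Lemma flow_inj1 A B C : representable B -> representable C -> flow G A B ->
  flow G A (uop false B C).
Proof. by move=> rB rC h; apply: flow_redr h _; case: (red_proj G rB rC). Qed.

Lemma flow_inj2 A B C : representable B -> representable C -> flow G A C ->
  flow G A (uop false B C).
Proof. by move=> rB rC h; apply: flow_redr h _; exact: red_inj2. Qed.

Lemma flow_distr A B C : representable A -> representable B -> representable C ->
  flow G (uop true A (uop false B C)) (uop false (uop true A B) C).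
Proof.
move=> rA rB rC; apply: flow_red.
  by apply: representable_op => //; exact: representable_op.
apply: red_gle.
- by apply: representable_op => //; exact: representable_op.
- by apply: representable_op => //; exact: representable_op.
- by move=> M e _; case: (gop_distr (A M e) (B M e) (C M e)).
Qed.

Lemma flow_false A B : representable B ->
  flow G A (@uconst n k False) -> flow G A B.
Proof.
move=> rB h; apply: flow_redr h _.
by apply: (proj2 (red_pad G (fun _ _ => False) rB)) => M e _ [].
Qed.

Lemma flow_true A B : representable A ->
  flow G (@uconst n k True) B -> flow G A B.
Proof.
move=> rA h; apply: flow_redl h.
by apply: (proj1 (red_pad G (fun _ _ => True) rA)) => M e _.
Qed.

End Lattice.

Ltac reps := repeat first [ assumption | exact: rep_const | apply: representable_op
  | apply: rep_umeet | apply: rep_lift | apply: rep_not ].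

(* By induction on the number of quantifiers of [P].  If [P] is decidable, then the
   choice in [umeet P Q] can be computed; otherwise the chain decomposing [P]
   leaves one such choice for a simpler formula at each step. *)
Lemma decision k : contraction_at k -> forall N (P : ugame k), rep N P ->
  forall (G : pred) (Q : ugame k), representable Q ->
  flow G (umeet P Q) (unot (uop false P Q)).
Proof.
move=> contr; elim=> [|N IH] P rP G Q rQ; have RP : representable P by eexists; exact: rP.
all: have [[c dc hc]|[N' [Z [R [t [eN dt rZ rR h]]]]]] := decomposition rP => //.
1,2: have rc : representable (upad k c) by exact: representable_pad.
1,2: apply: flow_red; first by reps.
1,2: have rPQ : representable (uop false P Q) by reps.
1,2: apply: (red_case dc); [by reps|by reps| |].
1,3: apply: red_trans (red_umeet1 _ RP rQ) _; apply: red_not.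
1,2: apply: (@red_trans _ _ _ _ (upad k c));
  [by apply: (proj1 (red_pad _ c rPQ)) => M e []|
   by apply: red_geqv => // M e _; apply: geqv_sym; exact: hc].
1,2: apply: red_trans (red_umeet2 _ RP rQ) _; apply: red_not.
1,2: apply: (@red_trans _ _ _ _ (uop false (upad k c) Q));
  [by apply: red_mono (red_refl _ rQ); apply: red_geqv => // M e _; exact: hc|].
1,2: apply: red_trans (red_comm false _ rc rQ) _; apply: red_gle => //;
  [by reps|by move=> M e [_ hn]; exact: (proj2 (gle_pad _ (c M e)))].
have {eN}eN : N' = N by case: eN.
subst N'; have RR : representable R by exists N.
have rPl := rep_lift 1 RP; have rQl := rep_lift 1 rQ.
have dn := defe_next n.
have rZn : representable (next Z) by exact: rep_env.
have rZ0 : representable (at0 (fun _ _ => 0) Z) by apply: rep_env => //; defs.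
have rZt : representable (at0 t Z) by apply: rep_env => //; defs.
have wk G0 G1 (A B : ugame k) : (forall M e, G1 M e -> G0 M e) -> red G0 A B -> red G1 A B.
  by move=> hG; exact: red_weak.
case: h => [[h1 h2 h3 h4 _]|[h1 h2 h3 h4 _]].
(* The walk goes down from [t], where [Z] gives [P], to 0, where [Z] is trivial. The conjunct
   [P \/ Q] travels along because each step must provide [R \/ Q], and every instance [R] follows
   from [P]. *)
- pose Ri := uop true Z (uop false (lift 1 P) (lift 1 Q)).
  have rRi : representable Ri by rewrite /Ri; reps.
  have rR0 : representable (at0 (fun _ _ => 0) Ri) by apply: rep_env => //; defs.
  have rRn : representable (next Ri) by exact: rep_env.
  have st : flow G (umeet P Q) (umeet (at0 t Ri) Q).
    apply: umeet_intro; [by reps|by reps|by reps| |].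
      apply: flow_redl (red_umeet1 _ RP rQ) _; apply: flow_not.
      apply: (@flow_proj1 _ _ (at0 t Z) (uop false P Q)) => //; first by reps.
      by apply: flow_red => //; apply: wk h3.
    by apply: flow_red; [reps|exact: red_umeet2].
  apply: flow_trans st _.
  have en : flow G (umeet (at0 (fun _ _ => 0) Ri) Q) (unot (uop false P Q)).
    apply: flow_redl (red_umeet1 _ rR0 rQ) _; apply: flow_not.
    apply: (@flow_and _ contr G (uop false P Q) (at0 (fun _ _ => 0) Z) (uop false P Q));
      [by reps|by reps|by reps| |].
      apply: flow_true; first by reps.
      by apply: flow_red; [reps|apply: wk h1].
    by apply: flow_refl; reps.
  apply: flow_trans _ en.
  apply: (@flow_ind_down _ _ G (umeet Ri (lift 1 Q)) t dt); first by reps.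
  apply: (@umeet_intro _ _ (next (umeet Ri (lift 1 Q))) Ri (lift 1 Q));
    [by apply: rep_env => //; reps|by reps|by reps| |]; last first.
    by apply: flow_red; [apply: rep_env => //; reps|
      exact: (@red_umeet2 _ _ (next Ri) (lift 1 Q))].
  (* One step in outline: [Ri] and [R] together give the next [Ri], so the negation of the next one
     splits into the negation of [Ri] or a choice between [R] and [Q]. The induction hypothesis
     settles that choice, and [Ri] itself refutes the outcome. *)
  have s1 : flow (below G t) (next (umeet Ri (lift 1 Q)))
      (umeet (uop true Ri R) (lift 1 Q)).
    apply: (@umeet_intro _ _ (umeet (next Ri) (lift 1 Q)));
      [by reps|by reps|by reps| |].
      apply: flow_redl (red_umeet1 _ rRn rQl) _; apply: flow_not.
      apply: (@flow_and _ contr _ (uop true Ri R) (next Z)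
        (uop false (lift 1 P) (lift 1 Q))); [by reps|by reps|by reps| |].
        apply: (@flow_trans _ _ _ _ (uop true Z R)).
          apply: flow_and => //; [by reps|..].
            by apply: flow_proj1 => //; apply: flow_proj1; reps; exact: flow_refl.
          by apply: flow_proj2 => //; exact: flow_refl.
        by apply: flow_red; [reps|apply: wk h2 => M e []].
      apply: flow_proj1 => //; apply: flow_proj2; [by reps|by reps|].
      by apply: flow_refl; reps.
    by apply: flow_red; [reps|exact: red_umeet2].
  apply: flow_trans s1 _.
  apply: (@flow_trans _ _ _ _ (uop false (unot Ri) (umeet R (lift 1 Q)))).
    by apply: flow_red; [reps|exact: red_umeet_or].
  have s3 : flow (below G t) (uop false (unot Ri) (umeet R (lift 1 Q)))
      (uop false (unot Ri) (unot (uop false R (lift 1 Q)))).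
    by apply: flow_opr; [reps|exact: IH].
  apply: flow_trans s3 _.
  apply: (@flow_not _ _ _ Ri (uop true Ri (uop false R (lift 1 Q)))).
  apply: flow_and => //; [by reps|by apply: flow_refl|].
  apply: flow_proj2; [by reps|by reps|].
  apply: flow_opl => //; apply: flow_red => //; apply: wk h4 => M e [] //.
(* The walk goes up: [Z] is false at 0 and follows from [P] at [t]. In each step the negation of [P]
   yields that of the instance [R], and the induction hypothesis merges it with the negation of
   [Z \/ Q]. *)
- pose K := umeet (lift 1 P) (uop false Z (lift 1 Q)).
  have rK : representable K by rewrite /K; reps.
  have rt : representable (uop false (at0 t Z) Q) by reps.
  have st : flow G (umeet P Q) (umeet P (uop false (at0 (fun _ _ => 0) Z) Q)).
    apply: umeet_intro; [by reps|by reps|by reps| |].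
      by apply: flow_red; [reps|exact: red_umeet1].
    apply: flow_redl (red_umeet2 _ RP rQ) _; apply: flow_not.
    apply: flow_or => //; last exact: flow_refl.
    by apply: flow_false => //; apply: flow_red => //; apply: wk h1.
  apply: flow_trans st _.
  have en : flow G (umeet P (uop false (at0 t Z) Q)) (unot (uop false P Q)).
    apply: flow_redl (red_umeet2 _ RP rt) _; apply: flow_not.
    by apply: flow_opl => //; apply: flow_red => //; apply: wk h3.
  apply: flow_trans _ en.
  apply: (@flow_ind _ _ G K t dt rK).
  have rn : representable (uop false (next Z) (lift 1 Q)) by reps.
  apply: (@umeet_intro _ _ K (lift 1 P) (uop false (next Z) (lift 1 Q)));
    [by []|by []|by []| |].
    by apply: flow_red => //; apply: red_umeet1; reps.
  have rZQ : representable (uop false Z (lift 1 Q)) by reps.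
  apply: (@flow_trans _ _ _ _ (umeet R (uop false Z (lift 1 Q)))).
    apply: umeet_intro => //.
      apply: flow_redl (red_umeet1 _ rPl rZQ) _; apply: flow_not.
      by apply: flow_red => //; apply: wk h4 => M e [].
    by apply: flow_red => //; exact: red_umeet2.
  apply: flow_trans (IH _ rR _ _ rZQ) _; apply: flow_not.
  apply: (@flow_trans _ _ _ _ (uop false (uop false Z R) (lift 1 Q))).
    by apply: flow_opl => //; apply: flow_red => //; apply: wk h2 => M e [].
  apply: flow_or => //; [by reps|by reps| |].
    apply: flow_or => //; [by reps| |].
      by apply: flow_inj2 => //; apply: flow_inj1 => //; exact: flow_refl.
    by apply: flow_inj1 => //; exact: flow_refl.
  by apply: flow_inj2 => //; apply: flow_inj2 => //; exact: flow_refl.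
Qed.

Lemma red_block_elim k ps (G : pred) (C : ugame k) : representable C ->
  red (inblock ps G) (lift (size ps) (ublock ps C)) (unot C).
Proof.
move=> rC; exists 0%N, (mkseq Var (size ps)); split=> // [M E [[_ w] _]|].
  by rewrite map_eval_Var.
apply: red_ext (red_refl (within 0 (inblock ps G) (unot C)) rC) => M E w; split=> //.
  exact: geqv_refl.
by rewrite /ucontf map_eval_Var /lift /= ecat_take_drop; exact: geqv_refl.
Qed.

(** With [X] the universal closure of the negation of [C]: merging [X \/ X] needs only the
    duplication of [C] one level below. Duplicating [X] faces two independent moves and the negation
    of [C1 \/ C2]; both negations are available separately, [umeet] offers a choice between them,
    and [decision] makes it. *)
Lemma contraction k : contraction_at k.
Proof.
elim: k => [|k IH] G X rX.
  split; apply: flow_red; [by reps| |by []|].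
  - by move=> M e _; rewrite /uop /=; case.
  - by move=> M e _; rewrite /uop /=.
have [N [ps [C [N' [_ rC hX]]]]] := rX.
have RC : representable C by exists N'.
pose B := ublock ps C; have rB : representable B by exact: representable_block.
have XB G0 : red G0 X B by apply: red_geqv.
have BX G0 : red G0 B X.
  by apply: red_geqv => // M e _; apply: geqv_sym; exact: hX.
split.
- apply: flow_redr _ (BX G); apply: flow_redl (red_mono false (XB G) (XB G)) _.
  apply: flow_forall => //.
  have h := red_block_elim ps G RC.
  apply: flow_redl (red_mono false h h) _.
  exact: (@flow_not _ _ _ C (uop true C C) (proj2 (IH _ _ RC))).
- apply: flow_redr _ (red_mono true (BX G) (BX G)); apply: flow_redl (XB G) _.
  pose l := size ps.
  pose us1 : transformer n := fun M E =>
    ecat (mkseq (fun i => E i) l) (edrop (l + l) E).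
  have dus1 : defe us1 by apply: defe_ecat; [move=> i; defs|defs].
  have dus2 : defe (fun (M : pvmodel n) (E : nat -> M) => edrop l E) by defs.
  pose C1 : ugame k := fun M E => C M (us1 M E).
  pose C2 : ugame k := fun M E => C M (edrop l E).
  have rC1 : rep N' C1 by exact: rep_env_count.
  have rC2 : representable C2 by exact: rep_env dus2 RC.
  have RC1 : representable C1 by exists N'.
  have r12 : representable (uop false C1 C2) by reps.
  apply: (@flow_redr _ _ _ _ (ublock (ps ++ ps) (uop false C1 C2))); last first.
    apply: red_geqv; [exact: representable_block|by reps|move=> M e _].
    split=> [|us]; first by rewrite /= map_cat.
    move=> hs0; have hs : size us = (l + l)%N.
      by move: hs0; rewrite /= size_map size_cat.
    have st : size (take l us) = l by rewrite size_takel // hs leq_addr.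
    have f1 : edrop (l + l) (ecat us e) = e by rewrite -hs edrop_ecat.
    have f2 : etake l (ecat us e) = take l us.
      by rewrite -{1}(cat_take_drop l us) ecat_cat -{1}st etake_ecat.
    have f3 : edrop l (ecat us e) = ecat (drop l us) e.
      by rewrite -{1}(cat_take_drop l us) ecat_cat -{1}st edrop_ecat.
    apply: gop_geqv; rewrite [size _]/= size_map.
    + by rewrite /C1 /us1 -[mkseq _ _]/(etake l _) f1 f2; exact: geqv_refl.
    + by rewrite /C2 f3; exact: geqv_refl.
  apply: flow_forall => //.
  have dll (M : pvmodel n) (E : nat -> M) : edrop l (edrop l E) = edrop (l + l) E.
    by apply: functional_extensionality => i; rewrite /edrop addnA.
  have inb (M : pvmodel n) (E : nat -> M) : inblock (ps ++ ps) G E ->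
      [/\ G M (edrop (l + l) E),
        vles (etake l E) (map (eval (edrop (l + l) E)) ps) &
        vles (etake l (edrop l E)) (map (eval (edrop (l + l) E)) ps)].
    rewrite /inblock size_cat -/l => -[g]; rewrite etake_cat map_cat.
    by case/vles_cat; rewrite ?etake_size ?size_map.
  have h1 : red (inblock (ps ++ ps) G) (lift (size (ps ++ ps)) B) (unot C1).
    apply: (red_env dus1 (red_block_elim ps G RC)) => M E /inb[g w1 w2].
    have f1 : edrop l (us1 M E) = edrop (l + l) E by rewrite /us1 insert_drop.
    have f2 : etake l (us1 M E) = etake l E by rewrite /us1 insert_take.
    split=> //; first by rewrite /inblock -/l f1 f2.
    by rewrite /lift -/l f1 size_cat.
  have h2 : red (inblock (ps ++ ps) G) (lift (size (ps ++ ps)) B) (unot C2).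
    apply: (red_env dus2 (red_block_elim ps G RC)) => M E /inb[g w1 w2].
    split=> //; first by rewrite /inblock -/l dll.
    by rewrite /lift -/l dll size_cat.
  apply: flow_trans _ (decision IH rC1 _ rC2).
  by apply: umeet_intro; [reps|..]; reps; apply: flow_red; reps.
Qed.

End Contraction.

(** * Entailment by flows *)

Ltac reps := repeat first [ assumption | exact: rep_const | apply: representable_op
  | apply: rep_umeet | apply: rep_lift | apply: rep_not ].

Section Rules.
Variable n : nat.
Notation pred := (pred n).
Notation ugame := (ugame n).
Notation value := (value n).
Notation always := (@always n).
Implicit Type k : nat.

(** Contraction enters twice, once to duplicate [A] and once to merge two copies of [B]; linear
    distributivity moves the cut game [C] from one side to the other. *)
Lemma flow_cut k (G : pred) (A B C : ugame k) :
  representable A -> representable B -> representable C ->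
  flow G (uop true A C) B -> flow G A (uop false B C) -> flow G A B.
Proof.
move=> rA rB rC h1 h2; have ct := @contraction n k.
apply: (@flow_trans _ _ _ _ (uop true A (uop false C B))).
  apply: flow_and => //; [by reps|exact: flow_refl|].
  by apply: flow_redr h2 _; exact: red_comm.
apply: flow_trans (flow_distr G rA rC rB) _.
by apply: flow_or => //; [reps|exact: flow_refl].
Qed.

(** Right rule for a bounded universal quantifier. [H i] keeps [A] for the remaining instances and
    asserts [B] or the part of [C] below [i]; a step adds one instance. *)
Lemma flow_all_right k (A B C Z P : ugame k) (t : value) :
  representable A -> representable B -> representable C -> representable Z ->
  representable P -> defv t -> all_chain C Z P t ->
  flow (below always t) (lift 1 A) (uop false (lift 1 B) P) ->
  flow always A (uop false B C).
Proof.
move=> rA rB rC rZ rP dt [h1 h2 h3 h4 _] h; have ct := @contraction n k.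
have rZ0 : representable (at0 (fun _ _ => 0) Z) by apply: rep_env => //; defs.
have rZt : representable (at0 t Z) by apply: rep_env => //; defs.
have rZn : representable (next Z) by exact: rep_env (defe_next n) rZ.
have rAl := rep_lift 1 rA; have rBl := rep_lift 1 rB.
pose H := uop true (lift 1 A) (uop false (lift 1 B) Z).
apply: (@flow_trans _ _ _ _ (at0 (fun _ _ => 0) H)).
  apply: (@flow_and _ _ ct _ A A (uop false B (at0 (fun _ _ => 0) Z)));
    [by []|by []|by reps|exact: flow_refl|].
  apply: flow_inj2 => //; apply: flow_true => //; apply: flow_red => //.
  exact: rep_const.
apply: (@flow_trans _ _ _ _ (at0 t H)); last first.
  apply: (@flow_proj2 _ _ _ A (uop false B (at0 t Z))) => //; first by reps.
  by apply: flow_opr => //; apply: flow_red.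
apply: flow_ind => //; first by rewrite /H; reps.
apply: (@flow_and _ _ ct _ H (lift 1 A) (uop false (lift 1 B) (next Z)));
  [by rewrite /H; reps|by []|by reps| |].
  by apply: flow_proj1 => //; [reps|exact: flow_refl].
have rBP : representable (uop false (lift 1 B) P) by reps.
have rBZ : representable (uop false (lift 1 B) Z) by reps.
apply: (@flow_trans _ _ _ _ (uop true (uop false (lift 1 B) Z) (uop false (lift 1 B) P))).
  apply: flow_and => //; first by rewrite /H; reps.
    by apply: flow_proj2 => //; exact: flow_refl.
  exact: flow_proj1.
have rZP : representable (uop true Z P) by reps.
apply: (@flow_trans _ _ _ _ (uop false (lift 1 B) (uop true Z P))); last first.
  by apply: flow_opr => //; apply: flow_red.
have rBZ' : representable (uop true (uop false (lift 1 B) Z) P) by reps.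
apply: (@flow_trans _ _ _ _ (uop false (uop true (uop false (lift 1 B) Z) P) (lift 1 B))).
  apply: (@flow_trans _ _ _ _ (uop true (uop false (lift 1 B) Z) (uop false P (lift 1 B)))).
    by apply: flow_opr => //; apply: flow_red => //; exact: red_comm.
  exact: flow_distr.
apply: flow_or => //; [by reps| |]; last first.
  by apply: flow_inj1 => //; exact: flow_refl.
apply: flow_red => //; apply: red_gle => //; first by reps.
by move=> M e _; case: (gop_distr (lift 1 B e) (Z M e) (P M e)).
Qed.

(** Left rule for a bounded existential quantifier. The walk goes down: [H i] asserts [B], or [A]
    together with a witness below [i]; a step removes one possible witness at the price of [B]. *)
Lemma flow_ex_left k (A B C Z P : ugame k) (t : value) :
  representable A -> representable B -> representable C -> representable Z ->
  representable P -> defv t -> ex_chain C Z P t ->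
  flow (below always t) (uop true (lift 1 A) P) (lift 1 B) ->
  flow always (uop true A C) B.
Proof.
move=> rA rB rC rZ rP dt [h1 h2 h3 h4 _] h; have ct := @contraction n k.
have rZ0 : representable (at0 (fun _ _ => 0) Z) by apply: rep_env => //; defs.
have rZt : representable (at0 t Z) by apply: rep_env => //; defs.
have rZn : representable (next Z) by exact: rep_env (defe_next n) rZ.
have rAl := rep_lift 1 rA; have rBl := rep_lift 1 rB.
pose H := uop false (uop true (lift 1 A) Z) (lift 1 B).
apply: (@flow_trans _ _ _ _ (at0 t H)).
  apply: (@flow_inj1 _ _ _ _ (uop true A (at0 t Z)) B) => //; first by reps.
  by apply: flow_opr => //; apply: flow_red.
apply: (@flow_trans _ _ _ _ (at0 (fun _ _ => 0) H)); last first.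
  apply: (@flow_or _ _ ct _ (uop true A (at0 (fun _ _ => 0) Z)) B) => //;
    [by reps| |exact: flow_refl].
  by apply: flow_proj2 => //; apply: flow_false => //; apply: flow_red.
have rAZ : representable (uop true (lift 1 A) Z) by reps.
have rAZn : representable (uop true (lift 1 A) (next Z)) by reps.
have rH : representable H by rewrite /H; reps.
apply: flow_ind_down => //.
apply: (@flow_or _ _ ct _ (uop true (lift 1 A) (next Z)) (lift 1 B)) => //; last first.
  by apply: flow_inj2 => //; exact: flow_refl.
have rAP : representable (uop true (lift 1 A) P) by reps.
have rZP : representable (uop false Z P) by reps.
apply: (@flow_trans _ _ _ _ (uop true (lift 1 A) (uop false Z P))).
  by apply: flow_opr => //; apply: flow_red.
have rAZP : representable (uop true (lift 1 A) (uop false Z P)) by reps.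
apply: (@flow_trans _ _ _ _ (uop true (lift 1 A) (uop false (uop true (lift 1 A) Z) P))).
  apply: flow_and => //; [by reps| |exact: flow_distr].
  by apply: flow_proj1 => //; exact: flow_refl.
apply: (@flow_trans _ _ _ _ (uop true (lift 1 A) (uop false P (uop true (lift 1 A) Z)))).
  by apply: flow_opr => //; apply: flow_red; [reps|exact: red_comm].
apply: flow_trans (flow_distr _ rAl rP rAZ) _.
apply: flow_or => //.
  by apply: flow_inj2.
by apply: flow_inj1 => //; exact: flow_refl.
Qed.

(** Induction rule with side games: [A] is repeated for later steps, and [B], once reached, is kept
    until the end. *)
Lemma flow_induction k (A B D : ugame k) (t : value) :
  representable A -> representable B -> representable D -> defv t ->
  flow (below always t) (uop true (lift 1 A) D) (uop false (lift 1 B) (next D)) ->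
  flow always (uop true A (at0 (fun _ _ => 0) D)) (uop false B (at0 t D)).
Proof.
move=> rA rB rD dt h; have ct := @contraction n k.
have rD0 : representable (at0 (fun _ _ => 0) D) by apply: rep_env => //; defs.
have rDt : representable (at0 t D) by apply: rep_env => //; defs.
have rDn : representable (next D) by exact: rep_env (defe_next n) rD.
have rAl := rep_lift 1 rA; have rBl := rep_lift 1 rB.
have rDB : representable (uop false D (lift 1 B)) by reps.
pose H := uop true (lift 1 A) (uop false D (lift 1 B)).
have rH : representable H by rewrite /H; reps.
apply: (@flow_trans _ _ _ _ (at0 (fun _ _ => 0) H)).
  apply: (@flow_opr _ _ _ _ A _ (uop false (at0 (fun _ _ => 0) D) B)) => //.
  by apply: flow_inj1 => //; exact: flow_refl.
apply: (@flow_trans _ _ _ _ (at0 t H)); last first.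
  apply: (@flow_proj2 _ _ _ A (uop false (at0 t D) B)) => //; first by reps.
  by apply: flow_red; [reps|exact: red_comm].
apply: flow_ind => //.
have rDnB : representable (uop false (next D) (lift 1 B)) by reps.
apply: (@flow_and _ _ ct _ H (lift 1 A) (uop false (next D) (lift 1 B))) => //.
  by apply: flow_proj1 => //; exact: flow_refl.
have rAD : representable (uop true (lift 1 A) D) by reps.
apply: flow_trans (flow_distr _ rAl rD rBl) _.
apply: flow_or => //; last by apply: flow_inj2 => //; exact: flow_refl.
by apply: flow_redr h _; exact: red_comm.
Qed.

(** * Fresh variables *)

Definition agree (M : pvmodel n) N (e e' : nat -> M) : Prop :=
  forall i, (i < N)%N -> e i = e' i.

Lemma value_fresh (f : value) : defv f ->
  exists N, forall (M : pvmodel n) (e e' : nat -> M), agree N e e' -> f M e = f M e'.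
Proof.
move=> [t ht]; have [N hN] := eval_fresh t; exists N => M e e' h.
rewrite !ht (hN N) // [RHS](hN N) //; congr eval; congr ecat.
apply: (@eq_from_nth _ (e 0%N)); rewrite ?etake_size // => i hi.
by rewrite !nth_mkseq // h.
Qed.

Lemma pred_fresh (c : pred) : decidable c -> exists N,
  forall (M : pvmodel n) (e e' : nat -> M), agree N e e' -> c M e <-> c M e'.
Proof.
move=> [t ht]; have [|N hN] := @value_fresh (fun M e => eval e t); first by exists t.
by exists N => M e e' h; rewrite !ht (hN _ _ _ h).
Qed.

Lemma agree_le (M : pvmodel n) N N' (e e' : nat -> M) : (N <= N')%N ->
  agree N' e e' -> agree N e e'.
Proof. by move=> h h' i hi; apply: h'; exact: leq_trans hi h. Qed.

Lemma game_fresh k (X : ugame k) : representable X -> exists N,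
  forall (M : pvmodel n) (e e' : nat -> M), agree N e e' -> geqv (X M e) (X M e').
Proof.
elim: k X => [|k IH] X [m rX]; first exact: pred_fresh.
move: rX => [ps [C [m' [_ rC hX]]]].
have [N1 h1] := IH C (ex_intro _ m' rC).
have [N2 h2] : exists N, forall (M : pvmodel n) (e e' : nat -> M), agree N e e' ->
    map (eval e) ps = map (eval e') ps.
  elim: ps {hX} => [|p ps [N hN]]; first by exists 0%N.
  have [|N' hN'] := @value_fresh (fun M e => eval e p); first by exists p.
  exists (maxn N N') => M e e' h /=.
  by rewrite (hN' _ _ _ (agree_le (leq_maxr _ _) h))
    (hN _ _ _ (agree_le (leq_maxl _ _) h)).
exists (maxn N1 N2) => M e e' h.
apply: geqv_trans (hX M e) (geqv_trans _ (geqv_sym (hX M e'))).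
split; first by apply: h2; apply: agree_le h; exact: leq_maxr.
move=> us _; apply: h1 => i hi; rewrite !(ecat_nth (e 0%N)).
case: ltnP => // hs; apply: h; rewrite leq_max.
by rewrite (leq_ltn_trans (leq_subr _ _) hi).
Qed.

(** The eigenvariable argument: beyond all variables that matter, [N] can be renamed to the new
    position 0 while the other variables are shifted. *)
Lemma fresh_flow k (A B X Y : ugame k) :
  representable A -> representable B -> representable X -> representable Y ->
  exists N,
  flow always (uop true A (fun M e => X M (econs (e N) e)))
    (uop false B (fun M e => Y M (econs (e N) e))) ->
  flow always (uop true (lift 1 A) X) (uop false (lift 1 B) Y).
Proof.
move=> rA rB rX rY.
have [a ha] := game_fresh rA; have [b hb] := game_fresh rB.
have [x hx] := game_fresh rX; have [y hy] := game_fresh rY.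
pose N := maxn (maxn a b) (maxn x y); exists N => h.
pose s : transformer n := fun M E => fun i => if i == N then E 0%N else E i.+1.
have ds : defe s.
  exists (fun i => if i == N then Var 0 else Var i.+1) => M E.
  by apply: functional_extensionality => i; rewrite /s; case: eqP.
have h' : flow always (fun M E => uop true A (fun M e => X M (econs (e N) e)) (s M E))
    (fun M E => uop false B (fun M e => Y M (econs (e N) e)) (s M E)).
  exact: (flow_env ds h).
have dN : @defe n (fun M e => econs (s M e N) (s M e)).
  by apply: defe_cons => //; exact: defv_nth.
have s1 (M : pvmodel n) (E : nat -> M) m : (m <= N)%N -> agree m (s M E) (edrop 1 E).
  by move=> hm i hi; rewrite /s; case: eqP => // e; move: hi; rewrite e ltnNge hm.
have s2 (M : pvmodel n) (E : nat -> M) m : (m <= N)%N ->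
    agree m (econs (s M E N) (s M E)) E.
  move=> hm [|i] hi /=; first by rewrite /s eqxx.
  rewrite /s; case: eqP => // e; move: (ltnW hi); by rewrite e ltnNge hm.
apply: (@flow_redl _ _ _ _ (fun M E => uop true A (fun M e => X M (econs (e N) e)) (s M E))).
  apply: red_geqv => [||M E _]; first by reps.
    by apply: representable_op; [exact: rep_env|exact: (rep_env dN rX)].
  apply: gop_geqv; apply: geqv_sym; [apply: ha; apply: s1|apply: hx; apply: s2].
    by rewrite /N !leq_max leqnn.
  by rewrite /N !leq_max leqnn !orbT.
apply: flow_redr h' _; apply: red_geqv => [||M E _]; [|by reps|].
  by apply: representable_op; [exact: rep_env|exact: (rep_env dN rY)].
apply: gop_geqv; [apply: hb; apply: s1|apply: hy; apply: s2];
by rewrite /N !leq_max leqnn !orbT.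
Qed.

(** * Games of prenex formulas *)

(** For [pi] false the game is that of the negation of the Sigma_k formula, so both classes are
    represented by games of the same shape. *)
Fixpoint interp k (pi : bool) : prenex n k -> ugame k :=
  if k is j.+1 return prenex n k -> ugame k then
    fun A => ublock A.1 (interp (~~ pi) A.2)
  else fun A M e => if pi then sat e A else ~ sat e A.

Fixpoint count_vars k : prenex n k -> nat :=
  if k is j.+1 return prenex n k -> nat then
    fun A => (size A.1 + count_vars A.2)%N
  else fun _ => 0%N.

Lemma rep_interp k pi (A : prenex n k) : hatPi A -> rep (count_vars A) (interp pi A).
Proof.
elim: k pi A => [|k IH] pi A hA.
  have h := decidable_sharply_bounded hA.
  by case: pi => //=; exact: decidable_not.
exists A.1, (interp (~~ pi) A.2), (count_vars A.2); split=> //; first exact: IH.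
by move=> M e; exact: geqv_refl.
Qed.

(** A decidable predicate is an equation with 0, hence every representable game is the game of a
    formula. This is why enumerating formulas reaches all games, without increasing the number of
    quantifiers. *)
Lemma rep_prenex k N pi (X : ugame k) : rep N X -> exists A : prenex n k,
  [/\ hatPi A, (count_vars A <= N)%N & forall M e, geqv (X M e) (interp pi A e)].
Proof.
elim: k N pi X => [|k IH] N pi X.
  move=> [t ht]; case: pi.
    exists (Eq t 0%pv); split=> //; first by constructor.
    by move=> M e; apply: iff_trans (ht M e) _; rewrite /= evalE.
  exists (Imp (Eq t 0%pv) Bot); split=> //.
    by apply: sb_imp; [exact: sb_eq|exact: sb_bot].
  move=> M e; apply: iff_trans (ht M e) _; rewrite /= evalE.
  by split=> [h h'|/NNPP].
move=> [ps [C [N' [-> rC hX]]]].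
have [A [hA hN hC]] := IH _ (~~ pi) _ rC.
exists (ps, A); split=> //=; first by rewrite leq_add2l.
move=> M e; apply: geqv_trans (hX M e) _; split=> // us _; exact: hC.
Qed.

Lemma representable_interp k pi (A : prenex n k) : hatPi A ->
  representable (interp pi A).
Proof. by move=> h; exists (count_vars A); exact: rep_interp. Qed.

Lemma sat_block (M : pvmodel n) (e : nat -> M) ps A :
  (sat e (block (@ball n) ps A) <->
    forall us, vles us (map (eval e) ps) -> sat (ecat us e) A) /\
  (sat e (block (@bex n) ps A) <->
    exists2 us, vles us (map (eval e) ps) & sat (ecat us e) A).
Proof.
elim: ps A => [|p ps IH] A /=.
  split; split=> [h|h].
  - by move=> us hus; inversion hus.
  - by apply: (h [::]); constructor.
  - by exists [::] => //; constructor.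
  - by case: h => us hus; inversion hus.
have ev us d : vles us (map (eval e) ps) ->
    eval (econs d (ecat us e)) (tshift 1 (tshift (size ps) p)) = eval e p.
  move=> hus; have := vles_size hus; rewrite size_map => hs.
  by rewrite eval_tshift edrop_econs eval_tshift -hs edrop_ecat.
split.
- apply: iff_trans (proj1 (IH _)) _; split=> [h us hus|h us hus d].
  + inversion hus; subst; apply: (h l H3); by rewrite ?evalE ev.
  + rewrite /= ev // => hd; apply: (h (d :: us)); by constructor.
- apply: iff_trans (proj2 (IH _)) _; split=> [[us hus [d [hd hA]]]|[us hus hA]].
  + by exists (d :: us) => //; constructor=> //; rewrite -(ev us d).
  + inversion hus; subst; exists l => //; exists x; split=> //.
    by rewrite /= ev.
Qed.

Lemma gval_interp (M : pvmodel n) k pi (A : prenex n k) (e : nat -> M) :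
  gval (interp pi A e) <->
  if pi then sat e (pform true A) else ~ sat e (pform false A).
Proof.
elim: k pi A e => [|k IH] pi A e; first by case: pi.
have [h1 h2] := sat_block e A.1 (pform (~~ pi) A.2).
case: pi h1 h2 => h1 h2; rewrite [pform _ _]/=.
- apply: iff_trans _ (iff_sym h1); split=> h us hus.
    by apply: NNPP => hn; apply: (h us hus); apply/IH.
  by move=> /IH /=; apply; exact: h.
- split=> [h /h2[us hus hA]|h us hus].
    by apply: (h us hus); apply/IH.
  by move=> /IH /= hA; apply: h; apply/h2; exists us.
Qed.

Lemma red_sound k (G : pred) (X Y : ugame k) : red G X Y ->
  forall (M : pvmodel n) e, G M e -> gval (X M e) -> gval (Y M e).
Proof.
elim: k G X Y => [|k IH] G X Y; first by move=> h M e; exact: h.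
move=> [l [f [hl hf h]]] M e g hX us hus hY.
have hs : size us = l by rewrite (vles_size hus) hl.
have w : within l G Y (ecat us e).
  by rewrite /within -hs edrop_ecat etake_ecat.
have := hf _ _ w; rewrite -{1}hs edrop_ecat => /hX; apply.
have := IH _ _ _ h _ _ w; rewrite /ucont /ucontf -{1 2 3}hs edrop_ecat etake_ecat.
exact.
Qed.

End Rules.

(** * Completeness of flows *)

Section Generic.
Variables (n k : nat).
Notation pred := (pred n).
Notation ugame := (ugame n).
Notation value := (value n).
Notation always := (@always n).
Implicit Types A B X Y : ugame k.

Let ct := @contraction n k.

Definition upair : Type := (ugame k * ugame k)%type.

Definition unprovable (c : upair) : Prop :=
  [/\ representable c.1, representable c.2 & ~ flow always c.1 c.2].

Definition extends (c d : upair) : Prop :=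
  flow always d.1 c.1 /\ flow always c.2 d.2.

Definition ult (v t : value) : ugame k := upad k (fun M e => v M e < t M e).

Lemma rep_ult v t : defv v -> defv t -> representable (ult v t).
Proof. by move=> dv dt; apply: representable_pad; apply: dec_le; defs. Qed.

(* [c] settles [C], with a term as witness for the outermost quantifier (in [P])
   when [C] is put on the side where it needs one. *)
Definition decides (C : prenex n k) (c : upair) : Prop :=
  hatPi C ->
  (flow always c.1 (interp true C) \/ flow always (interp true C) c.2) /\
  (flat (interp true C) \/ exists N Z P t, [/\ (N < count_vars C)%N, defv t, rep N P &
    (all_chain (interp true C) Z P t /\ (flow always c.1 (interp true C) \/
       exists v, [/\ defv v, flow always c.1 (ult v t) & flow always (at0 v P) c.2]))
    \/
    (ex_chain (interp true C) Z P t /\ (flow always (interp true C) c.2 \/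
       exists v, [/\ defv v, flow always c.1 (ult v t) & flow always c.1 (at0 v P)]))]).

(** The three ways in which induction for [C] up to [T] can be respected: [C] fails at 0, holds at
    [T], or holds at some [v] and fails at [v + 1]. *)
Definition inductive_at (C : prenex n k) (T : term n) (c : upair) : Prop :=
  hatPi C ->
  [\/ flow always (at0 (fun _ _ => 0) (interp true C)) c.2,
      flow always c.1 (at0 (fun M e => eval e T) (interp true C)) |
      exists v, [/\ defv v, flow always c.1 (at0 v (interp true C)) &
        flow always (at0 (fun M e => v M e + 1) (interp true C)) c.2]].

Lemma extends_refl c : unprovable c -> extends c c.
Proof. by move=> [r1 r2 _]; split; exact: flow_refl. Qed.

Lemma extends_trans c d f : extends c d -> extends d f -> extends c f.
Proof. by move=> [h1 h2] [h3 h4]; split; [exact: flow_trans h3 h1|exact: flow_trans h2 h4]. Qed.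

Lemma decides_mono C c d : extends c d -> decides C c -> decides C d.
Proof.
move=> [h1 h2] h hC; case: (h hC) => hd hw; split.
  by case: hd => hd; [left; exact: flow_trans h1 hd|right; exact: flow_trans hd h2].
case: hw => [|[N [Z [P [t [hN dt rP hw]]]]]]; [by left|right].
exists N, Z, P, t; split=> //; case: hw => -[hw hv]; [left|right]; split=> //.
- case: hv => [hv|[v [dv v1 v2]]]; [left; exact: flow_trans h1 hv|right].
  by exists v; split=> //; [exact: flow_trans h1 v1|exact: flow_trans v2 h2].
- case: hv => [hv|[v [dv v1 v2]]]; [left; exact: flow_trans hv h2|right].
  by exists v; split=> //; [exact: flow_trans h1 v1|exact: flow_trans h1 v2].
Qed.

Lemma ext_right A B X : representable A -> representable B -> representable X ->
  ~ flow always A (uop false B X) ->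
  unprovable (A, uop false B X) /\ extends (A, B) (A, uop false B X).
Proof.
move=> rA rB rX h; split; first by split=> //=; reps.
by split; [exact: flow_refl|apply: flow_inj1 => //; exact: flow_refl].
Qed.

Lemma ext_left A B X : representable A -> representable B -> representable X ->
  ~ flow always (uop true A X) B ->
  unprovable (uop true A X, B) /\ extends (A, B) (uop true A X, B).
Proof.
move=> rA rB rX h; split; first by split=> //=; reps.
by split; [apply: flow_proj1 => //; exact: flow_refl|exact: flow_refl].
Qed.

Let dvar i : @defv n (fun M e => e i). Proof. by defs. Qed.

Lemma fresh_extension A B X Y : representable A -> representable B ->
  representable X -> representable Y ->
  ~ flow always (uop true (lift 1 A) X) (uop false (lift 1 B) Y) ->
  exists v, let d := (uop true A (at0 v X), uop false B (at0 v Y)) in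
    [/\ defv v, unprovable d, extends (A, B) d &
     flow always d.1 (at0 v X) /\ flow always (at0 v Y) d.2].
Proof.
move=> rA rB rX rY h; have [N hN] := fresh_flow rA rB rX rY.
have rXv : representable (at0 (fun M e => e N) X) by exact: rep_env (defe_at (dvar N)) rX.
have rYv : representable (at0 (fun M e => e N) Y) by exact: rep_env (defe_at (dvar N)) rY.
exists (fun M e => e N); split=> //; split=> //=.
- by reps.
- by reps.
- by move=> /hN.
- by apply: flow_proj1 => //; exact: flow_refl.
- by apply: flow_inj1 => //; exact: flow_refl.
- by apply: flow_proj2 => //; exact: flow_refl.
- by apply: flow_inj2 => //; exact: flow_refl.
Qed.

Definition ult0 (t : value) : ugame k :=
  upad k (fun M e => e 0%N < t M (edrop 1 e)).

Lemma rep_ult0 t : defv t -> representable (ult0 t).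
Proof.
move=> dt; apply: representable_pad; apply: dec_le; first by defs.
by apply: defv_comp dt _; defs.
Qed.

(** Generic pairs are about flows without a guard, so the condition that the time is below [t] is
    turned into a conjunct on the left. *)
Lemma flow_below t A X Y : defv t -> representable A -> representable X ->
  flow always (uop true (lift 1 A) (uop true (ult0 t) X)) Y ->
  flow (below always t) (uop true (lift 1 A) X) Y.
Proof.
move=> dt rA rX h; have ru := rep_ult0 dt; have rAl := rep_lift 1 rA.
apply: (@flow_trans _ _ _ _ (uop true (lift 1 A) (uop true (ult0 t) X))).
  apply: flow_opr => //; apply: flow_red => //; apply: red_and_pad => //.
    by apply: dec_le; [defs|apply: defv_comp dt _; defs].
  by move=> M e [].
exact: flow_weak h.
Qed.

(** If [X] cannot be added on the right, then by cut it can be added on the left. A fresh [v] below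
    [t] may then be taken as counterexample or witness: a flow for the extended pair would, by
    [flow_all_right] or [flow_ex_left] and contraction, give one for the pair before. *)
Lemma decides_dense C c : unprovable c -> exists d,
  [/\ unprovable d, extends c d & decides C d].
Proof.
move=> hc; case: (classic (hatPi C)) => hC; last first.
  by exists c; split=> //; exact: extends_refl.
case: c hc => A B /= hc; have [rA rB /= hAB] := hc.
pose X := interp true C; have rX : representable X by exact: representable_interp.
have flow0 G Y : representable Y -> flow G Y Y by exact: flow_refl.
case: (classic (flow always A (uop false B X))) => hX; last first.
- have [h1 e1] := ext_right rA rB rX hX.
  have rBX : representable (uop false B X) by reps.
  have XB : flow always X (uop false B X) by apply: flow_inj2 => //; exact: flow0.
  case: (decomposition (rep_interp true hC)) => [hflat|].
    by exists (A, uop false B X); split=> // _; split; [right|left].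
  move=> [N [Z [P [t [eN dt rZ rP hch]]]]].
  have hN : (N < count_vars C)%N by rewrite eN.
  case: hch => hch; last first.
    exists (A, uop false B X); split=> // _; split; [by right|right].
    by exists N, Z, P, t; split=> //; right; split=> //; left.
  have RP : representable P by exists N.
  have [|v [dv h2 e2 [h3 h4]]] := fresh_extension rA rBX (rep_ult0 dt) RP.
    move=> h; apply: hX.
    apply: (@flow_trans _ _ _ _ (uop false (uop false B X) X)); last first.
      by apply: flow_or => //; exact: flow0.
    apply: (flow_all_right (Z := Z) (P := P) (t := t)) => //.
    have ru := rep_ult0 dt; have rAl := rep_lift 1 rA.
    apply: (@flow_trans _ _ _ _ (uop true (lift 1 A) (ult0 t))).
      apply: flow_red => //.
      apply: red_trans (red_comm true (below always t) ru rAl).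
      apply: red_and_pad => //; last by move=> M e [].
      by apply: dec_le; [defs|apply: defv_comp dt _; defs].
    exact: flow_weak h.
  exists (uop true A (at0 v (ult0 t)), uop false (uop false B X) (at0 v P)).
  split=> //; first exact: extends_trans e1 e2.
  have XB2 := flow_trans XB (proj2 e2).
  move=> _; split; first by right.
  right; exists N, Z, P, t; split=> //; left; split=> //; right.
  by exists v; split.
- have hX' : ~ flow always (uop true A X) B by move=> h; apply: hAB; exact: flow_cut h hX.
  have [h1 e1] := ext_left rA rB rX hX'.
  have rAX : representable (uop true A X) by reps.
  have AX : flow always (uop true A X) X by apply: flow_proj2 => //; exact: flow0.
  case: (decomposition (rep_interp true hC)) => [hflat|].
    by exists (uop true A X, B); split=> // _; split; [left|left].
  move=> [N [Z [P [t [eN dt rZ rP hch]]]]].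
  have hN : (N < count_vars C)%N by rewrite eN.
  case: hch => hch.
    exists (uop true A X, B); split=> // _; split; [by left|right].
    by exists N, Z, P, t; split=> //; left; split=> //; left.
  have RP : representable P by exists N.
  have ru := rep_ult0 dt.
  have ruP : representable (uop true (ult0 t) P) by reps.
  have rF := rep_const n k False.
  have [|v [dv h2 e2 [h3 h4]]] := fresh_extension rAX rB ruP rF.
    move=> h; apply: hX'.
    apply: (@flow_trans _ _ _ _ (uop true (uop true A X) X)).
      by apply: flow_and => //; exact: flow0.
    apply: (flow_ex_left (Z := Z) (P := P) (t := t)) => //.
    apply: flow_below => //; apply: flow_trans h _.
    have rBl := rep_lift 1 rB.
    apply: flow_or => //; first exact: flow0.
    by apply: flow_false => //; exact: flow0.
  have rat (Y : ugame k) : representable Y -> representable (at0 v Y).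
    exact: rep_env (defe_at dv).
  exists (uop true (uop true A X) (at0 v (uop true (ult0 t) P)),
    uop false B (at0 v (@uconst n k False))).
  split=> //; first exact: extends_trans e1 e2.
  move=> _; split; first by left; exact: flow_trans (proj1 e2) AX.
  right; exists N, Z, P, t; split=> //; right; split=> //; right.
  exists v; split=> //; apply: flow_trans h3 _.
  + apply: (@flow_proj1 _ _ _ (at0 v (ult0 t)) (at0 v P)); try exact: rat.
    by apply: (@flow0 _ (at0 v (ult0 t))); exact: rat.
  + apply: (@flow_proj2 _ _ _ (at0 v (ult0 t)) (at0 v P)); try exact: rat.
    by apply: flow0; exact: rat.
Qed.

(** If [D] at 0 cannot go to the right and [D] at [t] cannot go to the left, then by cut they go to
    the opposite sides. In that case a fresh [v] separates [D v] from [D (v + 1)], since otherwise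
    [flow_induction] would supply the forbidden flow. *)
Lemma inductive_dense C T c : unprovable c -> exists d,
  [/\ unprovable d, extends c d & inductive_at C T d].
Proof.
move=> hc; case: (classic (hatPi C)) => hC; last first.
  by exists c; split=> //; exact: extends_refl.
case: c hc => A B /= hc; have [rA rB /= hAB] := hc.
pose D := interp true C; have rD : representable D by exact: representable_interp.
pose t : value := fun M e => eval e T; have dt : defv t by exists T.
pose D0 := at0 (fun _ _ => 0) D; pose Dt := at0 t D.
have rD0 : representable D0 by apply: rep_env => //; defs.
have rDt : representable Dt by exact: rep_env (defe_at dt) rD.
have flow0 G Y : representable Y -> flow G Y Y by exact: flow_refl.
case: (classic (flow always A (uop false B D0))) => h0; last first.
  have [h1 e1] := ext_right rA rB rD0 h0; exists (A, uop false B D0); split=> // _.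
  by apply: Or31; apply: flow_inj2 => //; exact: flow0.
have h0' : ~ flow always (uop true A D0) B by move=> h; apply: hAB; exact: flow_cut h h0.
have [h1 e1] := ext_left rA rB rD0 h0'.
have rA0 : representable (uop true A D0) by reps.
case: (classic (flow always (uop true (uop true A D0) Dt) B)) => ht; last first.
  have [h2 e2] := ext_left rA0 rB rDt ht.
  exists (uop true (uop true A D0) Dt, B); split=> //; first exact: extends_trans e1 e2.
  by move=> _; apply: Or32; apply: flow_proj2 => //; exact: flow0.
have ht' : ~ flow always (uop true A D0) (uop false B Dt).
  by move=> h; apply: h0'; exact: flow_cut ht h.
have [h2 e2] := ext_right rA0 rB rDt ht'.
have rBt : representable (uop false B Dt) by reps.
have rDn : representable (next D) by exact: rep_env (defe_next n) rD.
have ru := rep_ult0 dt.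
have ruD : representable (uop true (ult0 t) D) by reps.
have [|v [dv h3 e3 [h4 h5]]] := fresh_extension rA0 rBt ruD rDn.
  move=> h; apply: ht'.
  apply: (@flow_trans _ _ _ _ (uop true (uop true A D0) D0)).
    apply: flow_and => //; first exact: flow0.
    by apply: flow_proj2 => //; exact: flow0.
  apply: (@flow_trans _ _ _ _ (uop false (uop false B Dt) Dt)); last first.
    apply: flow_or => //; first exact: flow0.
    by apply: flow_inj2 => //; exact: flow0.
  by apply: flow_induction => //; exact: flow_below.
exists (uop true (uop true A D0) (at0 v (uop true (ult0 t) D)),
  uop false (uop false B Dt) (at0 v (next D))); split=> //.
  exact: extends_trans e1 (extends_trans e2 e3).
move=> _; apply: Or33; exists v; split=> //.
apply: flow_trans h4 _.
have rat (Y : ugame k) : representable Y -> representable (at0 v Y).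
  exact: rep_env (defe_at dv).
apply: (@flow_proj2 _ _ _ (at0 v (ult0 t)) (at0 v D)); try exact: rat.
by apply: flow0; exact: rat.
Qed.

Lemma generic_pair A B : representable A -> representable B -> ~ flow always A B ->
  exists s : nat -> upair, [/\ s 0%N = (A, B), forall j, unprovable (s j),
    forall i j, (i <= j)%N -> extends (s i) (s j) &
    forall C T, exists j, decides C (s j) /\ inductive_at C T (s j)].
Proof.
move=> rA rB hAB.
have [en hen] : exists f : nat -> prenex n k * term n, forall x, exists j, f j = x.
  apply: (@enumeration _ (pmat k Bot, Var 0)
    (GenTree.tree nat * GenTree.tree nat)%type
    (fun x => (code_prenex x.1, code_term x.2))) => -[C T] [C' T'] [].
  by move=> /code_prenex_inj -> /code_term_inj ->.
pose cond := {c | unprovable c}.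
pose ext (c d : cond) := extends (sval c) (sval d).
pose R j (c : cond) := decides (en j).1 (sval c) /\
  inductive_at (en j).1 (en j).2 (sval c).
have h0 : unprovable (A, B) by [].
have [|||s [s0 smono sR]] := @generic_sequence cond ext R (exist _ _ h0).
- by move=> [c hc]; exact: extends_refl.
- by move=> c d f; exact: extends_trans.
- move=> j [c hc].
  have [d [hd e1 r1]] := decides_dense (en j).1 hc.
  have [d' [hd' e2 r2]] := inductive_dense (en j).1 (en j).2 hd.
  exists (exist _ d' hd'); split; first exact: extends_trans e1 e2.
  by split=> //; exact: decides_mono e2 r1.
exists (fun j => sval (s j)); split.
- by rewrite s0.
- by move=> j; exact: proj2_sig (s j).
- exact: smono.
- move=> C T; have [j hj] := hen (C, T); have [i hi] := sR j.
  by exists i; move: hi; rewrite /R hj.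
Qed.

End Generic.

Lemma qfree_sub n (A : form n) s : qfree A -> qfree (fsub s A).
Proof.
by elim: A s => //= [B IB C IC|B IB C IC|B IB C IC] s /andP[/IB -> /IC ->].
Qed.

Lemma sharply_bounded_qfree n (A : form n) : qfree A -> sharply_bounded A.
Proof.
elim: A => //=; try by constructor.
- by move=> B IB C IC /andP[/IB hB /IC hC]; constructor.
- by move=> B IB C IC /andP[/IB hB /IC hC]; constructor.
- by move=> B IB C IC /andP[/IB hB /IC hC]; constructor.
Qed.

Lemma qfree_PV n (A : form n) : PV_ax A -> qfree A.
Proof. by case=> // B []. Qed.

Lemma gpad_gle (D : Type) k (P Q : Prop) : (P -> Q) -> gle (gpad D k P) (gpad D k Q).
Proof. by elim: k P Q => [//|k IH] P Q h; split=> // us _; apply: IH; tauto. Qed.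

Lemma gval_pad n (M : model n) k P : gval (gpad M k P) <-> P.
Proof.
elim: k P => [//|k IH] P /=; split=> [h|h us _ /IH //].
by apply: NNPP => hP; apply: (h [::]); [constructor|apply/IH].
Qed.

(** * The model of a generic pair *)

Section Completeness.
Variables (n k : nat).
Notation pred := (pred n).
Notation ugame := (ugame n).
Notation value := (value n).
Notation always := (@always n).
Implicit Types A B X Y : ugame k.

Lemma red_pad_le (G c c' : pred) : decidable c -> decidable c' ->
  (forall M e, G M e -> c M e -> c' M e) -> red G (upad k c) (upad k c').
Proof.
move=> dc dc' h; apply: red_gle; [exact: representable_pad..|].
by move=> M e g; apply: gpad_gle; exact: h.
Qed.

Lemma red_pad_and (c c' : pred) : decidable c -> decidable c' ->
  red always (uop true (upad k c) (upad k c')) (upad k (fun M e => c M e /\ c' M e)).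
Proof.
move=> dc dc'; have dcc := decidable_and dc dc'.
have rc := representable_pad k dc; have rc' := representable_pad k dc'.
apply: (red_case dc); [by reps|exact: representable_pad| |].
- apply: red_trans (red_proj2 _ rc rc') _.
  by apply: red_pad_le => // M e [].
- apply: red_trans (proj1 (red_proj _ rc rc')) _.
  by apply: red_pad_le => // M e [].
Qed.

Theorem flow_completeness A B : representable A -> representable B ->
  ~ flow always A B -> exists (M : pvmodel n) (e : nat -> M),
  [/\ models (T_ax k) M, gval (A M e) & ~ gval (B M e)].
Proof.
move=> rA rB hAB; have ct := @contraction n k.
have [s [s0 sU smono sR]] := generic_pair rA rB hAB.
(* [V] and [W] are the games entailed by the left side and those entailing the right side at some
   stage. They are disjoint, because a common game would link both sides of a later stage by a
   flow. *)
pose V X := exists j, flow always (s j).1 X.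
pose W X := exists j, flow always X (s j).2.
have flow0 X : representable X -> flow always X X by exact: flow_refl.
have VW X : V X -> W X -> False.
  move=> [i hi] [j hj]; have [_ _] := sU (maxn i j); apply.
  have [h1 _] := smono _ _ (leq_maxl i j); have [_ h2] := smono _ _ (leq_maxr i j).
  exact: flow_trans h1 (flow_trans hi (flow_trans hj h2)).
have Vup X Y : V X -> flow always X Y -> V Y.
  by move=> [i hi] h; exists i; exact: flow_trans hi h.
have Wdown X Y : W Y -> flow always X Y -> W X.
  by move=> [i hi] h; exists i; exact: flow_trans h hi.
have Vand X Y : representable X -> representable Y -> V X -> V Y -> V (uop true X Y).
  move=> rX rY [i hi] [j hj]; exists (maxn i j).
  have [h1 _] := smono _ _ (leq_maxl i j); have [h2 _] := smono _ _ (leq_maxr i j).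
  have [r _ _] := sU (maxn i j).
  by apply: flow_and => //; [exact: flow_trans h1 hi|exact: flow_trans h2 hj].
(* Only formulas were enumerated, so an arbitrary game is first replaced by the game of a
   formula. *)
have Vor X : representable X -> V X \/ W X.
  move=> rX; have [N rN] := rX; have [C [hC _ hX]] := rep_prenex true rN.
  have rC := representable_interp true hC.
  have [j [hj _]] := sR C (Var 0); have [h _] := hj hC.
  case: h => h; [left|right]; exists j.
  - by apply: flow_redr h _; apply: red_geqv => // M e _; apply: geqv_sym; exact: hX.
  - by apply: flow_redl _ h; apply: red_geqv.
pose pad (c : pred) := upad k c.
have rpad c : decidable c -> representable (pad c) by exact: representable_pad.
have Vent (c c' : pred) : decidable c -> decidable c' -> V (pad c) ->
    (forall M e, c M e -> c' M e) -> V (pad c').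
  move=> dc dc' h hc; apply: Vup h _; apply: flow_red; first exact: rpad.
  by apply: red_pad_le => // M e _; exact: hc.
have Vtrue (c : pred) : (forall M e, c M e) -> V (pad c).
  move=> hc; exists 0%N; have [r _ _] := sU 0%N; apply: flow_red => //.
  by apply: (proj1 (red_pad always c r)) => M e _.
have Vconj (c c' : pred) : decidable c -> decidable c' -> V (pad c) -> V (pad c') ->
    V (pad (fun M e => c M e /\ c' M e)).
  move=> dc dc' h h'; apply: Vup (Vand _ _ (rpad _ dc) (rpad _ dc') h h') _.
  by apply: flow_red; [apply: representable_op; exact: rpad|exact: red_pad_and].
have Vneg (c : pred) : decidable c -> ~ V (pad c) -> V (pad (fun M e => ~ c M e)).
  move=> dc hc; have dn := decidable_not dc.
  case: (Vor _ (rpad _ dc)) => // [[i hi]].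
  case: (Vor _ (rpad _ dn)) => // [[j hj]].
  case: (VW (uop false (pad c) (pad (fun M e => ~ c M e)))).
    have : V (pad (fun _ _ => True)) by exact: Vtrue.
    move=> h; apply: (Vup _ _ h); apply: flow_red.
      by apply: rpad; exact: decidable_const.
    have rc := rpad _ dc; have rn := rpad _ dn.
    apply: (red_case dc); [by apply: rpad; exact: decidable_const|by reps| |].
    + apply: red_trans (proj2 (red_proj _ rc rn)).
      apply: red_pad_le => //; first exact: decidable_const.
      by move=> M e [].
    + apply: red_trans (red_inj2 _ rc rn).
      apply: red_pad_le => //; first exact: decidable_const.
      by move=> M e [].
  exists (maxn i j).
  have [_ h1] := smono _ _ (leq_maxl i j); have [_ h2] := smono _ _ (leq_maxr i j).
  have [_ r _] := sU (maxn i j).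
  by apply: flow_or; [exact: ct|exact: rpad|exact: rpad|exact: r|
    exact: flow_trans hi h1|exact: flow_trans hj h2].
pose peq t u : pred := fun M e => eval e t = eval e u.
pose ple t u : pred := fun M e => eval e t <= eval e u.
have dpeq t u : decidable (peq t u) by exact: decidable_eq.
have dple t u : decidable (ple t u) by exact: decidable_le.
have [|||||M0 [cls [cls_surj clsE clsL evalE]]] :=
    @term_model n (fun t u => V (pad (peq t u))) (fun t u => V (pad (ple t u))).
- by move=> t; exact: Vtrue.
- by move=> t u /Vent; apply=> // M e.
- move=> t u v h1 h2.
  apply: (Vent _ _ (decidable_and (dpeq t u) (dpeq u v)) (dpeq t v)).
    exact: Vconj.
  by rewrite /peq => M e [-> ->].
- move=> t t' u u' h1 h2 h3.
  have d1 := decidable_and (dpeq t t') (dpeq u u').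
  apply: (Vent _ _ (decidable_and d1 (dple t u)) (dple t' u')).
    by apply: (Vconj) => //; exact: (Vconj).
  by rewrite /peq /ple => M e [[-> ->]].
- move=> m f a b h.
  have h' (l : seq 'I_m) :
      decidable (fun M (e : nat -> M) => forall i, i \in l -> eval e (a i) = eval e (b i))
      /\ V (pad (fun M e => forall i, i \in l -> eval e (a i) = eval e (b i))).
    elim: l => [|i l [d1 v1]].
      split; last exact: Vtrue.
      by apply: decidable_ext (decidable_const n True) => M e; split.
    have eqv (M : pvmodel n) (e : nat -> M) : (peq (a i) (b i) M e /\
        forall j, j \in l -> eval e (a j) = eval e (b j)) <->
        (forall j, j \in i :: l -> eval e (a j) = eval e (b j)).
      split=> [[h1 h2] j|h1].
        by rewrite inE => /orP[/eqP ->|/h2].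
      by split=> [|j hj]; apply: h1; rewrite inE ?eqxx ?hj ?orbT.
    have d2 := decidable_ext eqv (decidable_and (dpeq (a i) (b i)) d1).
    split=> //; apply: (Vent _ _ (decidable_and (dpeq (a i) (b i)) d1) d2).
      exact: Vconj.
    by move=> M e /eqv.
  have [d v] := h' (enum 'I_m).
  apply: (Vent _ _ d (dpeq _ _) v) => M e hab; rewrite /peq /eval -/eval; congr fn.
  by apply: functional_extensionality => i; apply: hab; rewrite mem_enum.
have dsat (A0 : form n) : qfree A0 -> decidable (fun M e => sat e A0).
  by move=> q; apply: decidable_sharply_bounded; exact: sharply_bounded_qfree.
(* Quantifier-free truth is settled before anything else: it already makes the term structure a
   model of PV, whose axioms are quantifier-free, and games can be evaluated only in such models. *)
have qtruth (A0 : form n) : qfree A0 -> forall r,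
    sat (fun i => cls (r i)) A0 <-> V (pad (fun M e => sat e (fsub r A0))).
  elim: A0 => //= [|t u|t u|B0 IB C0 IC|B0 IB C0 IC|B0 IB C0 IC].
  - move=> _ r; split=> // h; apply: (VW _ h).
    exists 0%N; have [_ r2 _] := sU 0%N; apply: flow_false => //.
    by apply: flow0; exact: rep_const.
  - by move=> _ r; rewrite !evalE clsE.
  - by move=> _ r; rewrite !evalE clsL.
  - move=> /andP[qB qC] r.
    have dB := dsat _ (qfree_sub r qB); have dC := dsat _ (qfree_sub r qC).
    rewrite (IB qB) (IC qC); split=> [h|h hB]; last first.
      apply: (Vent _ _ (decidable_and (decidable_imp dB dC) dB) dC (Vconj _ _ _ _ h hB)).
      + exact: decidable_imp.
      + by [].
      + by move=> M e [h1 h2]; exact: h1.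
    case: (classic (V (pad (fun M e => sat e (fsub r B0))))) => hB.
      by apply: (Vent _ _ dC (decidable_imp dB dC) (h hB)) => M e hC _.
    apply: (Vent _ _ (decidable_not dB) (decidable_imp dB dC) (Vneg _ dB hB)).
    by move=> M e h1 h2.
  - move=> /andP[qB qC] r.
    have dB := dsat _ (qfree_sub r qB); have dC := dsat _ (qfree_sub r qC).
    rewrite (IB qB) (IC qC); split=> [[h1 h2]|h]; first exact: Vconj.
    by split; [apply: (Vent _ _ _ dB h)|apply: (Vent _ _ _ dC h)];
      try exact: decidable_and; move=> M e [].
  - move=> /andP[qB qC] r.
    have dB := dsat _ (qfree_sub r qB); have dC := dsat _ (qfree_sub r qC).
    have dO := decidable_or dB dC.
    rewrite (IB qB) (IC qC); split=> [[h|h]|h].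
    + by apply: (Vent _ _ dB dO h) => M e; left.
    + by apply: (Vent _ _ dC dO h) => M e; right.
    + case: (classic (V (pad (fun M e => sat e (fsub r B0))))) => hB; [by left|right].
      apply: (Vent _ _ (decidable_and dO (decidable_not dB)) dC
        (Vconj _ _ dO (decidable_not dB) h (Vneg _ dB hB))).
      by move=> M e [[]].
have envs (e : nat -> M0) : exists r, e = fun i => cls (r i).
  have [r hr] := choice_fun (fun i => cls_surj (e i)).
  by exists r; apply: functional_extensionality.
have hM0 : models (@PV_ax n) M0.
  move=> A0 hA e; have [r ->] := envs e; apply/(qtruth _ (qfree_PV hA)).
  apply: Vtrue => M e'; rewrite sat_fsub; exact: (pvmP (p := M)).
pose M := PVModel hM0; pose e0 : nat -> M := fun i => cls (Var i).
have eval0 t : eval e0 t = cls t.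
  by rewrite /e0 -[fun i => cls (Var i)]/(fun i => cls (@Var n i)) evalE tsub_Var.
(* A decidable predicate is an equation between terms in every model of PV, the new one included, so
   [qtruth] applies to it. *)
have Vdec (c : pred) : decidable c -> V (pad c) <-> c M e0.
  move=> dc; have [t ht] := dc; rewrite (ht M e0).
  have h := qtruth (t == 0)%pv erefl Var; rewrite fsub_Var in h.
  have et : eval e0 t = 0 <-> sat e0 (t == 0)%pv by rewrite /= eval_zero.
  rewrite et; apply: iff_trans _ (iff_sym h).
  by split=> hv; apply: (Vent _ _ _ _ hv) => //; try exact: dsat;
    move=> M' e'; rewrite (ht M' e') /= eval_zero.
have rat v X : defv v -> representable X -> representable (at0 v X).
  by move=> dv; exact: rep_env (defe_at dv).
have below_at (v t : value) X Y : defv v -> defv t -> representable X -> representable Y ->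
    red (below always t) (lift 1 X) Y ->
    flow always (uop true X (ult k v t)) (at0 v Y).
  move=> dv dt rX rY h; have ru := rep_ult k dv dt.
  have dlt : decidable (fun M e => v M e < t M e) by apply: dec_le; defs.
  apply: flow_red; first by reps.
  apply: (red_case dlt); [by reps|exact: rat| |].
  + apply: red_trans (proj1 (red_proj _ rX ru)) _.
    by apply: (red_env (defe_at dv) h) => M' e' [_ h'].
  + apply: red_trans (red_proj2 _ rX ru) _.
    by apply: (proj2 (red_pad _ _ (rat _ _ dv rY))) => M' e' [].
have above_at (v t : value) X Y : defv v -> defv t -> representable X -> representable Y ->
    red (below always t) Y (lift 1 X) ->
    flow always (uop true (at0 v Y) (ult k v t)) X.
  move=> dv dt rX rY h; have ru := rep_ult k dv dt; have rv := rat _ _ dv rY.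
  have dlt : decidable (fun M e => v M e < t M e) by apply: dec_le; defs.
  apply: flow_red; first by reps.
  apply: (red_case dlt); [by reps|by []| |].
  + apply: red_trans (proj1 (red_proj _ rv ru)) _.
    by apply: (red_env (defe_at dv) h) => M' e' [_ h'].
  + apply: red_trans (red_proj2 _ rv ru) _.
    by apply: (proj2 (red_pad _ _ rX)) => M' e' [].
have names (d : M) : exists t, d = eval e0 t.
  by have [t ->] := cls_surj d; exists t; rewrite eval0.
(* Strong induction on the number of quantifiers: the formula [C] representing [X] has at most [N]
   of them, and the chain recorded for [C] has instances with strictly fewer. *)
have truth N : forall X, rep N X -> (V X -> gval (X M e0)) /\ (W X -> ~ gval (X M e0)).
  have [m] := ubnP N; elim: m N => [//|m IH] N hm X rN.
  have rX : representable X by exists N.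
  have [C [hC hCN hX]] := rep_prenex true rN.
  have rC := representable_interp true hC.
  have VX : V X <-> V (interp true C).
    split=> h; apply: Vup h _; apply: flow_red => //; apply: red_geqv => // M' e' _.
    exact: geqv_sym.
  have WX : W X <-> W (interp true C).
    split=> h; apply: Wdown h _; apply: flow_red => //; apply: red_geqv => // M' e' _.
    exact: geqv_sym.
  rewrite VX WX (gval_geqv (hX M e0)).
  have [j [hj _]] := sR C (Var 0); have [_] := hj hC.
  case=> [[c dc hc]|[N' [Z [P [t [hN' dt rP hw]]]]]].
    rewrite (gval_geqv (hc M e0)) gval_pad -(Vdec _ dc).
    have cC : V (interp true C) -> V (pad c).
      by move=> h; apply: Vup h _; apply: flow_red => //; apply: red_geqv => //; exact: rpad.
    split=> // hW hV; apply: (VW _ hV); apply: Wdown hW _; apply: flow_red.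
      exact: rpad.
    by apply: red_geqv => //; [exact: rpad|move=> M' e' _; apply: geqv_sym; exact: hc].
  have RP : representable P by exists N'.
  have IHP v : defv v -> (V (at0 v P) -> gval (P M (econs (v M e0) e0))) /\
      (W (at0 v P) -> ~ gval (P M (econs (v M e0) e0))).
    move=> dv; apply: (IH N'); last exact: rep_env_count (defe_at dv) rP.
    by apply: leq_trans hN' (leq_trans hCN _).
  have dult v : defv v -> decidable (fun M e => v M e < t M e).
    by move=> dv; apply: dec_le; defs.
  case: hw => -[[h1 h2 h3 h4 h5] hw]; split=> hVW.
  - apply: h5 => d hd; have [u hu] := names d.
    have dv : @defv n (fun M e => eval e u) by exists u.
    rewrite hu; apply: (proj1 (IHP _ dv)).
    apply: Vup (below_at _ _ _ _ dv dt rC RP h4).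
    apply: Vand => //; first exact: rep_ult.
    by apply/Vdec; [exact: dult|rewrite -hu].
  - case: hw => [hV|[v [dv v1 v2]]]; first by case: (VW (interp true C)) => //; exists j.
    move=> hg; apply: (proj2 (IHP _ dv)); first by exists j.
    apply: (red_sound h4) hg; split=> //.
    by apply/(Vdec _ (dult _ dv)); exists j.
  - case: hw => [hV|[v [dv v1 v2]]]; first by case: (VW (interp true C)) => //; exists j.
    have hg : gval (P M (econs (v M e0) e0)) by apply: (proj1 (IHP _ dv)); exists j.
    apply: (red_sound h4) hg; split=> //.
    by apply/(Vdec _ (dult _ dv)); exists j.
  - move=> /h5[d hd hg]; have [u hu] := names d.
    have dv : @defv n (fun M e => eval e u) by exists u.
    rewrite hu in hg hd.
    case: (Vor _ (rat _ _ dv RP)) => hP; last exact: (proj2 (IHP _ dv)) hP hg.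
    apply: (VW (interp true C)) => //.
    apply: Vup (above_at _ _ _ _ dv dt rC RP h4).
    by apply: Vand => //; [exact: rat|exact: rep_ult|apply/Vdec; first exact: dult].
have truthR X : representable X -> (V X <-> gval (X M e0)).
  move=> rX; have [N rN] := rX; have [h1 h2] := truth _ _ rN; split=> // hg.
  by case: (Vor _ rX) => // /h2.
exists M, e0; split; last first.
- have [N rN] := rB; apply: (proj2 (truth _ _ rN)); exists 0%N; rewrite s0.
  exact: flow0.
- by apply/truthR => //; exists 0%N; rewrite s0; exact: flow0.
- move=> A0 [A1 hA1|P hP PA] e; first exact: (hM0 _ hA1 e).
  have [r hr] := envs e.
  have hsat d : sat (econs d e) (pform true P) <->
      gval (interp true P (econs d e : nat -> M)).
    exact: iff_sym (@gval_interp n M k true P (econs d e)).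
  rewrite [sat _ _]/= => -[hz hs] d.
  (* The parameters of the induction formula are elements of the model. Replacing them by terms that
     name them gives a formula [D] with the induction variable 0, to which genericity applies. *)
  have [D [hD _ hDP]] := rep_prenex true (rep_sub (up r) (rep_interp true hP)).
  have rD := representable_interp true hD.
  have key u : gval (interp true P (econs (cls u) e : nat -> M)) <->
      gval (at0 (fun M e => eval e u) (interp true D) e0).
    rewrite /at0 -(gval_geqv (hDP M _)) /usub econs_up eval0 hr.
    suff -> : (fun i => cls (r i)) = (fun i => eval e0 (r i)) by [].
    by apply: functional_extensionality => i; rewrite eval0.
  apply: NNPP => hd; have [T hT] := cls_surj d.
  have [j [_ hj]] := sR D T.
  have dT : @defv n (fun M e => eval e T) by exists T.
  have d0 : @defv n (fun M e => eval e 0%pv) by exists 0%pv.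
  have a0 : at0 (fun _ _ => 0) (interp true D) =
      at0 (fun M e => eval e 0%pv) (interp true D).
    apply: functional_extensionality_dep => M'.
    by apply: functional_extensionality => e'; rewrite /at0 eval_zero.
  case: (hj hD) => [h|h|[v [dv v1 v2]]].
  + apply: (VW (at0 (fun _ _ => 0) (interp true D))); last by exists j.
    rewrite a0; apply/truthR; first exact: rat.
    apply/key; apply/hsat; move: hz; rewrite sat_inst.
    by rewrite !eval_zero -eval0 eval_zero.
  + apply: hd; apply/hsat; rewrite hT; apply/key; apply/truthR; first exact: rat.
    by exists j.
  + have [u hu] := dv.
    have vu (F : ugame k) : at0 v F = at0 (fun M e => eval e u) F.
      apply: functional_extensionality_dep => M'.
      by apply: functional_extensionality => e'; rewrite /at0 hu.
    have dv1 : @defv n (fun M e => eval e (u + 1)%pv) by exists (u + 1)%pv.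
    have vu1 : at0 (fun M e => v M e + 1) (interp true D) =
        at0 (fun M e => eval e (u + 1)%pv) (interp true D).
      apply: functional_extensionality_dep => M'.
      by apply: functional_extensionality => e'; rewrite /at0 hu eval_add eval_one.
    have g1 : V (at0 v (interp true D)) by exists j.
    rewrite vu in g1; move/truthR: g1 => /(_ (rat _ _ (ex_intro _ u (fun _ _ => erefl)) rD)).
    move=> /key /hsat /hs; rewrite sat_fsub => g2.
    apply: (VW (at0 (fun M e => v M e + 1) (interp true D))); last by exists j.
    rewrite vu1; apply/truthR; first exact: rat.
    apply/key; apply/hsat; move: g2; congr sat.
    apply: functional_extensionality => -[|i] //=.
    rewrite (@eval_add n M (econs (cls u) e) (Var 0) 1%pv) eval_one.
    by rewrite -[cls (u + 1)%pv]eval0 eval_add eval_one eval0.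
Qed.

End Completeness.

(** * Games and deterministic reductions *)

Lemma sharply_bounded_sub n (A : form n) s :
  sharply_bounded A -> sharply_bounded (fsub s A).
Proof.
have e t r : tsub (up r) (tshift 1 (len t)) = tshift 1 (len (tsub r t)) :> term n.
  by rewrite /len /tshift !tsub_ap //= /tshift !tsub_comp.
move=> h; elim: h s => /=; try by constructor.
- by move=> t B hB IH s; rewrite /ball /= e; apply: sb_ball.
- by move=> t B hB IH s; rewrite /bex /= e; apply: sb_bex.
Qed.

Lemma hatPi_psub n k (A : prenex n k) s : hatPi A -> hatPi (psub s A).
Proof.
by elim: k A s => [|k IH] A s; [exact: sharply_bounded_sub|exact: IH].
Qed.

Lemma hatPi_guard n k (op : form n -> form n -> form n) g (A : prenex n k) :
  (forall B C, sharply_bounded B -> sharply_bounded C -> sharply_bounded (op B C)) ->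
  sharply_bounded g -> hatPi A -> hatPi (guard op g A).
Proof.
move=> hop; elim: k g A => [|k IH] g A hg hA; first exact: hop.
by apply: IH => //; exact: sharply_bounded_sub.
Qed.

Lemma hatPi_pop2 n k (op : form n -> form n -> form n) (A B : prenex n k) :
  (forall B C, sharply_bounded B -> sharply_bounded C -> sharply_bounded (op B C)) ->
  hatPi A -> hatPi B -> hatPi (pop2 op A B).
Proof.
move=> hop; elim: k A B => [|k IH] A B hA hB; first exact: hop.
by apply: IH; exact: hatPi_psub.
Qed.

Lemma sharply_bounded_les n (ts ps : seq (term n)) : sharply_bounded (les ts ps).
Proof.
rewrite /les; elim: (zip ts ps) => [|tp s IH] /=; first by do 2 constructor.
by constructor=> //; constructor.
Qed.

(** All plays have the same outcome, the sign alternating with the blocks. A guard whose condition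
    fails leaves such a game. *)
Fixpoint gflat D (P : Prop) k : game D k -> Prop :=
  if k is j.+1 return game D k -> Prop then fun X =>
    forall us, size us = size X.1 -> gflat (~ P) (X.2 us)
  else fun X => X <-> P.

Section Formulas.
Variable n : nat.
Notation pred := (pred n).
Notation ugame := (ugame n).

Lemma sat_les (M : model n) (e : nat -> M) ts ps : size ts = size ps ->
  sat e (les ts ps) <-> vles (map (eval e) ts) (map (eval e) ps).
Proof.
elim: ts ps => [|t ts IH] [|p ps] //=; first by split=> // _; constructor.
move=> [hs]; split=> [[h /(IH _ hs) h']|h]; first by constructor.
by inversion h; subst; split=> //; apply/(IH _ hs).
Qed.

Lemma gflat_iff (D : Type) (P Q : Prop) k (X : game D k) :
  (P <-> Q) -> gflat P X -> gflat Q X.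
Proof.
elim: k P Q X => [|k IH] P Q X h /=; first by move=> ->.
by move=> hX us hs; apply: IH (hX us hs); tauto.
Qed.

Lemma gval_flat (M : pvmodel n) k P (X : game M k) : gflat P X -> gval X <-> P.
Proof.
elim: k P X => [//|k IH] P X h; split=> [hX|hP us hus].
- apply: NNPP => hP; apply: (hX (nseq (size X.1) 0)); first exact: vles_zeros.
  by apply/(IH (~ P)); first by apply: h; rewrite size_nseq.
- by move=> /(IH _ _ (h _ (vles_size hus))); apply.
Qed.

(** The outcome does not depend on the moves, so any legal ones will do, for instance zeros. *)
Lemma red_flat k (G : pred) (X Y : ugame k) : representable X -> representable Y ->
  (forall M e, G M e -> gflat False (X M e) \/ gflat True (Y M e)) -> red G X Y.
Proof.
elim: k G X Y => [|k IH] G X Y.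
  by move=> _ _ h M e /h[|] /= [h1 h2]; [move=> /h1|move=> _; exact: h2].
move=> /representable_cont[ps [hps _ hX]] /representable_cont[qs [hqs hY _]] h.
exists (size qs), (nseq (size ps) 0%pv); split=> [M e _|M E _|].
- by rewrite hqs size_map.
- by rewrite eval_zeros; apply: vles_zeros; rewrite hps size_map.
- apply: IH => // [|M E [g w]]; first by apply: hX; rewrite size_nseq.
  case: (h _ _ g) => h'; [right|left].
  + apply: (@gflat_iff _ (~ False)); first by tauto.
    by apply: h'; rewrite size_map size_nseq hps size_map.
  + apply: (@gflat_iff _ (~ True)); first by tauto.
    by apply: h'; exact: (vles_size w).
Qed.

Lemma eval_iter_up (M : model n) us (e : nat -> M) s :
  (fun i => eval (ecat us e) (iter (size us) (@up n) s i)) =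
  ecat us (fun i => eval e (s i)).
Proof. by elim: us => [//|u us IH] /=; rewrite econs_up IH. Qed.

Lemma interp_psub k pi (A : prenex n k) s (M : pvmodel n) (e : nat -> M) :
  geqv (interp pi (psub s A) e) (interp pi A (fun i => eval e (s i))).
Proof.
elim: k pi A s e => [|k IH] pi A s e.
  by case: pi => /=; rewrite sat_fsub; exact: geqv_refl.
split=> [|us] /=.
  by rewrite -map_comp; apply: eq_map => t /=; rewrite eval_tsub.
rewrite !size_map => hs; apply: geqv_trans (IH _ _ _ _) _.
by rewrite -hs eval_iter_up; exact: geqv_refl.
Qed.

Lemma interp_guard k pi (A : prenex n k) h (M : pvmodel n) (e : nat -> M) :
  [/\ sat e h -> geqv (interp pi (guard (@And n) h A) e) (interp pi A e),
      sat e h -> geqv (interp pi (guard (@Imp n) h A) e) (interp pi A e),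
      ~ sat e h -> gflat (~~ pi) (interp pi (guard (@And n) h A) e) &
      ~ sat e h -> gflat pi (interp pi (guard (@Imp n) h A) e)].
Proof.
elim: k pi A h e => [|k IH] pi A h e.
  by case: pi; split=> hh; rewrite /geqv /= ?f; split=> // h'; tauto.
have es us : size us = size A.1 -> sat (ecat us e) (fshift (size A.1) h) = sat e h.
  by move=> <-; rewrite sat_fshift edrop_ecat.
split=> hh; try (split=> // us); try (move=> us);
  rewrite /= ?size_map => hs; have [h1 h2 h3 h4] :=
    IH (~~ pi) A.2 (fshift (size A.1) h) (ecat us e); rewrite (es _ hs) in h1 h2 h3 h4.
- exact: h1.
- exact: h2.
- by apply: gflat_iff (h3 hh); case: (pi); split=> //; move/(_ isT).
- by apply: gflat_iff (h4 hh); case: (pi); split=> //; move/(_ isT).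
Qed.

Lemma interp_pop2 k pi (A B : prenex n k) (M : pvmodel n) (e : nat -> M) :
  geqv (interp pi (pop2 (@And n) A B) e) (gop pi (interp pi A e) (interp pi B e)) /\
  geqv (interp pi (pop2 (@Or n) A B) e) (gop (~~ pi) (interp pi A e) (interp pi B e)).
Proof.
elim: k pi A B e => [|k IH] pi A B e.
  by case: pi; split; rewrite /geqv /=; split; tauto.
set l := size A.1; set r := size B.1.
have key us : size us = (l + r)%N ->
    geqv (interp (~~ pi) (psub (fun i => Var (if (i < l)%N then i else r + i)%N) A.2)
      (ecat us e)) (interp (~~ pi) A.2 (ecat (take l us) e)) /\
    geqv (interp (~~ pi) (psub (fun i => Var (l + i)%N) B.2) (ecat us e))
      (interp (~~ pi) B.2 (ecat (drop l us) e)).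
  move=> hs; split; apply: geqv_trans (interp_psub _ _ _ _) _.
  - have -> : (fun i => eval (ecat us e) (Var (if (i < l)%N then i else r + i)%N)) =
      ecat (take l us) e; last exact: geqv_refl.
    apply: functional_extensionality => i; rewrite eval_Var !(ecat_nth (e 0%N)).
    rewrite size_takel hs ?leq_addr //; case: (ltnP i l) => hi.
      by rewrite ltn_addr // nth_take.
    by rewrite addnC ltn_add2r ltnNge hi /= subnDr.
  - have -> : (fun i => eval (ecat us e) (Var (l + i)%N)) = ecat (drop l us) e;
      last exact: geqv_refl.
    apply: functional_extensionality => i; rewrite eval_Var !(ecat_nth (e 0%N)).
    by rewrite size_drop hs addKn ltn_add2l nth_drop subnDl.
by split; (split=> [|us] /=; first by rewrite map_cat);
  rewrite map_cat size_cat !size_map => hs; have [k1 k2] := key _ hs;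
  [apply: geqv_trans (proj1 (IH _ _ _ _)) _|apply: geqv_trans (proj2 (IH _ _ _ _)) _];
  exact: gop_geqv.
Qed.

Lemma gval_op (M : pvmodel n) k b (X Y : game M k) :
  gval (gop b X Y) <-> if b then gval X /\ gval Y else gval X \/ gval Y.
Proof.
elim: k b X Y => [|k IH] b X Y; first by case: b.
have split_moves (Q : seq M -> seq M -> Prop) :
    (forall us, vles us (X.1 ++ Y.1) -> Q (take (size X.1) us) (drop (size X.1) us)) <->
    forall us vs, vles us X.1 -> vles vs Y.1 -> Q us vs.
  split=> h => [us vs hu hv|us hus].
  - have hs := vles_size hu; have := h (us ++ vs).
    by rewrite -hs take_size_cat // drop_size_cat //; apply; apply/vles_cat.
  - have hs := vles_size hus; rewrite size_cat in hs.
    have ht : size (take (size X.1) us) = size X.1 by rewrite size_takel // hs leq_addr.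
    have [h1 h2] : vles (take (size X.1) us) X.1 /\ vles (drop (size X.1) us) Y.1.
      by apply/vles_cat; rewrite ?cat_take_drop.
    exact: h.
apply: iff_trans (split_moves (fun us vs => ~ gval (gop (~~ b) (X.2 us) (Y.2 vs)))) _.
(* Zeros are legal in every block, so a refutation of one conjunct extends to a refutation of the
   conjunction. *)
have z Z : @vles n M (nseq (size Z) 0) Z by exact: vles_zeros.
case: b; split=> h.
- split=> us hus hg.
    by apply: (h us (nseq (size Y.1) 0)) => //; apply/IH; left.
  by apply: (h (nseq (size X.1) 0) us) => //; apply/IH; right.
- by case: h => h1 h2 us vs hu hv /IH[]; [exact: h1|exact: h2].
- apply: NNPP => /not_or_and[h1 h2]; apply: h1 => us hus hX; apply: h2 => vs hvs hY.
  by apply: (h us vs) => //; apply/IH.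
- by move=> us vs hu hv /IH[h1 h2]; case: h => h; [exact: h h1|exact: h h2].
Qed.

Lemma gval_pmat k (A : form n) (M : pvmodel n) (e : nat -> M) pi :
  gval (interp pi (pmat k A) e) <-> if pi then sat e A else ~ sat e A.
Proof.
elim: k pi => [|k IH] pi; first by case: pi.
split=> [h|h us hus]; last first.
  by inversion hus; subst; move=> /(IH (~~ pi)); case: (pi) h => /=; tauto.
have /IH : ~ gval (interp (~~ pi) (pmat k A) e) by apply: (h [::]); constructor.
by case: (pi) => /= h'; [apply: NNPP|].
Qed.

(** Deterministic reductions demand tuples of exact length, while a strategy with an empty guard may
    have any length; in that case it is replaced by zeros. *)
Lemma red_blockP k (G : pred) p q (C D : ugame k) :
  red G (ublock p C) (ublock q D) ->
  exists f, [/\ size f = size p,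
    forall (M : pvmodel n) E, G M (edrop (size q) E) ->
      vles (etake (size q) E) (map (eval (edrop (size q) E)) q) ->
      vles (map (eval E) f) (map (eval (edrop (size q) E)) p) &
    red (within (size q) G (ublock q D)) D (usub (block_sub f (size q)) C)].
Proof.
move=> [l [f [hl hf h]]].
case: (classic (exists (M : pvmodel n) e, G M e)) => [[M0 [e0 g0]]|hG]; last first.
  exists (nseq (size p) 0%pv); split; first by rewrite size_nseq.
  - by move=> M E g; case: hG; exists M, (edrop (size q) E).
  - by apply: red_absurd => M E [g _]; apply: hG; exists M, (edrop (size q) E).
have e : l = size q by rewrite -(hl _ _ g0) size_map.
rewrite e in hf h; exists f; split.
- have z : @vles n M0 (nseq (size q) 0) (map (eval e0) q).
    by apply: vles_zeros; rewrite size_map.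
  have e1 := edrop_ecat (nseq (size q) (zero M0)) e0.
  have e2 := etake_ecat (nseq (size q) (zero M0)) e0; rewrite size_nseq in e1 e2.
  have := hf M0 (ecat (nseq (size q) 0) e0); rewrite /within e1 e2.
  by move=> /(_ (conj g0 z)) /vles_size; rewrite !size_map.
- by move=> M E g w; exact: (hf M E (conj g w)).
- apply: red_ext h => M E w; split=> //; rewrite /ucont /ucontf /ublock /=.
  + by rewrite ecat_take_drop; exact: geqv_refl.
  + by rewrite /usub eval_block_sub; exact: geqv_refl.
Qed.

(** Moves the side condition [g] from the guard of the reduction into the formulas. Where [g] fails,
    the game on the left is lost by every play, so there is nothing to prove. *)
Lemma red_guard k (pi : bool) (G : pred) (g h : form n) s (C D : prenex n k) :
  let op := if pi then @And n else @Imp n in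
  hatPi C -> hatPi D -> sharply_bounded g -> sharply_bounded h ->
  (forall (M : pvmodel n) (e : nat -> M), G M e -> sat e g -> sat e h) ->
  red (fun M e => G M e /\ sat e g) (interp pi D) (usub s (interp pi C)) ->
  red G (interp pi (guard op g D)) (interp pi (guard op h (psub s C))).
Proof.
move=> op hC hD hg hh gh r.
have hop B B' : sharply_bounded B -> sharply_bounded B' -> sharply_bounded (op B B').
  by rewrite /op; case: (pi) => ? ?; [exact: sb_and|exact: sb_imp].
have rX : representable (interp pi (guard op g D)).
  by apply: representable_interp; exact: hatPi_guard.
have rY : representable (interp pi (guard op h (psub s C))).
  by apply: representable_interp; apply: hatPi_guard => //; exact: hatPi_psub.
apply: (red_case (decidable_sharply_bounded hg)) => //.
- apply: red_ext r => M e [Ge ge]; split=> //.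
  + have [h1 h2 _ _] := interp_guard pi D g e.
    by apply: geqv_sym; rewrite /op; case: (pi) h1 h2 => h1 h2; [exact: h1|exact: h2].
  + apply: geqv_trans (geqv_sym (interp_psub pi C s e)) _.
    have he := gh _ _ Ge ge; have [h1 h2 _ _] := interp_guard pi (psub s C) h e.
    by apply: geqv_sym; rewrite /op; case: (pi) h1 h2 => h1 h2; [exact: h1|exact: h2].
- apply: red_flat => // M e [Ge ge]; left.
  have [_ _ h1 h2] := interp_guard pi D g e.
  have f : is_true false <-> False by [].
  by apply: (gflat_iff f); rewrite /op; case: (pi) h1 h2 => h1 h2; [exact: h1|exact: h2].
Qed.
End Formulas.

(** * Deterministic reductions of formulas and strategies *)

Section Reductions.
Variable n : nat.
Notation pred := (pred n).
Notation ugame := (ugame n).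

Lemma dred_ext (T : form n -> Prop) k F F' pi g (A B : prenex n k) :
  (forall i, (i <= k)%N -> F i = F' i) -> dred T F pi g A B -> dred T F' pi g A B.
Proof.
elim: k pi g A B => [//|k IH] pi g [p C] [q D] h /=; rewrite -(h k.+1) //.
have h' i : (i <= k)%N -> F i = F' i by move=> hi; apply: h; exact: leqW.
by case: pi => -[h1 h2 h3]; split=> //; exact: IH.
Qed.

Lemma sat_in_block (M : pvmodel n) (E : nat -> M) (q : seq (term n)) :
  sat E (les (block_vars n (size q)) (map (tshift (size q)) q)) <->
  vles (etake (size q) E) (map (eval (edrop (size q) E)) q).
Proof.
rewrite sat_les ?size_mkseq ?size_map // map_eval_Var -map_comp.
by rewrite (eq_map (fun t => eval_tshift (size q) E t)).
Qed.

Lemma sat_in_block_at (M : pvmodel n) (E : nat -> M) f (p : seq (term n)) l :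
  size f = size p -> sat E (les f (map (tshift l) p)) <->
  vles (map (eval E) f) (map (eval (edrop l E)) p).
Proof.
move=> hs; rewrite sat_les ?size_map // -map_comp.
by rewrite (eq_map (fun t => eval_tshift l E t)).
Qed.

Lemma red_step k (pi : bool) g p q (C D : prenex n k) : hatPi C -> hatPi D ->
  red (fun M e => sat e g) (ublock p (interp pi C)) (ublock q (interp pi D)) ->
  exists f,
  let op := if pi then @And n else @Imp n in
  let l := size q in
  let g' := fshift l g in
  let in_q := les (block_vars n l) (map (tshift l) q) in
  let in_p := les f (map (tshift l) p) in
  [/\ size f = size p, proves (@PV_ax n) (g' -> in_q -> in_p)%pv &
    red (fun M e => sat e g') (interp pi (guard op in_q D))
      (interp pi (guard op in_p (psub (block_sub f l) C)))].
Proof.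
move=> hC hD h; have [f [hf hv r]] := red_blockP h; exists f => op l g' in_q in_p.
have sg (M : pvmodel n) (E : nat -> M) : sat E g' = sat (edrop l E) g.
  exact: sat_fshift.
have hin (M : pvmodel n) (E : nat -> M) : sat E g' -> sat E in_q -> sat E in_p.
  by rewrite sg => hg /sat_in_block hq; apply/sat_in_block_at => //; exact: hv.
split=> //; first by apply/pv_provesP => M E; exact: hin.
apply: (red_guard (G := fun M e => sat e g')) => //; try exact: sharply_bounded_les.
by apply: (red_weak _ r) => M E; rewrite sg sat_in_block.
Qed.

(** In the Sigma case the games are those of the negations, so the strategy runs from [B] to [A].
    This is also why the two cases of the induction differ only by exchanging the formulas. *)
Lemma dred_of_red k (pi : bool) g (A B : prenex n k) : hatPi A -> hatPi B ->
  red (fun M e => sat e g) (interp pi (if pi then A else B))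
    (interp pi (if pi then B else A)) ->
  exists F, dred (@PV_ax n) F pi g A B.
Proof.
elim: k pi g A B => [|k IH] pi g A B.
  move=> _ _ h; exists (fun _ => [::]); apply/pv_provesP => M e hg hA.
  by case: pi h => h; [exact: h hg hA|apply: NNPP => hB; exact: h hg hB hA].
case: A B => [p C] [q D] hC hD h.
(* The induction hypothesis fixes the terms of the inner levels only. The entry at [k + 1] is
   overwritten, which [dred_ext] permits. *)
have key f F : exists F' : nat -> seq (term n), F' k.+1 = f /\
    forall i, (i <= k)%N -> F i = F' i.
  exists (fun j => if j == k.+1 then f else F j); rewrite eqxx; split=> // i hi.
  by case: eqP => // e; rewrite e ltnn in hi.
have sbI : forall B' C', sharply_bounded B' -> sharply_bounded C' ->
    sharply_bounded (Imp B' C' : form n) by exact: sb_imp.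
have sbA : forall B' C', sharply_bounded B' -> sharply_bounded C' ->
    sharply_bounded (And B' C' : form n) by exact: sb_and.
case: pi h => h.
- have [f [h1 h2 r]] := @red_step k false g p q C D hC hD h.
  have [||F hF] := IH false _ _ _ _ _ r.
  + by apply: hatPi_guard (sharply_bounded_les _ _) _ => //; exact: hatPi_psub.
  + exact: hatPi_guard (sharply_bounded_les _ _) _.
  have [F' [e hF']] := key f F; exists F'; rewrite /= e; split=> //.
  exact: dred_ext hF' hF.
- have [f [h1 h2 r]] := @red_step k true g q p D C hD hC h.
  have [||F hF] := IH true _ _ _ _ _ r.
  + exact: hatPi_guard (sharply_bounded_les _ _) _.
  + by apply: hatPi_guard (sharply_bounded_les _ _) _ => //; exact: hatPi_psub.
  have [F' [e hF']] := key f F; exists F'; rewrite /= e; split=> //.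
  exact: dred_ext hF' hF.
Qed.

Lemma sat_geqv k pi (A A' : prenex n k) (M : pvmodel n) (e e' : nat -> M) :
  geqv (interp pi A e) (interp pi A' e') ->
  sat e (pform pi A) <-> sat e' (pform pi A').
Proof.
move=> /gval_geqv; rewrite !gval_interp; case: pi => // h.
by split=> hA; apply: NNPP => hA'; move: hA; apply/h.
Qed.

Lemma sat_psub k pi (A : prenex n k) s (M : pvmodel n) (e : nat -> M) :
  sat e (pform pi (psub s A)) <-> sat (fun i => eval e (s i)) (pform pi A).
Proof. by apply: sat_geqv; exact: interp_psub. Qed.

Lemma sat_guard k pi (A : prenex n k) h (M : pvmodel n) (e : nat -> M) :
  (sat e (pform pi (guard (@Imp n) h A)) <-> (sat e h -> sat e (pform pi A))) /\
  (sat e (pform pi (guard (@And n) h A)) <-> (sat e h /\ sat e (pform pi A))).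
Proof.
have [h1 h2 h3 h4] := interp_guard pi A h e.
case: (classic (sat e h)) => hh.
- by rewrite (sat_geqv (h1 hh)) (sat_geqv (h2 hh)); tauto.
- have := gval_flat (h3 hh); have := gval_flat (h4 hh).
  rewrite !gval_interp; case: (pi) => /= k1 k2.
    have {}k1 := proj2 k1 isT; split; first by tauto.
    by split=> [/k2|[]].
  have {}k2 := proj2 k2 isT; split; last by tauto.
  by split=> // _; apply: NNPP => /k1.
Qed.

Lemma dred_sound k F pi g (A B : prenex n k) : dred (@PV_ax n) F pi g A B ->
  forall (M : pvmodel n) (e : nat -> M), sat e g ->
  sat e (pform pi A) -> sat e (pform pi B).
Proof.
elim: k pi g A B => [|k IH] pi g A B.
  by move=> /pv_provesP h M e; exact: h.
case: A B => [p C] [q D] /=; set f := F k.+1; case: pi => -[hf /pv_provesP hin r] M e hg.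
- move=> /(proj1 (sat_block _ _ _)) hA; apply/(proj1 (sat_block _ _ _)) => vs hvs.
  have hs := vles_size hvs; rewrite size_map in hs.
  have e1 := edrop_ecat vs e; have e2 := etake_ecat vs e; rewrite hs in e1 e2.
  have hg' : sat (ecat vs e) (fshift (size q) g) by rewrite sat_fshift e1.
  have hq : sat (ecat vs e) (les (block_vars n (size q)) (map (tshift (size q)) q)).
    by apply/sat_in_block; rewrite e1 e2.
  have hp := hin M _ hg' hq.
  apply: (proj1 (proj1 (@sat_guard k false D _ _ _)) (IH _ _ _ _ r M _ hg' _) hq).
  apply: (proj2 (proj1 (@sat_guard k false _ _ _ _))) => _.
  apply/(@sat_psub k false); rewrite eval_block_sub e1; apply: hA.
  by have := proj1 (sat_in_block_at _ _ hf) hp; rewrite e1.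
- move=> /(proj2 (sat_block _ _ _)) [us hus hA]; apply/(proj2 (sat_block _ _ _)).
  have hs := vles_size hus; rewrite size_map in hs.
  have e1 := edrop_ecat us e; have e2 := etake_ecat us e; rewrite hs in e1 e2.
  have hg' : sat (ecat us e) (fshift (size p) g) by rewrite sat_fshift e1.
  have hp : sat (ecat us e) (les (block_vars n (size p)) (map (tshift (size p)) p)).
    by apply/sat_in_block; rewrite e1 e2.
  have hq := hin M _ hg' hp.
  have hA' := proj2 (proj2 (@sat_guard k true C _ _ _)) (conj hp hA).
  have [_] := proj1 (proj2 (@sat_guard k true _ _ _ _)) (IH _ _ _ _ r M _ hg' hA').
  move=> /(@sat_psub k true); rewrite eval_block_sub e1 => hD.
  exists (map (eval (ecat us e)) f) => //.
  by have := proj1 (sat_in_block_at _ _ hf) hq; rewrite e1.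
Qed.
End Reductions.

(** * Derivability and deterministic flows *)

Section Correspondence.
Variables (n k : nat).
Notation pred := (pred n).
Notation ugame := (ugame n).
Notation value := (value n).
Notation always := (@always n).

Lemma sat_pop2 (A B : prenex n k) (M : pvmodel n) (e : nat -> M) :
  (sat e (pform true (pop2 (@And n) A B)) <->
    sat e (pform true A) /\ sat e (pform true B)) /\
  (sat e (pform true (pop2 (@Or n) A B)) <->
    sat e (pform true A) \/ sat e (pform true B)).
Proof.
have [h1 h2] := interp_pop2 true A B e.
have g (C : prenex n k) : gval (interp true C e) <-> sat e (pform true C).
  exact: (@gval_interp n M k true C e).
split; apply: iff_trans (iff_sym (g _)) _.
- apply: iff_trans (gval_geqv h1) _; apply: iff_trans (gval_op _ _ _) _.
  by have := g A; have := g B; rewrite /=; tauto.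
- apply: iff_trans (gval_geqv h2) _; apply: iff_trans (gval_op _ _ _) _.
  by have := g A; have := g B; rewrite /=; tauto.
Qed.

Lemma sat_pmat (A : form n) (M : pvmodel n) (e : nat -> M) :
  sat e (pform true (pmat k A)) <-> sat e A.
Proof. exact: iff_trans (iff_sym (@gval_interp n M k true _ e)) (gval_pmat k A e true). Qed.

Lemma sat_pAnd (Gamma : seq (prenex n k)) (M : pvmodel n) (e : nat -> M) :
  sat e (pform true (pAnd Gamma)) <->
  sat e (foldr (@And n) (Top n) (map (pform true) Gamma)).
Proof.
elim: Gamma => [|A Gamma IH]; first exact: sat_pmat.
by apply: iff_trans (proj1 (sat_pop2 _ _ _)) _; rewrite IH.
Qed.

Lemma sat_pOr (Delta : seq (prenex n k)) (M : pvmodel n) (e : nat -> M) :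
  sat e (pform true (pOr Delta)) <->
  sat e (foldr (@Or n) Bot (map (pform true) Delta)).
Proof.
elim: Delta => [|A Delta IH]; first exact: sat_pmat.
by apply: iff_trans (proj2 (sat_pop2 _ _ _)) _; rewrite IH.
Qed.

Lemma hatPi_pAnd (Gamma : seq (prenex n k)) :
  (forall A, List.In A Gamma -> hatPi A) -> hatPi (pAnd Gamma).
Proof.
elim: Gamma => [|A Gamma IH] h.
  by rewrite /hatPi /in_class /=; elim: k => //=; do 2 constructor.
apply: hatPi_pop2; [exact: sb_and|by apply: h; left|].
by apply: IH => B hB; apply: h; right.
Qed.

Lemma hatPi_pOr (Delta : seq (prenex n k)) :
  (forall A, List.In A Delta -> hatPi A) -> hatPi (pOr Delta).
Proof.
elim: Delta => [|A Delta IH] h.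
  by rewrite /hatPi /in_class /=; elim: k => //=; constructor.
apply: hatPi_pop2; [exact: sb_or|by apply: h; left|].
by apply: IH => B hB; apply: h; right.
Qed.

Lemma dflow_sound (A B : prenex n k) : dflow (@sharply_bounded n) (@PV_ax n) A B ->
  forall M : pvmodel n, models (T_ax k) M -> forall e : nat -> M,
  sat e (pform true A) -> sat e (pform true B).
Proof.
move=> [t [H [E0 [E1 [G0 [G1 [F [hH [_ hA] [hB _] hs]]]]]]]] M hM e sA.
have tt : sat e (Top n) by [].
have H0 : sat (econs 0 e) (pform true H).
  have /(@sat_psub n k true) := dred_sound hA tt sA.
  have -> // : (fun i => eval e (scons 0%pv Var i)) = econs 0 e.
  by apply: functional_extensionality => -[|i] //=; rewrite evalE.
(* The steps of the flow are valid only below [t], so the induction formula carries the condition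
   [u <= t]; as a guard on the matrix it stays in the class. *)
pose P := guard (@Imp n) (Var 0 <= tshift 1 t)%pv H.
have hP : in_class (@sharply_bounded n) P.
  by apply: (@hatPi_guard n k (@Imp n)) => //; [exact: sb_imp|exact: sb_le].
have satP (d : M) : sat (econs d e) (pform true P) <->
    (d <= eval e t -> sat (econs d e) (pform true H)).
  apply: iff_trans (proj1 (sat_guard _ _ _ _)) _.
  by rewrite [sat _ (Le _ _)]/= eval_tshift edrop_econs.
apply: (dred_sound hB tt); apply/(@sat_psub n k true).
have -> : (fun i => eval e (scons t Var i)) = econs (eval e t) e.
  by apply: functional_extensionality => -[|i].
have h0 : sat e (inst 0 (pform true P)).
  by rewrite sat_inst evalE; apply/satP => _; exact: H0.
have es d : (fun i => eval (econs d e) (scons (Var 0 + 1)%pv (fun i => Var i.+1) i)) =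
    econs (d + 1) e.
  by apply: functional_extensionality => -[|i]; rewrite /= ?evalE.
have h1 (d : M) : sat (econs d e) (pform true P ->
    fsub (scons (Var 0 + 1)%pv (fun i => Var i.+1)) (pform true P))%pv.
  move=> /satP hd; rewrite -/(sat _ _) sat_fsub es; apply/satP => hd'.
  have hlt : sat (econs d e) (Var 0 < tshift 1 t)%pv.
    by rewrite [sat _ _]/= !evalE eval_tshift edrop_econs.
  have /(@sat_psub n k true) := dred_sound hs hlt (hd (ltMW hd')).
  by rewrite es.
apply: (proj1 (satP _) _ (leMM _)).
exact: (hM _ (T_ind hP) e (conj h0 h1) (eval e t)).
Qed.


Lemma red_ucase (G c : pred) (X Y : ugame k) : decidable c ->
  representable X -> representable Y ->
  ((forall M e, G M e -> c M e) -> red G X (ucase c X Y) /\ red G (ucase c X Y) X) /\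
  ((forall M e, G M e -> ~ c M e) -> red G Y (ucase c X Y) /\ red G (ucase c X Y) Y).
Proof.
move=> hc hX hY; split=> h; split.
- exact: red_case_intro1.
- exact: red_case_elim1.
- exact: red_case_intro2.
- exact: red_case_elim2.
Qed.

(* A flow only relates its ends by reductions in one direction; inserting [A] and
   [B] themselves as new end points gives equivalences. *)
Lemma flow_ends (A B : ugame k) : representable A -> representable B ->
  flow always A B -> exists (t : value) K, [/\ defv t, representable K,
    red always (at0 (fun _ _ => 0) K) A /\ red always A (at0 (fun _ _ => 0) K),
    red always (at0 t K) B /\ red always B (at0 t K) &
    red (below always t) K (next K)].
Proof.
move=> rA rB [t [H [dt rH hA hB hs]]].
pose z : pred := fun M e => e 0%N = 0.
pose b : pred := fun M e => e 0%N <= t M (edrop 1 e) + 1.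
pose s : transformer n := fun M e => econs (e 0%N - 1) (edrop 1 e).
have dz : decidable z by apply: dec_eq; defs.
have db : decidable b by apply: dec_le; defs.
have ds : defe s by apply: defe_cons; defs.
pose Hs : ugame k := fun M e => H M (s M e).
have rHs : representable Hs by exact: rep_env.
have rAl := rep_lift 1 rA; have rBl := rep_lift 1 rB.
(* Time 0 plays [A], the times from 1 to [t + 1] play [H] delayed by one, and all later times play
   [B]; the total length is therefore [t + 2]. *)
pose K2 := ucase b Hs (lift 1 B); pose K := ucase z (lift 1 A) K2.
have rK2 : representable K2 by exact: rep_case.
have rK : representable K by exact: rep_case.
have K_zero (G : pred) : (forall M e, G M e -> e 0%N = 0) ->
    red G (lift 1 A) K /\ red G K (lift 1 A).
  exact: (proj1 (red_ucase _ dz rAl rK2)).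
have K_mid (G : pred) : (forall M e, G M e -> e 0%N <> 0 /\ b M e) ->
    red G Hs K /\ red G K Hs.
  move=> h; have [h1 h2] := proj2 (red_ucase G dz rAl rK2) (fun M e g => proj1 (h M e g)).
  have [h3 h4] := proj1 (red_ucase G db rHs rBl) (fun M e g => proj2 (h M e g)).
  by split; [exact: red_trans h3 h1|exact: red_trans h2 h4].
have K_last (G : pred) : (forall M e, G M e -> e 0%N <> 0 /\ ~ b M e) ->
    red G (lift 1 B) K /\ red G K (lift 1 B).
  move=> h; have [h1 h2] := proj2 (red_ucase G dz rAl rK2) (fun M e g => proj1 (h M e g)).
  have [h3 h4] := proj2 (red_ucase G db rHs rBl) (fun M e g => proj2 (h M e g)).
  by split; [exact: red_trans h3 h1|exact: red_trans h2 h4].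
pose T : value := fun M e => t M e + 1 + 1.
have dT : defv T by rewrite /T; defs.
have succ0 (M : pvmodel n) (x : M) : x + 1 <> 0 by apply/posM; exact: leM_addl.
have dn := defe_next n.
exists T, K; split=> //.
- have [h1 h2] := K_zero (fun M e => e 0%N = 0) (fun _ _ => id).
  by split; [apply: (red_env (defe_at (@defv_zero n)) h2)|
    apply: (red_env (defe_at (@defv_zero n)) h1)] => M e _.
- have [M e g|h1 h2] := K_last (fun M e => e 0%N = T M (edrop 1 e)).
    rewrite /b g /T; split; first exact: succ0.
    by move/ltMNge; apply; exact: ltMSn.
  by split; [apply: (red_env (defe_at dT) h2)|apply: (red_env (defe_at dT) h1)] => M e _.
- have [z1 z2] := K_zero (fun M e => below always T e /\ z M e) (fun _ _ => @proj2 _ _).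
  apply: (red_case dz) => //; first exact: rep_env dn rK.
  + apply: red_trans z2 _.
    apply: (@red_trans _ _ _ _ (fun M e => Hs M (econs (e 0%N + 1) (edrop 1 e)))).
      apply: (red_env (defe_drop n 1) hA) => M e [_ ze]; split=> //.
      by rewrite /Hs /s /at0 edrop_econs /= ze addMK.
    have [M e g|h1 _] := K_mid (fun M e => e 0%N = 1).
      by rewrite /b g; split; [exact: oneM_neq0|exact: leM_addl].
    by apply: (red_env dn h1) => M e [_ ze]; split=> //=; rewrite ze add0M.
  + apply: (red_case (c := fun M e => e 0%N <= t M (edrop 1 e))) => //.
    * by apply: dec_le; defs.
    * exact: rep_env dn rK.
    * have [M e [[_ h1] h2]|_ h1] := K_mid (fun M e =>
        (below always T e /\ ~ z M e) /\ e 0%N <= t M (edrop 1 e)).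
        by split=> //; apply: leM_trans h2 (leM_addr _ _).
      apply: red_trans h1 _.
      apply: (@red_trans _ _ _ _ (fun M e => Hs M (econs (e 0%N + 1) (edrop 1 e)))).
        apply: (red_env ds hs) => M e [[_ h1] h2].
        have e1 : e 0%N - 1 + 1 = e 0%N by apply: subMK; apply/posM.
        rewrite /below /s /Hs /next /s !edrop_econs /= e1 addMK; split=> //.
      have [M e g|h2 _] := K_mid (fun M e => e 0%N <> 0 /\ b M e); first by [].
      apply: (red_env dn h2) => M e [_ h3]; split=> //; split; first exact: succ0.
      by rewrite /b edrop_econs /=; apply/leM_add2r.
    * have [M e [[[_ h1] h2] h3]|_ h1] := K_mid (fun M e =>
        (below always T e /\ ~ z M e) /\ ~ e 0%N <= t M (edrop 1 e)).
        by split=> //; apply/ltMS.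
      apply: red_trans h1 _; apply: (@red_trans _ _ _ _ (lift 1 B)).
        apply: (red_env (defe_drop n 1) hB) => M e [[[_ h1] h2] h3]; split=> //.
        rewrite /at0 /Hs /s; congr H; congr econs.
        have -> : e 0%N = t M (edrop 1 e) + 1; last by rewrite addMK.
        by apply: leM_anti; [apply/ltMS|apply/ltMNge].
      have [M e g|h2 _] := K_last (fun M e => e 0%N <> 0 /\ ~ b M e); first by [].
      apply: (red_env dn h2) => M e [_ h3]; split=> //; split; first exact: succ0.
      by rewrite /b edrop_econs /= => /leM_add2r.
Qed.

Lemma dflow_of_flow (A B : prenex n k) : hatPi A -> hatPi B ->
  flow always (interp true A) (interp true B) ->
  dflow (@sharply_bounded n) (@PV_ax n) A B.
Proof.
move=> hA hB h.
have [t [K [[u hu] [N rK] [a1 a2] [b1 b2] hs]]] :=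
  flow_ends (representable_interp true hA) (representable_interp true hB) h.
have [H [hH _ hK]] := rep_prenex true rK.
have sub s (M : pvmodel n) (e e' : nat -> M) : e' = (fun i => eval e (s i)) ->
    geqv (K M e') (interp true (psub s H) e).
  move=> ->; exact: geqv_trans (hK _ _) (geqv_sym (interp_psub _ _ _ _)).
have e0 (M : pvmodel n) (e : nat -> M) :
    econs 0 e = fun i => eval e (scons 0%pv Var i).
  by apply: functional_extensionality => -[|i] //=; rewrite evalE.
have et (M : pvmodel n) (e : nat -> M) :
    econs (t M e) e = fun i => eval e (scons u Var i).
  by apply: functional_extensionality => -[|i] //=; rewrite hu.
have en (M : pvmodel n) (e : nat -> M) : econs (e 0%N + 1) (edrop 1 e) =
    fun i => eval e (scons (Var 0 + 1)%pv (fun i => Var i.+1) i).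
  by apply: functional_extensionality => -[|i] //=; rewrite !evalE.
have conv (C D : prenex n k) : hatPi C -> hatPi D -> red always (interp true C) (interp true D) ->
    exists F, dred (@PV_ax n) F true (Top n) C D.
  by move=> hC hD r; apply: (@dred_of_red n k true _ _ _ hC hD); apply: (red_weak _ r).
have h0 := hatPi_psub (scons 0%pv Var) hH; have ht := hatPi_psub (scons u Var) hH.
have [|E0 hE0] := conv (psub (scons 0%pv Var) H) A h0 hA.
  by apply: red_ext a1 => M e g; split=> //; [exact: sub|exact: geqv_refl].
have [|E1 hE1] := conv A (psub (scons 0%pv Var) H) hA h0.
  by apply: red_ext a2 => M e g; split=> //; [exact: geqv_refl|exact: sub].
have [|G0 hG0] := conv (psub (scons u Var) H) B ht hB.
  by apply: red_ext b1 => M e g; split=> //; [exact: sub|exact: geqv_refl].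
have [|G1 hG1] := conv B (psub (scons u Var) H) hB ht.
  by apply: red_ext b2 => M e g; split=> //; [exact: geqv_refl|exact: sub].
have [|||F hF] := @dred_of_red n k true (Var 0 < tshift 1 u)%pv H
  (psub (scons (Var 0 + 1)%pv (fun i => Var i.+1)) H) => //.
- exact: hatPi_psub.
- apply: red_ext hs => M e; rewrite [sat _ _]/= !evalE eval_tshift -hu => hlt.
  by split=> //; exact: sub.
by exists u, H, E0, E1, G0, G1, F.
Qed.

Lemma derivability_iff_flow (Gamma Delta : seq (prenex n k)) :
  (forall A, List.In A (Gamma ++ Delta) -> hatPi A) ->
  proves_seq (T_ax (n:=n) k) (map (pform true) Gamma) (map (pform true) Delta) <->
  dflow_seq (@sharply_bounded n) (@PV_ax n) Gamma Delta.
Proof.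
move=> hGD.
have hG : hatPi (pAnd Gamma).
  by apply: hatPi_pAnd => A hA; apply: hGD; apply/List.in_app_iff; left.
have hD : hatPi (pOr Delta).
  by apply: hatPi_pOr => A hA; apply: hGD; apply/List.in_app_iff; right.
split=> [/provesP h|h]; last first.
  (* T^k_n contains the axioms of PV, so its models are among those for which reductions are
     sound. *)
  apply/provesP => M hM e; pose M' := @PVModel n M (fun A hA => hM A (T_pv k hA)).
  rewrite [sat _ _]/= => hg; apply: (proj1 (@sat_pOr Delta M' e)).
  by apply: (dflow_sound h (M := M') hM); apply: (proj2 (@sat_pAnd Gamma M' e)).
apply: dflow_of_flow => //; apply: NNPP => hf.
have [M [e [hM hA hB]]] := flow_completeness (representable_interp true hG)
  (representable_interp true hD) hf.
apply: hB; apply/(@gval_interp n M k true); apply/sat_pOr.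
apply: (h M hM e); apply/sat_pAnd; exact: (proj1 (@gval_interp n M k true _ e) hA).
Qed.

End Correspondence.

Local Close Scope pvm_scope.

Theorem corollary3p2 :
  (forall (n k : nat) (Gamma Delta : seq (prenex n k)),
     2 <= n ->
     (forall A : prenex n k, List.In A (Gamma ++ Delta) -> hatPi A) ->
     (proves_seq (T_ax (n:=n) k) (map (pform true) Gamma)
                 (map (pform true) Delta)
      <-> dflow_seq (@sharply_bounded n) (@PV_ax n) Gamma Delta))
  /\
  (forall (k : nat) (Gamma Delta : seq (prenex 2 k)),
     (forall A : prenex 2 k, List.In A (Gamma ++ Delta) -> hatPi A) ->
     (proves_seq (T_ax (n:=2) k) (map (pform true) Gamma)
                 (map (pform true) Delta)
      <-> dflow_seq (@sharply_bounded 2) PV Gamma Delta)).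
Proof.
by split=> [n k Gamma Delta _|k Gamma Delta]; exact: derivability_iff_flow.
Qed.
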